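(* Let $N\ge 1$ be an integer and let $k>0$ be a real number. 1. Let $F\in H_N^k(D)$. Then there exist constants $C>0$, $R>0$ and $\delta\in\,]0,1[$ and a sequence $(P_n)_{n\ge 1}$ of $N$-analytic polynomials such that (i) $\|P_n\|_{\infty,D_{k,R,n}}\le C\delta^n$ for every $n\ge 1$; (ii) $\sum_{n=1}^{+\infty}P_n(z)=F(z)$ for every $z\in D$; (iii) $d^\circ(P_n)\le n^{\frac{k+1}{k}}$ for every $n\ge 1$. 2. Conversely, let $(f_n)_{n\ge 1}$ be a sequence of $N$-analytic polynomials such that $\|f_n\|_{\infty,D_{k,R,n}}\le C\delta^n$ for every $n\ge 1$, for some constants $C>0$, $R>0$ and $\delta\in\,]0,1[$. Then the function series $\sum f_n$ converges uniformly on $D$ to a function $f\in H_N^k(D)$.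
   Context: $D=\{z\in\mathbb{C}:|z|<1\}$. For $R,k>0$ and an integer $n\ge1$, $D_{k,R,n}$ is the open disk of center $0$ and radius $1+Rn^{-1/k}$. For a function $h$ on a nonempty set $E\subset\mathbb{C}$, $\|h\|_{\infty,E}=\sup_{u\in E}|h(u)|$. With $z=x+iy$, $\frac{\partial}{\partial\overline z}=\frac12\left(\frac{\partial}{\partial x}+i\frac{\partial}{\partial y}\right)$, and for $\alpha=(\alpha_1,\alpha_2)\in\mathbb{N}^2$ (with $0\in\mathbb{N}$), $|\alpha|=\alpha_1+\alpha_2$ and $D^\alpha=\frac{\partial^{|\alpha|}}{\partial x^{\alpha_1}\partial y^{\alpha_2}}$. $H_N(D)$ (polyanalytic functions of order $N$ on $D$) is the set of functions $F:D\to\mathbb{C}$ of class $C^N$ with $\left(\frac{\partial}{\partial\overline z}\right)^NF=0$ on $D$; such functions are automatically $C^\infty$. The Gevrey polyanalytic class $H_N^k(D)$ is the set of $f\in H_N(D)$ for which there is a constant $B>0$ with $\|D^\alpha f\|_{\infty,D}\le B^{|\alpha|+1}|\alpha|^{(1+\frac1k)|\alpha|}$ for all $\alpha\in\mathbb{N}^2$ (convention $0^0=1$). An $N$-analytic polynomial is a function $P:\mathbb{C}\to\mathbb{C}$ of the form $P(z)=\sum_{p=0}^{N-1}Q_p(z)\overline z^{\,p}$ with $Q_0,\dots,Q_{N-1}$ holomorphic polynomials (they are uniquely determined by $P$). For $P\neq0$ its degree is $d^\circ(P)=\max\{\deg Q_p: 0\le p\le N-1,\ Q_p\ne0\}$,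 and $d^\circ(0)=-\infty$. *)

(* Defs.v *)
From Stdlib Require Import Reals.
From Coquelicot Require Import Coquelicot.

Open Scope R_scope.

Definition disk (r : R) (z : C) : Prop := Cmod z < r.

Definition unit_disk : C -> Prop := disk 1.

Definition disk_kRn (k Rad : R) (n : nat) : C -> Prop :=
  disk (1 + Rad * Rpower (INR n) (- (1 / k))).

(* Takes the value [p_infty] when [h] is unbounded on [E]. *)
Definition sup_norm (E : C -> Prop) (h : C -> C) : Rbar :=
  Lub_Rbar (fun r => exists u, E u /\ r = Cmod (h u)).

(* A function on an open set [U] is represented by a total function [C -> C]
   of which only the values on [U] are used; continuity and partial
   derivatives at a point of [U] are local, hence do not see the values
   outside [U]. Since [Derive] is real-valued, derivatives are taken on the
   real and imaginary parts of the values. *)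

Definition ex_partial_x (f : C -> C) (z : C) : Prop :=
  ex_derive (fun t : R => Re (f (t, Im z))) (Re z) /\
  ex_derive (fun t : R => Im (f (t, Im z))) (Re z).

Definition ex_partial_y (f : C -> C) (z : C) : Prop :=
  ex_derive (fun t : R => Re (f (Re z, t))) (Im z) /\
  ex_derive (fun t : R => Im (f (Re z, t))) (Im z).

Definition partial_x (f : C -> C) (z : C) : C :=
  (Derive (fun t : R => Re (f (t, Im z))) (Re z),
   Derive (fun t : R => Im (f (t, Im z))) (Re z)).

Definition partial_y (f : C -> C) (z : C) : C :=
  (Derive (fun t : R => Re (f (Re z, t))) (Im z),
   Derive (fun t : R => Im (f (Re z, t))) (Im z)).

Fixpoint class_C (n : nat) (U : C -> Prop) (f : C -> C) : Prop :=
  (forall z : C, U z -> continuous f z) /\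
  match n with
  | O => True
  | S m =>
      (forall z : C, U z -> ex_partial_x f z /\ ex_partial_y f z) /\
      class_C m U (partial_x f) /\ class_C m U (partial_y f)
  end.

Definition dbar (f : C -> C) (z : C) : C :=
  (/ 2 * (partial_x f z + Ci * partial_y f z))%C.

Definition partial_alpha (a1 a2 : nat) (f : C -> C) : C -> C :=
  Nat.iter a1 partial_x (Nat.iter a2 partial_y f).

Definition polyanalytic (N : nat) (U : C -> Prop) (f : C -> C) : Prop :=
  class_C N U f /\ forall z : C, U z -> Nat.iter N dbar f z = 0%C.

(* For [a1 + a2 = 0] the factor [Rpower (INR 0) _] is [exp 0 = 1], which agrees
   with the convention [0^0 = 1]. The total operator [partial_alpha] gives
   genuine derivatives at every order because a polyanalytic function is
   smooth. *)
Definition gevrey_polyanalytic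
    (N : nat) (k : R) (U : C -> Prop) (f : C -> C) : Prop :=
  polyanalytic N U f /\
  exists B : R, 0 < B /\
    forall a1 a2 : nat,
      Rbar_le (sup_norm U (partial_alpha a1 a2 f))
        (Finite (B ^ (a1 + a2 + 1) *
                 Rpower (INR (a1 + a2)) ((1 + 1 / k) * INR (a1 + a2)))).

Definition has_coeffs (Q : C -> C) (d : nat) (a : nat -> C) : Prop :=
  forall z : C, Q z = sum_n (fun j => (a j * z ^ j)%C) d.

Definition holo_poly (Q : C -> C) : Prop :=
  exists (d : nat) (a : nat -> C), has_coeffs Q d a.

(* Holds of no [d] when [Q] is the zero polynomial. *)
Definition holo_poly_degree (Q : C -> C) (d : nat) : Prop :=
  exists a : nat -> C, has_coeffs Q d a /\ a d <> 0%C.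

(* [sum_n _ (pred N)] runs over [0 <= p <= N - 1]; only [1 <= N] is meaningful. *)
Definition analytic_decomp (N : nat) (P : C -> C) (Q : nat -> C -> C) : Prop :=
  (forall p : nat, (p < N)%nat -> holo_poly (Q p)) /\
  forall z : C, P z = sum_n (fun p => (Q p z * Cconj z ^ p)%C) (pred N).

Definition analytic_poly (N : nat) (P : C -> C) : Prop :=
  exists Q : nat -> C -> C, analytic_decomp N P Q.

(* The components [Q p], [p < N], are determined by [P], so this is the supremum
   of the finite set of degrees of the nonzero ones: their maximum if [P] is
   nonzero, and [m_infty], the supremum of the empty set, if [P] is zero. *)
Definition analytic_degree (N : nat) (P : C -> C) : Rbar :=
  Lub_Rbar (fun r => exists (Q : nat -> C -> C) (p d : nat),
    analytic_decomp N P Q /\ (p < N)%nat /\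
    holo_poly_degree (Q p) d /\ r = INR d).

Definition series_CVU_on (U : C -> Prop) (u : nat -> C -> C) (f : C -> C) : Prop :=
  forall eps : R, 0 < eps ->
    exists n0 : nat, forall n : nat, (n0 <= n)%nat ->
      forall z : C, U z ->
        Cmod (sum_n_m (fun j => u j z) 1 n - f z)%C < eps.

(* Main.v *)
Require Import Defs.
From Stdlib Require Import Reals Lra Lia Arith List FunctionalExtensionality.
From Stdlib Require Import IndefiniteDescription.
From Coquelicot Require Import Coquelicot.

Open Scope R_scope.

(** Both halves rest on a description of the Gevrey polyanalytic class by
    coefficients. Put [s = 1 + 1 / k]. A polyanalytic function of order [N] on
    the unit disk has an expansion
    [F z = sum_(p < N) conj z ^ p * sum_j c p j * z ^ j], and [F] satisfies the
    Gevrey estimates iff [|c p j| <= L * exp (- a * (j + 1) ^ (1 / s))] for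
    some [a > 0].

    The expansion ([polyanalytic_expansion]) is obtained by induction on [N],
    since [dbar ^ (N - 1) F] is holomorphic. For [N = 1] it is Cauchy's formula
    ([cauchy_expansion]): the integral over [t] of
    [f (z + u * (e - z)) * e / (e - z)], with [e = r * exp (i t)], does not
    depend on [u] in [[0, 1]], because its derivative in [u] is, up to a
    factor, the integral of a derivative in [t]. On the coefficients, the
    partial derivatives act as commuting algebraic operators ([ax], [ay]).

    On a circle of radius [r] one has [conj z = r ^ 2 / z], so a polyanalytic
    function times [z ^ N] coincides there with a power series, whose
    terms, of modulus [|sum_p c p (l + p) * r ^ (l + N + 2 p)|], are bounded by
    means of Fourier integrals ([pser_fourier_bound]). This is used in two ways.
    Letting [r] tend to [1] for [dbar ^ p] of the [m]-th complex derivative,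
    and descending on [p], one gets
    [|c p j| * j! / (j - m)! <= K * B ^ m * (m + N) ^ (s * (m + N))] from the
    Gevrey estimates ([coef_of_der_bound]); the choice of [m] of the order of
    [j ^ (1 / s)] gives the decay ([decay_of_ratio_bound]). For a function that
    is only bounded, interpolation at [N] radii separates the components
    ([pser_coef_bound]).

    Decomposition: [P n] collects the monomials with
    [(n - 1) ^ s < j <= n ^ s]. Their coefficients are [O (exp (- a * (n - 1)))],
    while [|z| ^ j <= exp (Rad * n)] on the disk of radius
    [1 + Rad * n ^ (- 1 / k)], because [n ^ s * n ^ (- 1 / k) = n].

    Converse: [pser_coef_bound] bounds the coefficients of [f n], after
    absorption of a power of [n] ([poly_exp_bound]), by
    [L * exp (- b * n) * (1 + Rad' * n ^ (- 1 / k)) ^ (- j)], hence by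
    [L' * exp (- b' * n) * exp (- a * (j + 1) ^ (1 / s))] ([geometric_wt]). The
    sums over [n] of the coefficients therefore decay as required, and
    termwise differentiation gives the Gevrey estimates
    ([gevrey_of_decay]). *)


(** * Finite sums and absolutely convergent series of complex numbers *)

(** The sum of [f j] over [0 <= j < n]. *)
Fixpoint csum (n : nat) (f : nat -> C) : C :=
  match n with O => 0%C | S m => (csum m f + f m)%C end.

Lemma csum_ext n (f g : nat -> C) :
  (forall j, (j < n)%nat -> f j = g j) -> csum n f = csum n g.
Proof.
  induction n as [|n IH]; simpl; intros H; [easy|].
  rewrite IH, H; auto with arith.
Qed.

Lemma csum_plus n f g :
  csum n (fun j => (f j + g j)%C) = (csum n f + csum n g)%C.
Proof. induction n as [|n IH]; simpl; [|rewrite IH]; ring. Qed.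

Lemma csum_scal n c f : csum n (fun j => (c * f j)%C) = (c * csum n f)%C.
Proof. induction n as [|n IH]; simpl; [|rewrite IH]; ring. Qed.

Lemma csum_0 n (f : nat -> C) : (forall j, (j < n)%nat -> f j = 0%C) -> csum n f = 0%C.
Proof.
  induction n as [|n IH]; simpl; intros H; [easy|].
  rewrite IH, H; auto with arith. ring.
Qed.

Lemma csum_single n (f : nat -> C) i : (i < n)%nat ->
  (forall j, (j < n)%nat -> j <> i -> f j = 0%C) -> csum n f = f i.
Proof.
  induction n as [|n IH]; simpl; intros Hi H; [lia|].
  destruct (Nat.eq_dec i n) as [->|Hn].
  - rewrite csum_0; [ring|]. intros j Hj. apply H; lia.
  - rewrite IH, (H n); try lia; [ring|]. intros j Hj Hji; apply H; lia.
Qed.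

Lemma csum_split n m f :
  csum (n + m) f = (csum n f + csum m (fun j => f (n + j)%nat))%C.
Proof.
  induction m as [|m IH]; simpl.
  - rewrite Nat.add_0_r; ring.
  - rewrite Nat.add_succ_r; simpl; rewrite IH; ring.
Qed.

Lemma csum_shift n f : csum (S n) f = (f O + csum n (fun j => f (S j)))%C.
Proof. rewrite (csum_split 1 n); simpl; ring. Qed.

Lemma csum_bound n f M : (forall j, (j < n)%nat -> Cmod (f j) <= M) ->
  Cmod (csum n f) <= INR n * M.
Proof.
  induction n as [|n IH]; intros H; [simpl; rewrite Cmod_0; lra|].
  rewrite S_INR; simpl csum.
  eapply Rle_trans; [apply Cmod_triangle|].
  assert (Cmod (csum n f) <= INR n * M) by (apply IH; auto with arith).
  specialize (H n (Nat.lt_succ_diag_r n)); lra.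
Qed.

Lemma sum_n_csum n f : sum_n f n = csum (S n) f.
Proof.
  induction n as [|n IH].
  - rewrite sum_O; simpl. symmetry; apply Cplus_0_l.
  - rewrite sum_Sn, IH; reflexivity.
Qed.

Lemma Re_csum n f : Re (csum (S n) f) = sum_n (fun j => Re (f j)) n.
Proof.
  induction n as [|n IH].
  - rewrite sum_O; cbn [csum]; now rewrite Cplus_0_l.
  - rewrite sum_Sn, <- IH; reflexivity.
Qed.

Lemma Im_csum n f : Im (csum (S n) f) = sum_n (fun j => Im (f j)) n.
Proof.
  induction n as [|n IH].
  - rewrite sum_O; cbn [csum]; now rewrite Cplus_0_l.
  - rewrite sum_Sn, <- IH; reflexivity.
Qed.

Lemma im_le_Cmod c : Rabs (Im c) <= Cmod c.
Proof.
  eapply Rle_trans; [|apply Rmax_Cmod]. apply Rmax_r.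
Qed.

Lemma Cmod_le_ReIm c : Cmod c <= Rabs (Re c) + Rabs (Im c).
Proof.
  replace c with (RtoC (Re c) + Ci * RtoC (Im c))%C at 1
    by (destruct c; unfold Ci, RtoC; simpl; apply injective_projections; simpl; ring).
  eapply Rle_trans; [apply Cmod_triangle|].
  rewrite Cmod_mult, !Cmod_R, Cmod_Ci; lra.
Qed.

Lemma Cmod_triangle_inv a b : Cmod a - Cmod b <= Cmod (a - b).
Proof.
  assert (H := Cmod_triangle (a - b) b).
  replace (a - b + b)%C with a in H by ring; lra.
Qed.

Lemma Cmod_minus_sym a b : Cmod (a - b) = Cmod (b - a).
Proof. rewrite <- Cmod_opp; f_equal; ring. Qed.

(** Sum of an absolutely convergent series; the value is meaningful when
    [asum] holds. *)
Definition CSer (a : nat -> C) : C :=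
  (Series (fun j => Re (a j)), Series (fun j => Im (a j))).

(** Absolute convergence. *)
Definition asum (a : nat -> C) : Prop := ex_series (fun j => Cmod (a j)).

Lemma ex_series_Rle (a b : nat -> R) :
  (forall n, 0 <= a n <= b n) -> ex_series b -> ex_series a.
Proof.
  intros H Hb. apply (ex_series_le a b); auto.
  intros n. unfold norm; simpl; unfold abs; simpl.
  rewrite Rabs_pos_eq; apply H.
Qed.

Lemma ex_series_Rscal (c : R) (a : nat -> R) :
  ex_series a -> ex_series (fun n => c * a n).
Proof. intros H. exact (ex_series_scal_l c a H). Qed.

Lemma asum_le a (b : nat -> R) :
  (forall n, Cmod (a n) <= b n) -> ex_series b -> asum a.
Proof.
  intros H. apply ex_series_Rle. intros n; split; [apply Cmod_ge_0|easy].
Qed.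

Lemma asum_Re a : asum a -> ex_series (fun j => Re (a j)).
Proof.
  intros H. apply ex_series_Rabs. revert H. apply ex_series_Rle.
  intros n; split; [apply Rabs_pos|apply re_le_Cmod].
Qed.

Lemma asum_Im a : asum a -> ex_series (fun j => Im (a j)).
Proof.
  intros H. apply ex_series_Rabs. revert H. apply ex_series_Rle.
  intros n; split; [apply Rabs_pos|apply im_le_Cmod].
Qed.

Lemma asum_plus a b : asum a -> asum b -> asum (fun j => (a j + b j)%C).
Proof.
  intros Ha Hb. eapply asum_le; [|apply (ex_series_plus _ _ Ha Hb)].
  intros n; apply Cmod_triangle.
Qed.

Lemma asum_scal c a : asum a -> asum (fun j => (c * a j)%C).
Proof.
  intros Ha. eapply asum_le; [|apply (ex_series_scal (Cmod c) _ Ha)].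
  intros n; rewrite Cmod_mult; apply Rle_refl.
Qed.

Lemma asum_incr a n : asum a -> asum (fun j => a (n + j)%nat).
Proof. intros H. apply (ex_series_incr_n (fun j => Cmod (a j)) n), H. Qed.

Lemma CSer_ext a b : (forall j, a j = b j) -> CSer a = CSer b.
Proof. intros H. f_equal. now apply functional_extensionality. Qed.

Lemma CSer_plus a b : asum a -> asum b ->
  CSer (fun j => (a j + b j)%C) = (CSer a + CSer b)%C.
Proof.
  intros Ha Hb. apply injective_projections; simpl.
  - rewrite <- Series_plus; auto using asum_Re.
  - rewrite <- Series_plus; auto using asum_Im.
Qed.

Lemma CSer_scal c a : asum a -> CSer (fun j => (c * a j)%C) = (c * CSer a)%C.
Proof.
  intros Ha. assert (HR := asum_Re _ Ha). assert (HI := asum_Im _ Ha).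
  apply injective_projections; simpl.
  - rewrite <- !Series_scal_l, <- Series_minus;
      [easy| |]; now apply ex_series_Rscal.
  - rewrite <- !Series_scal_l, <- Series_plus;
      [easy| |]; now apply ex_series_Rscal.
Qed.

Lemma CSer_incr_1 a : asum a -> CSer a = (a O + CSer (fun j => a (S j)))%C.
Proof.
  intros Ha. apply injective_projections; simpl.
  - rewrite Series_incr_1; auto using asum_Re.
  - rewrite Series_incr_1; auto using asum_Im.
Qed.

Lemma CSer_incr_n a n : asum a ->
  CSer a = (csum n a + CSer (fun j => a (n + j)%nat))%C.
Proof.
  intros Ha. induction n as [|n IH].
  - cbn [csum]. now rewrite Cplus_0_l.
  - rewrite IH, (CSer_incr_1 (fun j => a (n + j)%nat)) by now apply asum_incr.
    simpl csum. rewrite Nat.add_0_r, Cplus_assoc. f_equal.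
    apply CSer_ext; intros j; f_equal; lia.
Qed.

(** Convergence of a sequence of complex numbers. *)
Definition Clim (u : nat -> C) (l : C) : Prop :=
  forall eps, 0 < eps -> exists n0, forall n, (n0 <= n)%nat -> Cmod (u n - l) < eps.

Lemma CSer_lim a : asum a -> Clim (fun n => csum n a) (CSer a).
Proof.
  intros Ha eps He.
  assert (HR := Series_correct _ (asum_Re _ Ha)).
  assert (HI := Series_correct _ (asum_Im _ Ha)).
  assert (He2 : 0 < eps / 2) by lra.
  destruct (proj2 (is_lim_seq_spec _ (Finite _)) HR (mkposreal _ He2)) as [n1 H1].
  destruct (proj2 (is_lim_seq_spec _ (Finite _)) HI (mkposreal _ He2)) as [n2 H2].
  exists (S (n1 + n2)). intros [|n] Hn; [lia|].
  specialize (H1 n ltac:(lia)). specialize (H2 n ltac:(lia)).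
  rewrite <- Re_csum in H1. rewrite <- Im_csum in H2. simpl pos in H1, H2.
  eapply Rle_lt_trans; [apply Cmod_le_ReIm|].
  change (Rabs (Re (csum (S n) a) - Series (fun j => Re (a j))) +
    Rabs (Im (csum (S n) a) - Series (fun j => Im (a j))) < eps).
  lra.
Qed.

Lemma Clim_unique u l l' : Clim u l -> Clim u l' -> l = l'.
Proof.
  intros H H'.
  assert (E : Cmod (l - l') = 0).
  { apply Rle_antisym; [|apply Cmod_ge_0]. apply le_epsilon; intros eps He.
    destruct (H (eps/2)) as [n Hn]; [lra|]. destruct (H' (eps/2)) as [m Hm]; [lra|].
    specialize (Hn (n+m)%nat ltac:(lia)). specialize (Hm (n+m)%nat ltac:(lia)).
    set (w := u (n + m)%nat) in *.
    replace (l - l')%C with (- (w - l) + (w - l'))%C by ring.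
    eapply Rle_trans; [apply Cmod_triangle|]. rewrite Cmod_opp. lra. }
  apply Cmod_eq_0 in E. replace l with (l - l' + l')%C by ring. rewrite E; ring.
Qed.

Lemma Clim_bound u l M : Clim u l -> (forall n, Cmod (u n) <= M) -> Cmod l <= M.
Proof.
  intros H HM. apply le_epsilon; intros eps He.
  destruct (H eps He) as [n Hn]. specialize (Hn n (Nat.le_refl n)).
  specialize (HM n). rewrite Cmod_minus_sym in Hn.
  assert (HT := Cmod_triangle_inv l (u n)). lra.
Qed.

Lemma csum_le_Series a n : asum a ->
  Cmod (csum n a) <= Series (fun j => Cmod (a j)).
Proof.
  intros Ha. assert (Hp : forall b, ex_series b -> (forall j : nat, 0 <= b j) -> 0 <= Series b).
  { intros b Hb Hb0. rewrite <- (Rmult_0_l (Series b)).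
    rewrite <- Series_scal_l. apply Series_le; [|easy].
    intros j; specialize (Hb0 j); lra. }
  revert a Ha. induction n as [|n IH]; intros a Ha.
  - simpl. rewrite Cmod_0. apply Hp; [easy|]. intros; apply Cmod_ge_0.
  - rewrite csum_shift, Series_incr_1 by easy.
    eapply Rle_trans; [apply Cmod_triangle|]. apply Rplus_le_compat_l, IH.
    exact (asum_incr _ 1 Ha).
Qed.

Lemma CSer_bound a : asum a -> Cmod (CSer a) <= Series (fun j => Cmod (a j)).
Proof.
  intros Ha. eapply Clim_bound; [now apply CSer_lim|].
  intros n. now apply csum_le_Series.
Qed.

Lemma CSer_bound_le a b : (forall n, Cmod (a n) <= b n) -> ex_series b ->
  Cmod (CSer a) <= Series b.
Proof.
  intros H Hb. eapply Rle_trans; [apply CSer_bound; now apply asum_le with b|].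
  apply Series_le; [|easy]. intros n; split; [apply Cmod_ge_0|easy].
Qed.

Lemma Clim_is_series a l : Clim (fun n => csum n a) l -> is_series a l.
Proof.
  intros H. apply filterlim_locally. intros eps.
  destruct (H eps (cond_pos eps)) as [n0 Hn]. exists n0. intros n Hle.
  apply C_NormedModule_mixin_compat1. rewrite sum_n_csum.
  apply Hn; lia.
Qed.

Lemma CSer_finite (a : nat -> C) J : (forall j, (J <= j)%nat -> a j = 0%C) ->
  asum a /\ CSer a = csum J a.
Proof.
  intros H.
  assert (Ha : asum a).
  { apply (ex_series_incr_n (fun j => Cmod (a j)) J).
    apply ex_series_ext with (fun j => 0 * (1/2)^j).
    - intros n; rewrite H by lia. now rewrite Cmod_0, Rmult_0_l.
    - apply ex_series_Rscal, ex_series_geom.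
      rewrite Rabs_pos_eq; lra. }
  split; [easy|]. apply (Clim_unique (fun n => csum n a)); [now apply CSer_lim|].
  intros eps He. exists J. intros n Hn. replace n with (J + (n - J))%nat by lia.
  rewrite csum_split, (csum_0 (n - J)).
  - replace (csum J a + 0 - csum J a)%C with (RtoC 0) by ring. now rewrite Cmod_0.
  - intros j _; apply H; lia.
Qed.

(** * Complex power series *)

(** Sum at [z] of the power series with coefficients [a]. *)
Definition cps (a : nat -> C) (z : C) : C := CSer (fun j => (a j * z ^ j)%C).

(** The power series with coefficients [a] converges in the open disk of radius
    [rho], expressed by the boundedness of its terms on smaller circles. *)
Definition Conv (rho : R) (a : nat -> C) : Prop :=
  forall r, 0 < r < rho -> exists K, forall j, Cmod (a j) * r ^ j <= K.

Lemma Conv_ex rho a r : Conv rho a -> 0 <= r < rho ->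
  ex_series (fun j => Cmod (a j) * r ^ j).
Proof.
  intros H Hr. destruct (H ((r + rho) / 2)) as [K HK]; [lra|].
  set (r' := (r + rho) / 2) in *. assert (Hr' : r < r') by (unfold r'; lra).
  apply ex_series_Rle with (fun j => K * (r / r') ^ j).
  - intros j. split; [apply Rmult_le_pos; [apply Cmod_ge_0|apply pow_le; lra]|].
    replace (r ^ j) with (r' ^ j * (r / r') ^ j)
      by (rewrite <- Rpow_mult_distr; f_equal; field; lra).
    rewrite <- Rmult_assoc. apply Rmult_le_compat_r, HK.
    apply pow_le, Rdiv_le_0_compat; lra.
  - apply ex_series_Rscal, ex_series_geom.
    rewrite Rabs_pos_eq; [|apply Rdiv_le_0_compat; lra].
    apply Rmult_lt_reg_r with r'; [lra|]. unfold Rdiv.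
    rewrite Rmult_assoc, Rinv_l; lra.
Qed.

Lemma Conv_asum rho a z : Conv rho a -> Cmod z < rho ->
  asum (fun j => (a j * z ^ j)%C).
Proof.
  intros H Hz. assert (H1 := Conv_ex rho a (Cmod z) H (conj (Cmod_ge_0 z) Hz)).
  revert H1. apply ex_series_ext. intros n. now rewrite Cmod_mult, Cmod_pow.
Qed.

Lemma Conv_le rho rho' a : rho' <= rho -> Conv rho a -> Conv rho' a.
Proof. intros Hle H r Hr; apply H; lra. Qed.

Lemma Conv_plus rho a b : Conv rho a -> Conv rho b ->
  Conv rho (fun j => (a j + b j)%C).
Proof.
  intros Ha Hb r Hr. destruct (Ha r Hr) as [K HK], (Hb r Hr) as [L HL].
  exists (K + L). intros j. specialize (HK j). specialize (HL j).
  assert (Cmod (a j + b j) * r ^ j <= (Cmod (a j) + Cmod (b j)) * r ^ j); [|lra].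
  apply Rmult_le_compat_r; [apply pow_le; lra|apply Cmod_triangle].
Qed.

Lemma Conv_scal rho c a : Conv rho a -> Conv rho (fun j => (c * a j)%C).
Proof.
  intros Ha r Hr. destruct (Ha r Hr) as [K HK].
  exists (Cmod c * K). intros j. rewrite Cmod_mult, Rmult_assoc.
  apply Rmult_le_compat_l, HK. apply Cmod_ge_0.
Qed.

Lemma Conv_finite rho (a : nat -> C) J : (forall j, (J <= j)%nat -> a j = 0%C) -> Conv rho a.
Proof.
  intros H r Hr.
  assert (G : forall n, exists K, 0 <= K /\ forall j, (j < n)%nat -> Cmod (a j) * r ^ j <= K).
  { induction n as [|n [K [H0 HK]]]; [exists 0; split; [lra|lia]|].
    assert (0 <= Cmod (a n) * r ^ n) by (apply Rmult_le_pos; [apply Cmod_ge_0|apply pow_le; lra]).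
    exists (K + Cmod (a n) * r ^ n). split; [lra|].
    intros j Hj. destruct (Nat.eq_dec j n) as [->|Hn]; [lra|].
    specialize (HK j ltac:(lia)); lra. }
  destruct (G J) as [K [H0 HK]]. exists K. intros j.
  destruct (Nat.lt_ge_cases j J) as [Hj|Hj]; [now apply HK|].
  rewrite H, Cmod_0 by easy. lra.
Qed.

(** Differentiation keeps the disk of convergence, thanks to this bound. *)
Lemma geom_mul_bound q j : 0 <= q < 1 -> INR (S j) * q ^ j <= / (1 - q).
Proof.
  intros Hq.
  assert (E : forall n, (1 - q) * (INR (S n) * q ^ n) <= 1 - q ^ (S n)).
  { induction n as [|n IH]; [simpl; lra|].
    rewrite (S_INR (S n)). simpl pow in *.
    assert (0 <= q ^ n) by (apply pow_le; lra).
    assert (q ^ n <= 1) by (rewrite <- (pow1 n); apply pow_incr; lra).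
    set (N := INR (S n)) in *. set (Q := q ^ n) in *.
    assert (q * ((1 - q) * (N * Q)) <= q * (1 - q * Q)) by (apply Rmult_le_compat_l; lra).
    assert ((1 - q) * (q * Q) <= (1 - q) * 1) by (apply Rmult_le_compat_l; nra).
    lra. }
  specialize (E j). assert (0 <= q ^ (S j)) by (apply pow_le; lra).
  apply Rmult_le_reg_l with (1 - q); [lra|]. rewrite Rinv_r; lra.
Qed.

Lemma Conv_mulS rho a : Conv rho a ->
  Conv rho (fun j => (RtoC (INR (S j)) * a j)%C).
Proof.
  intros Ha r Hr. set (r' := (r + rho) / 2).
  assert (Hr' : r < r') by (unfold r'; lra).
  destruct (Ha r') as [K HK]; [unfold r' in *; lra|].
  assert (Hq : 0 <= r / r' < 1).
  { split; [apply Rdiv_le_0_compat; lra|].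
    apply Rmult_lt_reg_r with r'; [lra|]. unfold Rdiv.
    rewrite Rmult_assoc, Rinv_l; lra. }
  exists (K * / (1 - r / r')). intros j.
  assert (Hb := geom_mul_bound (r / r') j Hq).
  rewrite Cmod_mult, Cmod_R, Rabs_pos_eq by apply pos_INR.
  replace (INR (S j) * Cmod (a j) * r ^ j) with
    ((Cmod (a j) * r' ^ j) * (INR (S j) * (r / r') ^ j)).
  2:{ replace (r ^ j) with (r' ^ j * (r / r') ^ j)
      by (rewrite <- Rpow_mult_distr; f_equal; field; lra). ring. }
  apply Rmult_le_compat; auto.
  - apply Rmult_le_pos; [apply Cmod_ge_0|apply pow_le; lra].
  - apply Rmult_le_pos; [apply pos_INR|apply pow_le; lra].
Qed.

(** Coefficients of the derivative of a power series. *)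
Definition da (a : nat -> C) (j : nat) : C := (RtoC (INR (S j)) * a (S j))%C.

Lemma Conv_shift rho a : Conv rho a -> Conv rho (fun j => a (S j)).
Proof.
  intros Ha r Hr. destruct (Ha r Hr) as [K HK]. exists (K / r). intros j.
  specialize (HK (S j)). simpl in HK.
  apply Rmult_le_reg_r with r; [lra|]. unfold Rdiv.
  rewrite (Rmult_assoc K), Rinv_l, Rmult_1_r by lra.
  eapply Rle_trans; [|apply HK]. right; ring.
Qed.

Lemma Conv_da rho a : Conv rho a -> Conv rho (da a).
Proof.
  intros Ha. assert (H := Conv_plus _ _ _ (Conv_shift _ _ (Conv_mulS _ _ Ha))
    (Conv_scal _ (RtoC (-1)) _ (Conv_shift _ _ Ha))).
  intros r Hr. destruct (H r Hr) as [K HK]. exists K. intros j.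
  specialize (HK j). unfold da.
  replace (RtoC (INR (S j)) * a (S j))%C with
    (RtoC (INR (S (S j))) * a (S j) + RtoC (-1) * a (S j))%C; [easy|].
  rewrite (S_INR (S j)), RtoC_plus. ring.
Qed.

Lemma cps_plus rho a b z : Conv rho a -> Conv rho b -> Cmod z < rho ->
  cps (fun j => (a j + b j)%C) z = (cps a z + cps b z)%C.
Proof.
  intros Ha Hb Hz. unfold cps. rewrite <- CSer_plus; eauto using Conv_asum.
  apply CSer_ext; intros; ring.
Qed.

Lemma cps_scal rho c a z : Conv rho a -> Cmod z < rho ->
  cps (fun j => (c * a j)%C) z = (c * cps a z)%C.
Proof.
  intros Ha Hz. unfold cps. rewrite <- CSer_scal; eauto using Conv_asum.
  apply CSer_ext; intros; ring.
Qed.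

(** First order Taylor estimate for [z ^ j]; the factors [rho ^ 2] and
    [rho ^ j] stand for [rho ^ (j - 2)], which is not available for [j < 2]. *)
Lemma pow_taylor_bound rho z w j : 0 <= rho -> Cmod z <= rho -> Cmod (z + w) <= rho ->
  Cmod ((z + w) ^ j - z ^ j - RtoC (INR j) * w * z ^ (pred j)) * rho ^ 2
  <= INR j ^ 2 * Cmod w ^ 2 * rho ^ j.
Proof.
  intros H0 Hz Hzw. induction j as [|j IH].
  - simpl. replace (1 - 1 - 0 * w * 1)%C with (RtoC 0) by ring.
    rewrite Cmod_0. lra.
  - set (E := ((z + w) ^ j - z ^ j - RtoC (INR j) * w * z ^ (pred j))%C) in *.
    replace ((z + w) ^ S j - z ^ S j - RtoC (INR (S j)) * w * z ^ pred (S j))%C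
      with ((z + w) * E + RtoC (INR j) * (w * w) * z ^ (pred j))%C.
    2:{ rewrite S_INR, RtoC_plus. destruct j as [|j]; unfold E; simpl; ring. }
    assert (H1 : Cmod (RtoC (INR j) * (w * w) * z ^ (pred j)) * rho ^ 2
       <= INR j * Cmod w ^ 2 * rho ^ S j).
    { rewrite !Cmod_mult, Cmod_R, Cmod_pow, Rabs_pos_eq by apply pos_INR.
      destruct j as [|j]; [simpl; lra|].
      change (pred (S j)) with j.
      assert (Cmod z ^ j <= rho ^ j) by (apply pow_incr; split; [apply Cmod_ge_0|easy]).
      assert (0 <= INR (S j)) by apply pos_INR.
      replace (INR (S j) * Cmod w ^ 2 * rho ^ S (S j)) with
        ((INR (S j) * (Cmod w * Cmod w) * rho ^ j) * rho ^ 2) by (simpl; ring).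
      apply Rmult_le_compat_r; [apply pow_le; easy|].
      apply Rmult_le_compat_l; [|easy].
      apply Rmult_le_pos; [easy|]. apply Rmult_le_pos; apply Cmod_ge_0. }
    assert (H2 : Cmod ((z + w) * E) * rho ^ 2 <= rho * (INR j ^ 2 * Cmod w ^ 2 * rho ^ j)).
    { rewrite Cmod_mult, Rmult_assoc. apply Rmult_le_compat; auto using Cmod_ge_0.
      apply Rmult_le_pos; [apply Cmod_ge_0|apply pow_le; easy]. }
    assert (H3 := Cmod_triangle ((z + w) * E) (RtoC (INR j) * (w * w) * z ^ (pred j))).
    assert (H4 : 0 <= rho ^ 2) by (apply pow_le; easy).
    apply (Rmult_le_compat_r _ _ _ H4) in H3.
    eapply Rle_trans; [exact H3|]. rewrite Rmult_plus_distr_r.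
    eapply Rle_trans; [apply Rplus_le_compat; [exact H2|exact H1]|].
    rewrite S_INR. simpl (rho ^ S j).
    assert (0 <= Cmod w ^ 2 * (rho * rho ^ j)).
    { apply Rmult_le_pos; [apply pow_le, Cmod_ge_0|]. apply Rmult_le_pos; [easy|now apply pow_le]. }
    assert (0 <= INR j) by apply pos_INR. nra.
Qed.

(** Uniform first order Taylor estimate for a power series. *)
Lemma cps_taylor rho a r : Conv rho a -> 0 < r < rho ->
  exists K, 0 <= K /\ forall z w, Cmod z <= r -> Cmod (z + w) <= r ->
    Cmod (cps a (z + w) - cps a z - w * cps (da a) z) <= K * Cmod w ^ 2.
Proof.
  intros Ha Hr.
  assert (H2 := Conv_mulS _ _ (Conv_mulS _ _ Ha)).
  assert (Hex := Conv_ex _ _ r H2 ltac:(lra)).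
  assert (Hda := Conv_da _ _ Ha).
  set (b := fun j => Cmod (RtoC (INR (S j)) * (RtoC (INR (S j)) * a j)) * r ^ j) in *.
  exists (Series b / r ^ 2).
  assert (Hr2 : 0 < r ^ 2) by (apply pow_lt; lra).
  split.
  { apply Rdiv_le_0_compat; [|easy]. rewrite <- (Rmult_0_l (Series b)), <- Series_scal_l.
    apply Series_le; [|easy]. intros j.
    assert (0 <= b j) by (apply Rmult_le_pos; [apply Cmod_ge_0|apply pow_le; lra]). lra. }
  intros z w Hz Hzw.
  assert (Hz' : Cmod z < rho) by lra.
  assert (Hs : asum (fun j => (RtoC (INR j) * a j * z ^ pred j)%C)).
  { apply (ex_series_incr_1 (fun j => Cmod _)).
    apply (Conv_asum rho (da a) z Hda Hz'). }
  assert (E : cps (da a) z = CSer (fun j => (RtoC (INR j) * a j * z ^ pred j)%C)).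
  { rewrite (CSer_incr_1 _ Hs). simpl INR at 1. rewrite !Cmult_0_l, Cplus_0_l.
    reflexivity. }
  rewrite E. unfold cps.
  replace (CSer (fun j => a j * (z + w) ^ j) - CSer (fun j => a j * z ^ j) -
    w * CSer (fun j => RtoC (INR j) * a j * z ^ pred j))%C with
    (CSer (fun j => a j * (z + w) ^ j) + (- (1) * CSer (fun j => a j * z ^ j) +
    (- w) * CSer (fun j => RtoC (INR j) * a j * z ^ pred j)))%C by ring.
  assert (A1 := Conv_asum rho a (z + w) Ha ltac:(lra)).
  assert (A2 := Conv_asum rho a z Ha Hz').
  rewrite <- !CSer_scal, <- !CSer_plus; auto using asum_scal, asum_plus.
  replace (Series b / r ^ 2 * Cmod w ^ 2) with (Series b * (Cmod w ^ 2 * / r ^ 2)) by (unfold Rdiv; ring).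
  rewrite <- Series_scal_r.
  apply CSer_bound_le.
  2:{ apply (ex_series_scal_r (Cmod w ^ 2 * / r ^ 2) _ Hex). }
  intros j.
  replace (a j * (z + w) ^ j + (- (1) * (a j * z ^ j) + - w * (RtoC (INR j) * a j * z ^ pred j)))%C
    with (a j * ((z + w) ^ j - z ^ j - RtoC (INR j) * w * z ^ (pred j)))%C by ring.
  rewrite Cmod_mult. unfold b.
  rewrite !Cmod_mult, Cmod_R, Rabs_pos_eq by apply pos_INR.
  assert (HP := pow_taylor_bound r z w j ltac:(lra) Hz Hzw).
  apply Rmult_le_reg_r with (r ^ 2); [easy|].
  rewrite (Rmult_assoc _ (Cmod w ^ 2 * / r ^ 2)), (Rmult_assoc (Cmod w ^ 2)), Rinv_l, Rmult_1_r by lra.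
  rewrite Rmult_assoc.
  apply Rle_trans with (Cmod (a j) * (INR j ^ 2 * Cmod w ^ 2 * r ^ j)).
  { apply Rmult_le_compat_l; [apply Cmod_ge_0|easy]. }
  replace (INR (S j) * (INR (S j) * Cmod (a j)) * r ^ j * Cmod w ^ 2) with
    (Cmod (a j) * (INR (S j) ^ 2 * (Cmod w ^ 2 * r ^ j))) by ring.
  apply Rmult_le_compat_l; [apply Cmod_ge_0|]. rewrite Rmult_assoc.
  apply Rmult_le_compat_r.
  - apply Rmult_le_pos; [apply pow_le, Cmod_ge_0|apply pow_le; lra].
  - apply pow_incr. split; [apply pos_INR|apply le_INR; lia].
Qed.

(** * Partial derivatives and the classes of differentiability *)

(** [l] is the derivative at [t] of the complex-valued function [f] of a real
    variable. *)
Definition Cder (f : R -> C) (t : R) (l : C) : Prop :=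
  is_derive (fun s => Re (f s)) t (Re l) /\ is_derive (fun s => Im (f s)) t (Im l).

Lemma Cder_const c t : Cder (fun _ => c) t 0.
Proof. split; apply (is_derive_const (V := R_NormedModule)). Qed.

Lemma Cder_plus f g t a b : Cder f t a -> Cder g t b ->
  Cder (fun s => (f s + g s)%C) t (a + b)%C.
Proof.
  intros [Hf1 Hf2] [Hg1 Hg2].
  split; simpl; apply (is_derive_plus (V := R_NormedModule)); easy.
Qed.

Lemma Cder_mult f g t a b : Cder f t a -> Cder g t b ->
  Cder (fun s => (f s * g s)%C) t (a * g t + f t * b)%C.
Proof.
  intros [Hf1 Hf2] [Hg1 Hg2]. unfold Re, Im in *.
  assert (M := fun u v => is_derive_mult (K := R_AbsRing) u v t).
  split; simpl.
  - replace (_ + _) with (minus (plus (mult (fst a) (fst (g t))) (mult (fst (f t)) (fst b)))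
      (plus (mult (snd a) (snd (g t))) (mult (snd (f t)) (snd b))))
      by (unfold minus, plus, mult, opp; simpl; ring).
    apply (is_derive_minus (V := R_NormedModule)); apply M; try easy; apply Rmult_comm.
  - replace (_ + _) with (plus (plus (mult (fst a) (snd (g t))) (mult (fst (f t)) (snd b)))
      (plus (mult (snd a) (fst (g t))) (mult (snd (f t)) (fst b))))
      by (unfold minus, plus, mult, opp; simpl; ring).
    apply (is_derive_plus (V := R_NormedModule)); apply M; try easy; apply Rmult_comm.
Qed.

Lemma Cder_pow f t a n : Cder f t a ->
  Cder (fun s => (f s ^ n)%C) t (RtoC (INR n) * f t ^ (pred n) * a)%C.
Proof.
  intros H. induction n as [|n IH].
  - simpl. rewrite !Cmult_0_l. apply Cder_const.
  - assert (H' := Cder_mult _ _ _ _ _ H IH). simpl in H'.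
    replace (RtoC (INR (S n)) * f t ^ pred (S n) * a)%C
      with (a * f t ^ n + f t * (INR n * f t ^ pred n * a))%C; [exact H'|].
    rewrite S_INR, RtoC_plus. destruct n; simpl; ring.
Qed.

Lemma Cder_csum n (f : nat -> R -> C) t (l : nat -> C) :
  (forall p, (p < n)%nat -> Cder (f p) t (l p)) ->
  Cder (fun s => csum n (fun p => f p s)) t (csum n l).
Proof.
  induction n as [|n IH]; intros H; simpl.
  - apply Cder_const.
  - apply Cder_plus; auto.
Qed.

(** A quadratic remainder gives a derivative. *)
Lemma is_derive_quad (f : R -> R) t l K e : 0 < e ->
  (forall h, Rabs h < e -> Rabs (f (t + h) - f t - h * l) <= K * h ^ 2) ->
  is_derive f t l.
Proof.
  intros He H. apply is_derive_Reals. intros eps Heps.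
  assert (HK : 0 < Rabs K + 1) by (assert (0 <= Rabs K) by apply Rabs_pos; lra).
  assert (Hd : 0 < Rmin e (eps / (Rabs K + 1))).
  { apply Rmin_pos; [easy|]. apply Rdiv_lt_0_compat; easy. }
  exists (mkposreal _ Hd). intros h Hh Hlt. simpl in Hlt.
  assert (Hlt1 := Rlt_le_trans _ _ _ Hlt (Rmin_l _ _)).
  assert (Hlt2 := Rlt_le_trans _ _ _ Hlt (Rmin_r _ _)).
  specialize (H h Hlt1).
  replace ((f (t + h) - f t) / h - l) with ((f (t + h) - f t - h * l) / h) by (field; easy).
  assert (Hah : 0 < Rabs h) by (apply Rabs_pos_lt; easy).
  unfold Rdiv at 1. rewrite Rabs_mult, Rabs_inv.
  apply Rmult_lt_reg_r with (Rabs h); [easy|].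
  rewrite Rmult_assoc, Rinv_l, Rmult_1_r by lra.
  apply Rle_lt_trans with (Rabs K * Rabs h ^ 2).
  { eapply Rle_trans; [exact H|]. rewrite RPow_abs, <- Rabs_mult. apply Rle_abs. }
  apply Rmult_lt_compat_r with (r := Rabs K + 1) in Hlt2; [|easy].
  unfold Rdiv in Hlt2. rewrite Rmult_assoc, Rinv_l, Rmult_1_r in Hlt2 by lra.
  simpl. rewrite Rmult_1_r, <- Rmult_assoc. apply Rmult_lt_compat_r; [easy|].
  nra.
Qed.

Lemma Cder_quad (f : R -> C) t l K e : 0 < e ->
  (forall h, Rabs h < e -> Cmod (f (t + h)%R - f t - RtoC h * l) <= K * h ^ 2) ->
  Cder f t l.
Proof.
  intros He H. split; apply is_derive_quad with K e; auto; intros h Hh;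
    (eapply Rle_trans; [|apply H; easy]).
  - replace (Re (f (t + h)) - Re (f t) - h * Re l)
      with (Re (f (t + h)%R - f t - RtoC h * l)%C); [apply re_le_Cmod|].
    unfold Re; simpl; ring.
  - replace (Im (f (t + h)) - Im (f t) - h * Im l)
      with (Im (f (t + h)%R - f t - RtoC h * l)%C); [apply im_le_Cmod|].
    unfold Im; simpl; ring.
Qed.

Lemma partial_x_Cder f z l : Cder (fun t => f (t, Im z)) (Re z) l ->
  ex_partial_x f z /\ partial_x f z = l.
Proof.
  intros [H1 H2]. split.
  - split; [exists (Re l)|exists (Im l)]; easy.
  - apply injective_projections; [exact (is_derive_unique _ _ _ H1)|exact (is_derive_unique _ _ _ H2)].
Qed.

Lemma partial_y_Cder f z l : Cder (fun t => f (Re z, t)) (Im z) l ->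
  ex_partial_y f z /\ partial_y f z = l.
Proof.
  intros [H1 H2]. split.
  - split; [exists (Re l)|exists (Im l)]; easy.
  - apply injective_projections; [exact (is_derive_unique _ _ _ H1)|exact (is_derive_unique _ _ _ H2)].
Qed.

Lemma Cder_partial_x f z : ex_partial_x f z ->
  Cder (fun t => f (t, Im z)) (Re z) (partial_x f z).
Proof. intros [H1 H2]. split; apply Derive_correct; easy. Qed.

Lemma Cder_partial_y f z : ex_partial_y f z ->
  Cder (fun t => f (Re z, t)) (Im z) (partial_y f z).
Proof. intros [H1 H2]. split; apply Derive_correct; easy. Qed.

Lemma disk_line_x rho z : Cmod z < rho ->
  locally (Re z) (fun t => Cmod (t, Im z) < rho).
Proof.
  intros Hz. assert (He : 0 < rho - Cmod z) by lra.
  exists (mkposreal _ He). intros t Ht.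
  change (Rabs (t - Re z) < rho - Cmod z) in Ht.
  replace (t, Im z) with (z + RtoC (t - Re z)%R)%C
    by (destruct z; apply injective_projections; simpl; ring).
  eapply Rle_lt_trans; [apply Cmod_triangle|]. rewrite Cmod_R. lra.
Qed.

Lemma disk_line_y rho z : Cmod z < rho ->
  locally (Im z) (fun t => Cmod (Re z, t) < rho).
Proof.
  intros Hz. assert (He : 0 < rho - Cmod z) by lra.
  exists (mkposreal _ He). intros t Ht.
  change (Rabs (t - Im z) < rho - Cmod z) in Ht.
  replace (Re z, t) with (z + Ci * RtoC (t - Im z)%R)%C
    by (destruct z; apply injective_projections; simpl; ring).
  eapply Rle_lt_trans; [apply Cmod_triangle|]. rewrite Cmod_mult, Cmod_Ci, Cmod_R. lra.
Qed.

(** Equality on the open disk of radius [rho]. *)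
Definition eq_on (rho : R) (f g : C -> C) : Prop :=
  forall z, Cmod z < rho -> f z = g z.

Lemma eq_on_sym rho f g : eq_on rho f g -> eq_on rho g f.
Proof. intros H z Hz; symmetry; auto. Qed.

(** Partial derivatives are local, so equality on an open disk suffices. *)
Lemma partial_x_ext rho f g : eq_on rho f g -> eq_on rho (partial_x f) (partial_x g).
Proof.
  intros H z Hz. assert (L := disk_line_x _ _ Hz). unfold partial_x.
  f_equal; apply Derive_ext_loc; revert L; apply filter_imp; intros t Ht; now rewrite H.
Qed.

Lemma partial_y_ext rho f g : eq_on rho f g -> eq_on rho (partial_y f) (partial_y g).
Proof.
  intros H z Hz. assert (L := disk_line_y _ _ Hz). unfold partial_y.
  f_equal; apply Derive_ext_loc; revert L; apply filter_imp; intros t Ht; now rewrite H.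
Qed.

Lemma ex_partial_x_ext rho f g z : eq_on rho f g -> Cmod z < rho ->
  ex_partial_x f z -> ex_partial_x g z.
Proof.
  intros H Hz [H1 H2]. assert (L := disk_line_x _ _ Hz).
  split; [revert H1|revert H2]; apply ex_derive_ext_loc;
    revert L; apply filter_imp; intros t Ht; now rewrite H.
Qed.

Lemma ex_partial_y_ext rho f g z : eq_on rho f g -> Cmod z < rho ->
  ex_partial_y f z -> ex_partial_y g z.
Proof.
  intros H Hz [H1 H2]. assert (L := disk_line_y _ _ Hz).
  split; [revert H1|revert H2]; apply ex_derive_ext_loc;
    revert L; apply filter_imp; intros t Ht; now rewrite H.
Qed.

Lemma dbar_ext rho f g : eq_on rho f g -> eq_on rho (dbar f) (dbar g).
Proof.
  intros H z Hz. unfold dbar.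
  now rewrite (partial_x_ext _ _ _ H z Hz), (partial_y_ext _ _ _ H z Hz).
Qed.

Lemma iter_ext rho (D : (C -> C) -> C -> C) n :
  (forall f g, eq_on rho f g -> eq_on rho (D f) (D g)) ->
  forall f g, eq_on rho f g -> eq_on rho (Nat.iter n D f) (Nat.iter n D g).
Proof. intros HD f g H. induction n as [|n IH]; simpl; auto. Qed.

Lemma continuous_C_iff (f : C -> C) z :
  continuous f z <->
  forall eps, 0 < eps -> exists d, 0 < d /\
    forall w, Cmod (w - z) < d -> Cmod (f w - f z) < eps.
Proof.
  assert (H2 : 0 < sqrt 2) by (apply sqrt_lt_R0; lra).
  split.
  - intros H eps He.
    assert (He' : 0 < eps / sqrt 2) by (apply Rdiv_lt_0_compat; easy).
    destruct (proj1 (filterlim_locally _ _) H (mkposreal _ He')) as [d Hd].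
    exists d. split; [apply cond_pos|]. intros w Hw.
    assert (Hb : ball z d w) by (apply C_NormedModule_mixin_compat1; exact Hw).
    apply Hd, C_NormedModule_mixin_compat2 in Hb. simpl in Hb.
    eapply Rlt_le_trans; [exact Hb|]. right; field; lra.
  - intros H. apply filterlim_locally. intros eps.
    destruct (H eps (cond_pos eps)) as [d [Hd HH]].
    assert (Hd' : 0 < d / sqrt 2) by (apply Rdiv_lt_0_compat; easy).
    exists (mkposreal _ Hd'). intros w Hw.
    apply C_NormedModule_mixin_compat1. apply HH.
    apply C_NormedModule_mixin_compat2 in Hw. simpl in Hw.
    eapply Rlt_le_trans; [exact Hw|]. right; field; lra.
Qed.

Lemma continuous_ext_on rho (f g : C -> C) z : eq_on rho f g -> Cmod z < rho ->
  continuous f z -> continuous g z.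
Proof.
  intros H Hz. rewrite !continuous_C_iff. intros Hc eps He.
  destruct (Hc eps He) as [d [Hd Hw]].
  exists (Rmin d (rho - Cmod z)). split; [apply Rmin_pos; lra|].
  intros w Hlt.
  assert (Cmod (w - z) < d) by (eapply Rlt_le_trans; [exact Hlt|apply Rmin_l]).
  assert (Cmod (w - z) < rho - Cmod z) by (eapply Rlt_le_trans; [exact Hlt|apply Rmin_r]).
  assert (Hi := Cmod_triangle_inv w z).
  rewrite <- !H by lra. auto.
Qed.

Lemma continuous_lin (a b : C) (f g : C -> C) z : continuous f z -> continuous g z ->
  continuous (fun w => (a * f w + b * g w)%C) z.
Proof.
  rewrite !continuous_C_iff. intros Hf Hg eps He.
  assert (HA := Cmod_ge_0 a). assert (HB := Cmod_ge_0 b).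
  set (M := Cmod a + Cmod b + 1).
  assert (HM : 0 < eps / M) by (apply Rdiv_lt_0_compat; unfold M; lra).
  destruct (Hf _ HM) as [d1 [Hd1 H1]], (Hg _ HM) as [d2 [Hd2 H2]].
  exists (Rmin d1 d2). split; [apply Rmin_pos; easy|]. intros w Hw.
  specialize (H1 w (Rlt_le_trans _ _ _ Hw (Rmin_l _ _))).
  specialize (H2 w (Rlt_le_trans _ _ _ Hw (Rmin_r _ _))).
  replace (a * f w + b * g w - (a * f z + b * g z))%C with
    (a * (f w - f z) + b * (g w - g z))%C by ring.
  eapply Rle_lt_trans; [apply Cmod_triangle|]. rewrite !Cmod_mult.
  apply Rle_lt_trans with (Cmod a * (eps / M) + Cmod b * (eps / M)).
  { apply Rplus_le_compat; apply Rmult_le_compat_l; lra. }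
  replace eps with (M * (eps / M)) at 3 by (field; unfold M; lra).
  unfold M at 3. nra.
Qed.

Lemma class_C_ext rho n : forall f g, eq_on rho f g ->
  class_C n (disk rho) f -> class_C n (disk rho) g.
Proof.
  unfold disk. induction n as [|n IH]; intros f g H [Hc Hd].
  - split; [|easy]. intros z Hz. apply (continuous_ext_on rho f); auto.
  - split; [intros z Hz; apply (continuous_ext_on rho f); auto|].
    destruct Hd as [He [Hx Hy]]. split; [|split].
    + intros z Hz. destruct (He z Hz). split.
      * now apply (ex_partial_x_ext rho f).
      * now apply (ex_partial_y_ext rho f).
    + apply IH with (partial_x f); auto. now apply partial_x_ext.
    + apply IH with (partial_y f); auto. now apply partial_y_ext.
Qed.

Lemma Cder_lin a b f g t l m : Cder f t l -> Cder g t m ->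
  Cder (fun s => (a * f s + b * g s)%C) t (a * l + b * m)%C.
Proof.
  intros Hf Hg. apply Cder_plus.
  - replace (a * l)%C with (0 * f t + a * l)%C by ring.
    apply (Cder_mult (fun _ => a) f); [apply Cder_const|easy].
  - replace (b * m)%C with (0 * g t + b * m)%C by ring.
    apply (Cder_mult (fun _ => b) g); [apply Cder_const|easy].
Qed.

Lemma partial_x_lin a b f g z : ex_partial_x f z -> ex_partial_x g z ->
  ex_partial_x (fun w => (a * f w + b * g w)%C) z /\
  partial_x (fun w => (a * f w + b * g w)%C) z =
    (a * partial_x f z + b * partial_x g z)%C.
Proof.
  intros Hf Hg. apply (partial_x_Cder (fun w => (a * f w + b * g w)%C)).
  apply Cder_lin; now apply Cder_partial_x.
Qed.

Lemma partial_y_lin a b f g z : ex_partial_y f z -> ex_partial_y g z ->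
  ex_partial_y (fun w => (a * f w + b * g w)%C) z /\
  partial_y (fun w => (a * f w + b * g w)%C) z =
    (a * partial_y f z + b * partial_y g z)%C.
Proof.
  intros Hf Hg. apply (partial_y_Cder (fun w => (a * f w + b * g w)%C)).
  apply Cder_lin; now apply Cder_partial_y.
Qed.

Lemma class_C_lin rho n a b : forall f g,
  class_C n (disk rho) f -> class_C n (disk rho) g ->
  class_C n (disk rho) (fun w => (a * f w + b * g w)%C).
Proof.
  induction n as [|n IH]; intros f g [Hf1 Hf2] [Hg1 Hg2].
  - split; [|easy]. intros; apply continuous_lin; auto.
  - split; [intros; apply continuous_lin; auto|].
    destruct Hf2 as [Hf2 [Hf3 Hf4]], Hg2 as [Hg2 [Hg3 Hg4]]. split; [|split].
    + intros z Hz. destruct (Hf2 z Hz), (Hg2 z Hz).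
      split; [apply partial_x_lin|apply partial_y_lin]; easy.
    + apply class_C_ext with (fun w => (a * partial_x f w + b * partial_x g w)%C); auto.
      intros z Hz. symmetry. destruct (Hf2 z Hz), (Hg2 z Hz). now apply partial_x_lin.
    + apply class_C_ext with (fun w => (a * partial_y f w + b * partial_y g w)%C); auto.
      intros z Hz. symmetry. destruct (Hf2 z Hz), (Hg2 z Hz). now apply partial_y_lin.
Qed.

Lemma class_C_pred U n : forall f, class_C (S n) U f -> class_C n U f.
Proof.
  induction n as [|n IH]; intros f [H1 [H2 [H3 H4]]].
  - now split.
  - split; [easy|]. split; [easy|]. split; apply IH; easy.
Qed.

Lemma class_C_dbar rho n f : class_C (S n) (disk rho) f -> class_C n (disk rho) (dbar f).
Proof.
  intros [H1 [H2 [H3 H4]]].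
  apply class_C_ext with (fun w => (/ 2 * partial_x f w + / 2 * Ci * partial_y f w)%C).
  - intros z _. unfold dbar. ring.
  - now apply class_C_lin.
Qed.

(** [dbar ^ n] is linear on functions of class [C^n]. *)
Lemma iter_dbar_lin rho n a b : forall f g,
  class_C n (disk rho) f -> class_C n (disk rho) g ->
  eq_on rho (Nat.iter n dbar (fun w => (a * f w + b * g w)%C))
    (fun z => (a * Nat.iter n dbar f z + b * Nat.iter n dbar g z)%C).
Proof.
  induction n as [|n IH]; intros f g Hf Hg z Hz; [easy|].
  rewrite !Nat.iter_succ_r.
  rewrite <- (IH (dbar f) (dbar g)); auto using class_C_dbar.
  apply (iter_ext rho dbar n (dbar_ext rho)); [|easy].
  intros w Hw. destruct Hf as [_ [Hf _]], Hg as [_ [Hg _]].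
  destruct (Hf w Hw), (Hg w Hw). unfold dbar.
  rewrite (proj2 (partial_x_lin a b f g w ltac:(easy) ltac:(easy))).
  rewrite (proj2 (partial_y_lin a b f g w ltac:(easy) ltac:(easy))). ring.
Qed.

(** * Polyanalytic power series *)

Lemma cps_0 (a : nat -> C) z : (forall j, a j = 0%C) -> cps a z = 0%C.
Proof.
  intros H. apply (CSer_finite (fun j => (a j * z ^ j)%C) 0).
  intros j _. rewrite H. ring.
Qed.

(** The array [c] encodes the expansion
    [sum_(p < N) sum_j c p j * z ^ j * conj z ^ p]. *)
Definition pser (N : nat) (c : nat -> nat -> C) (z : C) : C :=
  csum N (fun p => (cps (c p) z * Cconj z ^ p)%C).

(** Admissible arrays of coefficients: each row converges in the disk of radius
    [rho], and the rows of index at least [N] vanish, so that [dzb] needs no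
    case distinction on the last row. *)
Definition array (N : nat) (rho : R) (c : nat -> nat -> C) : Prop :=
  (forall p, Conv rho (c p)) /\ forall p j, (N <= p)%nat -> c p j = 0%C.

(** Action of the derivative with respect to [z] on the coefficients. *)
Definition dz (c : nat -> nat -> C) : nat -> nat -> C := fun p => da (c p).

(** Action of the derivative with respect to [conj z] on the coefficients. *)
Definition dzb (c : nat -> nat -> C) : nat -> nat -> C :=
  fun p j => (RtoC (INR (S p)) * c (S p) j)%C.

(** Linear combination of arrays. *)
Definition alin (a b : C) (c d : nat -> nat -> C) : nat -> nat -> C :=
  fun p j => (a * c p j + b * d p j)%C.

Lemma array_dz N rho c : array N rho c -> array N rho (dz c).
Proof.
  intros [H1 H2]. split.
  - intros p; now apply Conv_da.
  - intros p j Hp. unfold dz, da. rewrite H2 by easy. ring.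
Qed.

Lemma array_dzb N rho c : array N rho c -> array N rho (dzb c).
Proof.
  intros [H1 H2]. split.
  - intros p; now apply Conv_scal.
  - intros p j Hp. unfold dzb. rewrite H2 by lia. ring.
Qed.

Lemma array_alin N rho a b c d : array N rho c -> array N rho d ->
  array N rho (alin a b c d).
Proof.
  intros [H1 H2] [H3 H4]. split.
  - intros p. apply Conv_plus; now apply Conv_scal.
  - intros p j Hp. unfold alin. rewrite H2, H4 by easy. ring.
Qed.

Lemma pser_lin N rho a b c d z : array N rho c -> array N rho d -> Cmod z < rho ->
  pser N (alin a b c d) z = (a * pser N c z + b * pser N d z)%C.
Proof.
  intros [H1 H2] [H3 H4] Hz. unfold pser.
  rewrite <- !csum_scal, <- csum_plus. apply csum_ext. intros p _.
  unfold alin. rewrite (cps_plus rho), !(cps_scal rho); auto using Conv_scal. ring.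
Qed.

(** Derivative of a power series along a line of direction [v]. *)
Lemma Cder_cps_line rho a (z v : C) (g : R -> C) t : Conv rho a -> Cmod z < rho ->
  (forall h, g (t + h)%R = (z + RtoC h * v)%C) ->
  Cder (fun s => cps a (g s)) t (cps (da a) z * v)%C.
Proof.
  intros Ha Hz Hg. assert (H0 := Cmod_ge_0 z). assert (Hv := Cmod_ge_0 v).
  set (r := (Cmod z + rho) / 2).
  assert (Hr : Cmod z < r /\ 0 < r < rho) by (unfold r; lra).
  destruct (cps_taylor rho a r Ha ltac:(lra)) as [K [HK HT]].
  assert (He : 0 < (r - Cmod z) / (Cmod v + 1)) by (apply Rdiv_lt_0_compat; lra).
  apply Cder_quad with (K * Cmod v ^ 2) ((r - Cmod z) / (Cmod v + 1)); [easy|].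
  intros h Hh.
  replace (g t) with z by (rewrite <- (Rplus_0_r t), Hg; ring).
  rewrite Hg.
  replace (K * Cmod v ^ 2 * h ^ 2) with (K * Cmod (RtoC h * v) ^ 2).
  2:{ rewrite Cmod_mult, Cmod_R, Rpow_mult_distr, pow2_abs; ring. }
  replace (RtoC h * (cps (da a) z * v))%C with (RtoC h * v * cps (da a) z)%C by ring.
  apply HT; [lra|].
  eapply Rle_trans; [apply Cmod_triangle|]. rewrite Cmod_mult, Cmod_R.
  apply Rmult_lt_compat_r with (r := Cmod v + 1) in Hh; [|lra].
  unfold Rdiv in Hh. rewrite Rmult_assoc, Rinv_l, Rmult_1_r in Hh by lra.
  assert (0 <= Rabs h) by apply Rabs_pos. nra.
Qed.

Lemma Cconj_R (r : R) : Cconj (RtoC r) = RtoC r.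
Proof. apply injective_projections; simpl; ring. Qed.

(** The derivative of [pser N c] in the direction [v] is [v] times its
    derivative in [z] plus [conj v] times its derivative in [conj z]. *)
Lemma Cder_pser_line N rho c (z v : C) (g : R -> C) t : array N rho c -> Cmod z < rho ->
  (forall h, g (t + h)%R = (z + RtoC h * v)%C) ->
  Cder (fun s => pser N c (g s)) t (v * pser N (dz c) z + Cconj v * pser N (dzb c) z)%C.
Proof.
  intros [Hc Hs] Hz Hg.
  assert (Hgt : g t = z) by (rewrite <- (Rplus_0_r t), Hg; ring).
  assert (Hconj : Cder (fun s => Cconj (g s)) t (Cconj v)).
  { apply Cder_quad with 0 1; [lra|]. intros h _. rewrite Hg, Hgt.
    rewrite Cplus_conj, Cmult_conj, Cconj_R.
    replace (_ - _ - _)%C with (RtoC 0) by ring. rewrite Cmod_0; lra. }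
  assert (E : (v * pser N (dz c) z + Cconj v * pser N (dzb c) z)%C =
    csum N (fun p => cps (dz c p) z * v * Cconj z ^ p +
      cps (c p) z * (RtoC (INR p) * Cconj z ^ (pred p) * Cconj v))%C).
  { rewrite csum_plus. unfold pser. rewrite <- !csum_scal. f_equal.
    - apply csum_ext; intros; ring.
    - transitivity (csum (S N) (fun p => cps (c p) z * (RtoC (INR p) * Cconj z ^ (pred p) * Cconj v))%C).
      + rewrite csum_shift. simpl (INR 0). rewrite !Cmult_0_l, Cmult_0_r, Cplus_0_l.
        apply csum_ext. intros p _. unfold dzb. rewrite (cps_scal rho) by auto.
        simpl pred. ring.
      + simpl csum. rewrite (cps_0 (c N)) by (intros; auto). ring. }
  rewrite E. unfold pser. apply Cder_csum. intros p _.
  assert (H1 := Cder_cps_line rho (c p) z v g t (Hc p) Hz Hg).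
  assert (H2 := Cder_pow _ _ _ p Hconj).
  assert (H3 := Cder_mult _ _ _ _ _ H1 H2). simpl in H3. rewrite Hgt in H3. exact H3.
Qed.

(** Action of [partial_x] on the coefficients. *)
Definition ax (c : nat -> nat -> C) : nat -> nat -> C := alin 1 1 (dz c) (dzb c).

(** Action of [partial_y] on the coefficients. *)
Definition ay (c : nat -> nat -> C) : nat -> nat -> C := alin Ci (- Ci) (dz c) (dzb c).

Lemma array_ax N rho c : array N rho c -> array N rho (ax c).
Proof. intros H. apply array_alin; auto using array_dz, array_dzb. Qed.

Lemma array_ay N rho c : array N rho c -> array N rho (ay c).
Proof. intros H. apply array_alin; auto using array_dz, array_dzb. Qed.

Lemma pser_partial_x N rho c z : array N rho c -> Cmod z < rho ->
  ex_partial_x (pser N c) z /\ partial_x (pser N c) z = pser N (ax c) z.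
Proof.
  intros Hc Hz. apply partial_x_Cder.
  unfold ax. rewrite (pser_lin N rho); auto using array_dz, array_dzb.
  replace (RtoC 1 * pser N (dzb c) z)%C with (Cconj 1 * pser N (dzb c) z)%C
    by (rewrite Cconj_R; easy).
  apply (Cder_pser_line N rho c z 1 (fun t => (t, Im z))); auto.
  intros h. destruct z; apply injective_projections; simpl; ring.
Qed.

Lemma pser_partial_y N rho c z : array N rho c -> Cmod z < rho ->
  ex_partial_y (pser N c) z /\ partial_y (pser N c) z = pser N (ay c) z.
Proof.
  intros Hc Hz. apply partial_y_Cder.
  unfold ay. rewrite (pser_lin N rho); auto using array_dz, array_dzb.
  replace (- Ci * pser N (dzb c) z)%C with (Cconj Ci * pser N (dzb c) z)%C.
  2:{ f_equal. apply injective_projections; simpl; ring. }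
  apply (Cder_pser_line N rho c z Ci (fun t => (Re z, t))); auto.
  intros h. destruct z; apply injective_projections; simpl; ring.
Qed.

Lemma pser_continuous N rho c z : array N rho c -> Cmod z < rho ->
  continuous (pser N c) z.
Proof.
  intros [Hc _] Hz.
  assert (HC : forall a, Conv rho a -> continuous (cps a) z).
  { intros a Ha. apply continuous_C_iff. intros eps He.
    assert (H0 := Cmod_ge_0 z).
    set (r := (Cmod z + rho) / 2).
    assert (Hr : Cmod z < r /\ 0 < r < rho) by (unfold r; lra).
    destruct (cps_taylor rho a r Ha ltac:(lra)) as [K [HK HT]].
    set (L := K + Cmod (cps (da a) z) + 1).
    assert (HL := Cmod_ge_0 (cps (da a) z)).
    exists (Rmin (Rmin 1 (r - Cmod z)) (eps / L)). split.
    { apply Rmin_pos; [apply Rmin_pos; lra|]. apply Rdiv_lt_0_compat; unfold L; lra. }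
    intros w Hw.
    assert (W1 := Rlt_le_trans _ _ _ Hw (Rmin_l _ _)).
    assert (W2 := Rlt_le_trans _ _ _ Hw (Rmin_r _ _)).
    assert (W3 := Rlt_le_trans _ _ _ W1 (Rmin_l _ _)).
    assert (W4 := Rlt_le_trans _ _ _ W1 (Rmin_r _ _)).
    assert (Hi := Cmod_triangle_inv w z).
    specialize (HT z (w - z)%C ltac:(lra)).
    replace (z + (w - z))%C with w in HT by ring. specialize (HT ltac:(lra)).
    replace (cps a w - cps a z)%C with
      (cps a w - cps a z - (w - z) * cps (da a) z + (w - z) * cps (da a) z)%C by ring.
    eapply Rle_lt_trans; [apply Cmod_triangle|]. rewrite Cmod_mult.
    assert (H1 := Cmod_ge_0 (w - z)).
    set (x := Cmod (w - z)) in *.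
    apply Rle_lt_trans with (x * L).
    { unfold L. assert (K * x ^ 2 <= K * x) by (apply Rmult_le_compat_l; nra). nra. }
    apply Rmult_lt_reg_r with (/ L); [apply Rinv_0_lt_compat; unfold L; lra|].
    rewrite Rmult_assoc, Rinv_r, Rmult_1_r by (unfold L; lra). exact W2. }
  assert (Hmult : forall f g : C -> C, continuous f z -> continuous g z ->
    continuous (fun w => (f w * g w)%C) z).
  { intros f g. rewrite !continuous_C_iff. intros Hf Hg eps He.
    set (M := Cmod (f z) + Cmod (g z) + 1).
    assert (HF := Cmod_ge_0 (f z)). assert (HG := Cmod_ge_0 (g z)).
    assert (HM : 0 < Rmin 1 (eps / M)) by (apply Rmin_pos; [lra|apply Rdiv_lt_0_compat; unfold M; lra]).
    destruct (Hf _ HM) as [d1 [Hd1 H1]], (Hg _ HM) as [d2 [Hd2 H2]].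
    exists (Rmin d1 d2). split; [apply Rmin_pos; easy|]. intros w Hw.
    specialize (H1 w (Rlt_le_trans _ _ _ Hw (Rmin_l _ _))).
    specialize (H2 w (Rlt_le_trans _ _ _ Hw (Rmin_r _ _))).
    assert (F1 := Rlt_le_trans _ _ _ H1 (Rmin_l _ _)).
    assert (F2 := Rlt_le_trans _ _ _ H1 (Rmin_r _ _)).
    assert (G2 := Rlt_le_trans _ _ _ H2 (Rmin_r _ _)).
    replace (f w * g w - f z * g z)%C with
      ((f w - f z) * (g w - g z) + (f w - f z) * g z + f z * (g w - g z))%C by ring.
    eapply Rle_lt_trans; [apply Cmod_triangle|].
    eapply Rle_lt_trans; [apply Rplus_le_compat_r, Cmod_triangle|].
    rewrite !Cmod_mult.
    assert (X1 := Cmod_ge_0 (f w - f z)). assert (X2 := Cmod_ge_0 (g w - g z)).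
    replace eps with (M * (eps / M)) by (field; unfold M; lra).
    unfold M at 1. set (q := eps / M) in *. nra. }
  assert (Hconj : continuous Cconj z).
  { apply continuous_C_iff. intros eps He. exists eps. split; [easy|].
    intros w Hw. rewrite <- Cminus_conj, Cmod_conj. exact Hw. }
  unfold pser. induction N as [|N IH]; simpl.
  - apply continuous_const.
  - apply (continuous_plus (V := C_NormedModule)); [apply IH|].
    apply Hmult; [apply HC, Hc|].
    clear - Hmult Hconj. induction N as [|N IH]; simpl; [apply continuous_const|].
    now apply Hmult.
Qed.

Lemma pser_class_C N rho n : forall c, array N rho c -> class_C n (disk rho) (pser N c).
Proof.
  induction n as [|n IH]; intros c Hc.
  - split; [|easy]. intros z Hz. now apply pser_continuous with rho.
  - split; [intros z Hz; now apply pser_continuous with rho|].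
    split; [|split].
    + intros z Hz. split; [now apply (pser_partial_x N rho)|now apply (pser_partial_y N rho)].
    + apply class_C_ext with (pser N (ax c)); [|apply IH; now apply array_ax].
      intros z Hz. symmetry. now apply (pser_partial_x N rho).
    + apply class_C_ext with (pser N (ay c)); [|apply IH; now apply array_ay].
      intros z Hz. symmetry. now apply (pser_partial_y N rho).
Qed.

Lemma pser_dbar N rho c : array N rho c -> eq_on rho (dbar (pser N c)) (pser N (dzb c)).
Proof.
  intros Hc z Hz. unfold dbar.
  rewrite (proj2 (pser_partial_x N rho c z Hc Hz)), (proj2 (pser_partial_y N rho c z Hc Hz)).
  unfold ax, ay. rewrite !(pser_lin N rho); auto using array_dz, array_dzb.
  set (u := pser N (dz c) z). set (v := pser N (dzb c) z).
  replace (/ 2 * _)%C with (/ 2 * (u + v + (Ci * Ci) * (u - v)))%C by ring.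
  replace (Ci * Ci)%C with (RtoC (-1)) by (apply injective_projections; simpl; ring).
  replace (u + v + RtoC (-1) * (u - v))%C with (2 * v)%C.
  2:{ replace (RtoC (-1)) with (- (1))%C by (apply injective_projections; simpl; ring). ring. }
  field.
Qed.

Lemma array_iter N rho n op c : (forall d, array N rho d -> array N rho (op d)) ->
  array N rho c -> array N rho (Nat.iter n op c).
Proof. intros Hop Hc. induction n as [|n IH]; simpl; auto. Qed.

Lemma pser_iter_dbar N rho c n : array N rho c ->
  eq_on rho (Nat.iter n dbar (pser N c)) (pser N (Nat.iter n dzb c)).
Proof.
  intros Hc. induction n as [|n IH]; simpl; [easy|].
  intros z Hz. rewrite (dbar_ext _ _ _ IH z Hz).
  apply (pser_dbar N rho); [|easy]. apply array_iter; auto. intros; now apply array_dzb.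
Qed.

Lemma pser_partial_alpha N rho c a1 a2 : array N rho c ->
  eq_on rho (partial_alpha a1 a2 (pser N c)) (pser N (Nat.iter a1 ax (Nat.iter a2 ay c))).
Proof.
  intros Hc. unfold partial_alpha.
  assert (Hy : eq_on rho (Nat.iter a2 partial_y (pser N c)) (pser N (Nat.iter a2 ay c))).
  { induction a2 as [|n IH]; simpl; [easy|].
    intros z Hz. rewrite (partial_y_ext _ _ _ IH z Hz).
    apply (pser_partial_y N rho); [|easy]. apply array_iter; auto. intros; now apply array_ay. }
  assert (Hd : array N rho (Nat.iter a2 ay c)).
  { apply array_iter; auto. intros; now apply array_ay. }
  intros z Hz. rewrite (iter_ext rho partial_x a1 (partial_x_ext rho) _ _ Hy z Hz).
  clear Hy. set (d := Nat.iter a2 ay c) in *. revert z Hz.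
  induction a1 as [|n IH]; simpl; [easy|].
  intros z Hz. rewrite (partial_x_ext _ _ _ IH z Hz).
  apply (pser_partial_x N rho); [|easy]. apply array_iter; auto. intros; now apply array_ax.
Qed.

Lemma iter_dzb_coef n c p j :
  Nat.iter n dzb c p j = (RtoC (INR (fact (p + n)) / INR (fact p)) * c (p + n)%nat j)%C.
Proof.
  revert p. induction n as [|n IH]; intros p; simpl.
  - rewrite Nat.add_0_r. unfold Rdiv. rewrite Rinv_r by apply INR_fact_neq_0. ring.
  - unfold dzb at 1. rewrite IH.
    replace (S p + n)%nat with (p + S n)%nat by lia.
    rewrite Cmult_assoc, <- RtoC_mult. f_equal. f_equal.
    rewrite (fact_simpl p), mult_INR. field.
    split; [apply INR_fact_neq_0|apply not_0_INR; lia].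
Qed.

Lemma pser_polyanalytic N rho c f : array N rho c -> eq_on rho f (pser N c) ->
  polyanalytic N (disk rho) f.
Proof.
  intros Hc Hf. split.
  - apply class_C_ext with (pser N c); [now apply eq_on_sym|now apply pser_class_C].
  - intros z Hz. rewrite (iter_ext rho dbar N (dbar_ext rho) _ _ Hf z Hz).
    rewrite (pser_iter_dbar N rho c N Hc z Hz).
    unfold pser. apply csum_0. intros p _. rewrite cps_0; [ring|].
    intros j. rewrite iter_dzb_coef, (proj2 Hc) by lia. ring.
Qed.

(** * Integrals over the circle *)

(** Continuity of a complex-valued function of a real variable. *)
Definition ccont (f : R -> C) : Prop :=
  forall t, continuous (fun s => Re (f s)) t /\ continuous (fun s => Im (f s)) t.

(** Integral of a complex-valued function over [[0, 2 * PI]]. *)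
Definition cint (f : R -> C) : C :=
  (RInt (fun t => Re (f t)) 0 (2 * PI), RInt (fun t => Im (f t)) 0 (2 * PI)).

Lemma ccont_const c : ccont (fun _ => c).
Proof. intros t; split; apply continuous_const. Qed.

Lemma ccont_plus f g : ccont f -> ccont g -> ccont (fun t => (f t + g t)%C).
Proof.
  intros Hf Hg t. destruct (Hf t), (Hg t).
  split; simpl; apply (continuous_plus (V := R_NormedModule)); easy.
Qed.

Lemma ccont_mult f g : ccont f -> ccont g -> ccont (fun t => (f t * g t)%C).
Proof.
  intros Hf Hg t. destruct (Hf t), (Hg t).
  split; simpl.
  - apply (continuous_minus (V := R_NormedModule)); apply (continuous_mult (K := R_AbsRing)); easy.
  - apply (continuous_plus (V := R_NormedModule)); apply (continuous_mult (K := R_AbsRing)); easy.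
Qed.

Lemma ccont_conj f : ccont f -> ccont (fun t => Cconj (f t)).
Proof.
  intros Hf t. destruct (Hf t). split; simpl; [easy|].
  apply (continuous_opp (V := R_NormedModule)); easy.
Qed.

Lemma ccont_pow f n : ccont f -> ccont (fun t => (f t ^ n)%C).
Proof.
  intros Hf. induction n as [|n IH]; simpl; [apply ccont_const|now apply ccont_mult].
Qed.

Lemma ccont_csum n (f : nat -> R -> C) : (forall j, ccont (f j)) ->
  ccont (fun t => csum n (fun j => f j t)).
Proof.
  intros Hf. induction n as [|n IH]; simpl; [apply ccont_const|now apply ccont_plus].
Qed.

Lemma ccont_Cder f : (forall t, exists l, Cder f t l) -> ccont f.
Proof.
  intros H t. destruct (H t) as [l [H1 H2]].
  split; apply (ex_derive_continuous (V := R_NormedModule)); eexists; eassumption.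
Qed.

Lemma ccont_ex f : ccont f ->
  ex_RInt (fun t => Re (f t)) 0 (2 * PI) /\ ex_RInt (fun t => Im (f t)) 0 (2 * PI).
Proof.
  intros Hf. split; apply (ex_RInt_continuous (V := R_CompleteNormedModule));
    intros; apply Hf.
Qed.

Lemma cint_ext f g : (forall t, f t = g t) -> cint f = cint g.
Proof. intros H. apply injective_projections; simpl; apply RInt_ext; intros; now rewrite H. Qed.

Lemma cint_plus f g : ccont f -> ccont g ->
  cint (fun t => (f t + g t)%C) = (cint f + cint g)%C.
Proof.
  intros Hf Hg. destruct (ccont_ex f Hf), (ccont_ex g Hg).
  apply injective_projections; simpl;
    apply (RInt_plus (V := R_CompleteNormedModule)); easy.
Qed.

Lemma cint_scal c f : ccont f -> cint (fun t => (c * f t)%C) = (c * cint f)%C.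
Proof.
  intros Hf. destruct (ccont_ex f Hf) as [H1 H2].
  assert (S : forall (a : R) g, ex_RInt g 0 (2 * PI) ->
    RInt (fun t => a * g t) 0 (2 * PI) = a * RInt g 0 (2 * PI)).
  { intros a g Hg. exact (RInt_scal (V := R_CompleteNormedModule) g 0 (2 * PI) a Hg). }
  assert (E : forall (a : R) g, ex_RInt g 0 (2 * PI) -> ex_RInt (fun t => a * g t) 0 (2 * PI)).
  { intros a g Hg. exact (ex_RInt_scal (V := R_NormedModule) g 0 (2 * PI) a Hg). }
  apply injective_projections; simpl.
  - rewrite <- !S by easy. apply (RInt_minus (V := R_CompleteNormedModule)); now apply E.
  - rewrite <- !S by easy. apply (RInt_plus (V := R_CompleteNormedModule)); now apply E.
Qed.

Lemma cint_csum n (f : nat -> R -> C) : (forall j, ccont (f j)) ->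
  cint (fun t => csum n (fun j => f j t)) = csum n (fun j => cint (f j)).
Proof.
  intros Hf. induction n as [|n IH]; simpl.
  - unfold cint; simpl. rewrite RInt_const. unfold scal; simpl; unfold mult; simpl.
    now rewrite Rmult_0_r.
  - rewrite cint_plus, IH; auto using ccont_csum.
Qed.

(** The real and imaginary parts are bounded separately, whence a factor [2],
    harmless in the sequel. *)
Lemma cint_bound f M : ccont f -> (forall t, 0 <= t <= 2 * PI -> Cmod (f t) <= M) ->
  Cmod (cint f) <= 2 * PI * (2 * M).
Proof.
  intros Hf HM. destruct (ccont_ex f Hf) as [H1 H2]. assert (HPI := PI_RGT_0).
  assert (B : forall g, ex_RInt g 0 (2 * PI) -> (forall t, 0 <= t <= 2 * PI -> Rabs (g t) <= M) ->
    Rabs (RInt g 0 (2 * PI)) <= 2 * PI * M).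
  { intros g Hg Hb. replace (2 * PI * M) with ((2 * PI - 0) * M) by ring.
    apply abs_RInt_le_const; auto. lra. }
  eapply Rle_trans; [apply Cmod_le_ReIm|].
  replace (2 * PI * (2 * M)) with (2 * PI * M + 2 * PI * M) by ring.
  apply Rplus_le_compat; apply B; auto; intros t Ht; (eapply Rle_trans; [|apply (HM t Ht)]).
  - apply re_le_Cmod.
  - apply im_le_Cmod.
Qed.

Lemma cint_derive F f : (forall t, Cder F t (f t)) -> ccont f ->
  F 0 = F (2 * PI) -> cint f = 0%C.
Proof.
  intros HF Hf HE. apply injective_projections; simpl.
  - rewrite (is_RInt_unique (V := R_CompleteNormedModule) _ _ _ _
      (is_RInt_derive (V := R_CompleteNormedModule) (fun t => Re (F t)) _ 0 (2 * PI)
        (fun t _ => proj1 (HF t)) (fun t _ => proj1 (Hf t)))).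
    rewrite <- HE. apply (minus_eq_zero (G := R_AbelianGroup)).
  - rewrite (is_RInt_unique (V := R_CompleteNormedModule) _ _ _ _
      (is_RInt_derive (V := R_CompleteNormedModule) (fun t => Im (F t)) _ 0 (2 * PI)
        (fun t _ => proj2 (HF t)) (fun t _ => proj2 (Hf t)))).
    rewrite <- HE. apply (minus_eq_zero (G := R_AbelianGroup)).
Qed.

(** The point [exp (i t)] of the unit circle. *)
Definition cexp (t : R) : C := (cos t, sin t).

Lemma Cder_cexp t : Cder cexp t (Ci * cexp t)%C.
Proof.
  split; simpl.
  - replace (0 * cos t - 1 * sin t) with (- sin t) by ring. apply is_derive_cos.
  - replace (0 * sin t + 1 * cos t) with (cos t) by ring. apply is_derive_sin.
Qed.

Lemma ccont_cexp : ccont cexp.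
Proof. apply ccont_Cder. intros t; eexists; apply Cder_cexp. Qed.

Lemma Cmod_cexp t : Cmod (cexp t) = 1.
Proof.
  transitivity (sqrt 1); [|apply sqrt_1]. unfold Cmod, cexp; simpl. f_equal.
  assert (H := sin2_cos2 t). unfold Rsqr in H. rewrite !Rmult_1_r, Rplus_comm. exact H.
Qed.

Lemma cexp_conj t : (cexp t * Cconj (cexp t))%C = 1%C.
Proof.
  rewrite <- Cmod2_conj, Cmod_cexp. f_equal; ring.
Qed.

Lemma cexp_2PI : cexp (2 * PI) = cexp 0.
Proof. unfold cexp. rewrite cos_2PI, sin_2PI, cos_0, sin_0. easy. Qed.

Lemma cint_cexp_pow n : (0 < n)%nat -> cint (fun t => cexp t ^ n)%C = 0%C.
Proof.
  intros Hn.
  assert (Hi : Ci <> 0%C /\ RtoC (INR n) <> 0%C).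
  { split.
    - intros H. apply (f_equal snd) in H. simpl in H. lra.
    - intros H. apply RtoC_inj in H. apply not_0_INR in H; [easy|lia]. }
  transitivity (/ (RtoC (INR n) * Ci) * cint (fun t => (RtoC (INR n) * Ci) * cexp t ^ n))%C.
  - rewrite <- cint_scal by (apply ccont_mult; [apply ccont_const|apply ccont_pow, ccont_cexp]).
    apply cint_ext. intros t. field. exact Hi.
  - rewrite (cint_derive (fun t => cexp t ^ n)%C); [ring| | |].
    + intros t. assert (H := Cder_pow _ _ _ n (Cder_cexp t)).
      replace (RtoC (INR n) * Ci * cexp t ^ n)%C
        with (RtoC (INR n) * cexp t ^ pred n * (Ci * cexp t))%C; [exact H|].
      destruct n; [lia|]. simpl pred. simpl (_ ^ S n)%C. ring.
    + apply ccont_mult; [apply ccont_const|apply ccont_pow, ccont_cexp].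
    + now rewrite cexp_2PI.
Qed.

Lemma cint_conj f : ccont f -> cint (fun t => Cconj (f t)) = Cconj (cint f).
Proof.
  intros Hf. unfold cint, Cconj; simpl. f_equal.
  apply (RInt_opp (V := R_CompleteNormedModule)). apply (ccont_ex f Hf).
Qed.

Lemma cint_const c : cint (fun _ => c) = (RtoC (2 * PI) * c)%C.
Proof.
  apply injective_projections; simpl; rewrite RInt_const; unfold scal; simpl;
    unfold mult, Re, Im; simpl; ring.
Qed.

Lemma cint_orthogonal j q :
  cint (fun t => cexp t ^ j * Cconj (cexp t) ^ q)%C =
  if Nat.eq_dec j q then RtoC (2 * PI) else 0%C.
Proof.
  destruct (Nat.eq_dec j q) as [->|Hn].
  - rewrite (cint_ext _ (fun _ => 1%C)).
    + rewrite cint_const. ring.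
    + intros t. now rewrite <- Cpow_mult_l, cexp_conj, Cpow_1_l.
  - destruct (Nat.lt_ge_cases j q) as [H|H].
    + rewrite (cint_ext _ (fun t => Cconj (cexp t ^ (q - j)))).
      * rewrite cint_conj, cint_cexp_pow; [|lia|apply ccont_pow, ccont_cexp].
        apply injective_projections; simpl; ring.
      * intros t. rewrite Cpow_conj. replace q with (j + (q - j))%nat at 1 by lia.
        rewrite Cpow_add_r, Cmult_assoc, <- Cpow_mult_l, cexp_conj, Cpow_1_l. ring.
    + rewrite (cint_ext _ (fun t => cexp t ^ (j - q))%C).
      * apply cint_cexp_pow; lia.
      * intros t. replace j with (q + (j - q))%nat at 1 by lia.
        rewrite Cpow_add_r.
        transitivity ((cexp t * Cconj (cexp t)) ^ q * cexp t ^ (j - q))%C.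
        { rewrite Cpow_mult_l; ring. }
        rewrite cexp_conj, Cpow_1_l. ring.
Qed.

(** * Coefficient estimates *)

Lemma Series_tail (b : nat -> R) : ex_series b -> forall eps, 0 < eps ->
  exists n0, forall n, (n0 <= n)%nat -> Rabs (Series (fun j => b (n + j)%nat)) < eps.
Proof.
  intros Hb eps He. assert (H := Series_correct _ Hb).
  destruct (proj2 (is_lim_seq_spec _ (Finite _)) H (mkposreal _ He)) as [n0 H0].
  exists (S n0). intros n Hn. specialize (H0 (pred n) ltac:(lia)). simpl in H0.
  rewrite (Series_incr_n b n) in H0 by (lia || easy).
  rewrite sum_n_Reals in H0.
  match type of H0 with Rabs (?x - (?x + ?y)) < _ =>
    replace (x - (x + y)) with (- y) in H0 by ring end.
  now rewrite Rabs_Ropp in H0.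
Qed.

Lemma cps_tail rho a r : Conv rho a -> 0 <= r < rho -> forall eps, 0 < eps ->
  exists n0, forall n, (n0 <= n)%nat -> forall z, Cmod z <= r ->
    Cmod (cps a z - csum n (fun j => a j * z ^ j)%C) <= eps.
Proof.
  intros Ha Hr eps He. assert (Hex := Conv_ex _ _ _ Ha Hr).
  destruct (Series_tail _ Hex eps He) as [n0 H0]. exists n0. intros n Hn z Hz.
  assert (Hs := Conv_asum rho a z Ha ltac:(lra)).
  unfold cps. rewrite (CSer_incr_n _ n Hs).
  match goal with |- Cmod (?x + ?y - ?x)%C <= _ => replace (x + y - x)%C with y by ring end.
  specialize (H0 n Hn). apply Rabs_def2 in H0. left. eapply Rle_lt_trans; [|apply H0].
  apply CSer_bound_le.
  - intros j. rewrite Cmod_mult, Cmod_pow. apply Rmult_le_compat_l; [apply Cmod_ge_0|].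
    apply pow_incr; split; [apply Cmod_ge_0|easy].
  - exact (proj1 (ex_series_incr_n (fun j => Cmod (a j) * r ^ j) n) Hex).
Qed.

(** Cauchy's estimate, up to the factor [2]. *)
Lemma cps_coef_bound rho a r M : Conv rho a -> 0 < r < rho ->
  (forall z, Cmod z = r -> Cmod (cps a z) <= M) ->
  forall q, Cmod (a q) * r ^ q <= 2 * M.
Proof.
  intros Ha Hr HM q. apply le_epsilon. intros eps He.
  destruct (cps_tail rho a r Ha ltac:(lra) (eps / 2) ltac:(lra)) as [n0 H0].
  set (n := (n0 + S q)%nat).
  assert (Hc : forall j, ccont (fun t => a j * r ^ j * (cexp t ^ j * Cconj (cexp t) ^ q))%C).
  { intros j. apply ccont_mult; [apply ccont_const|].
    apply ccont_mult; apply ccont_pow; [|apply ccont_conj]; apply ccont_cexp. }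
  assert (E : cint (fun t => csum n (fun j => a j * r ^ j * (cexp t ^ j * Cconj (cexp t) ^ q)))%C
     = (RtoC (2 * PI) * (a q * r ^ q))%C).
  { rewrite (cint_csum n (fun j t => a j * r ^ j * (cexp t ^ j * Cconj (cexp t) ^ q))%C Hc).
    rewrite (csum_single n _ q).
    - rewrite cint_scal, cint_orthogonal.
      + destruct (Nat.eq_dec q q); [ring|easy].
      + apply ccont_mult; apply ccont_pow; [|apply ccont_conj]; apply ccont_cexp.
    - unfold n; lia.
    - intros j _ Hj. rewrite cint_scal, cint_orthogonal.
      + destruct (Nat.eq_dec j q); [easy|ring].
      + apply ccont_mult; apply ccont_pow; [|apply ccont_conj]; apply ccont_cexp. }
  assert (B : Cmod (RtoC (2 * PI) * (a q * r ^ q))%C <= 2 * PI * (2 * (M + eps / 2))).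
  { rewrite <- E. apply cint_bound.
    - now apply (ccont_csum n (fun j t => a j * r ^ j * (cexp t ^ j * Cconj (cexp t) ^ q))%C).
    - intros t _. set (z := (RtoC r * cexp t)%C).
      assert (Hz : Cmod z = r) by (unfold z; rewrite Cmod_mult, Cmod_R, Cmod_cexp, Rabs_pos_eq; lra).
      rewrite (csum_ext n _ (fun j => Cconj (cexp t) ^ q * (a j * z ^ j))%C).
      2:{ intros j _. unfold z. rewrite Cpow_mult_l. ring. }
      rewrite csum_scal, Cmod_mult, Cmod_pow, Cmod_conj, Cmod_cexp, pow1, Rmult_1_l.
      specialize (H0 n ltac:(unfold n; lia) z ltac:(lra)). specialize (HM z Hz).
      rewrite Cmod_minus_sym in H0.
      assert (HT := Cmod_triangle_inv (csum n (fun j => a j * z ^ j)%C) (cps a z)). lra. }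
  assert (HPI := PI_RGT_0).
  rewrite !Cmod_mult, Cmod_pow, !Cmod_R, (Rabs_pos_eq (2 * PI)), (Rabs_pos_eq r) in B by lra.
  apply Rmult_le_reg_l in B; lra.
Qed.

Lemma cps_unique rho a b : 0 < rho -> Conv rho a -> Conv rho b ->
  (forall z, Cmod z < rho -> cps a z = cps b z) -> forall j, a j = b j.
Proof.
  intros Hr Ha Hb H j.
  assert (Hc : Conv rho (fun j => a j + -(1) * b j)%C) by (apply Conv_plus; [easy|now apply Conv_scal]).
  assert (E := cps_coef_bound rho _ (rho / 2) 0 Hc ltac:(lra)).
  assert (Cmod (a j + - (1) * b j) * (rho / 2) ^ j <= 2 * 0).
  { apply E. intros z Hz. rewrite (cps_plus rho), (cps_scal rho), H; auto using Conv_scal; try lra.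
    replace (cps b z + - (1) * cps b z)%C with (RtoC 0) by ring. rewrite Cmod_0; lra. }
  assert (0 < (rho / 2) ^ j) by (apply pow_lt; lra).
  assert (H2 : Cmod (a j + - (1) * b j) = 0).
  { assert (H3 := Cmod_ge_0 (a j + - (1) * b j)). nra. }
  apply Cmod_eq_0 in H2. replace (a j) with (a j + - (1) * b j + b j)%C by ring. rewrite H2; ring.
Qed.

(** Coefficients of [z ^ m] times the power series with coefficients [a]. *)
Definition shiftc (m : nat) (a : nat -> C) (q : nat) : C :=
  if (q <? m)%nat then 0%C else a (q - m)%nat.

Lemma shiftc_add m a j : shiftc m a (m + j) = a j.
Proof.
  unfold shiftc. destruct (Nat.ltb_spec (m + j) m); [lia|]. f_equal; lia.
Qed.

Lemma Conv_shiftc rho m a : Conv rho a -> Conv rho (shiftc m a).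
Proof.
  intros Ha r Hr. destruct (Ha r Hr) as [K HK].
  assert (HK0 : 0 <= K).
  { eapply Rle_trans; [|apply (HK O)]. apply Rmult_le_pos; [apply Cmod_ge_0|apply pow_le; lra]. }
  assert (Hm : 0 <= r ^ m) by (apply pow_le; lra).
  exists (K * r ^ m). intros q. unfold shiftc. destruct (Nat.ltb_spec q m) as [H|H].
  - rewrite Cmod_0, Rmult_0_l. now apply Rmult_le_pos.
  - replace q with ((q - m) + m)%nat at 2 by lia. rewrite pow_add, <- Rmult_assoc.
    apply Rmult_le_compat_r; auto.
Qed.

Lemma cps_shiftc rho m a z : Conv rho a -> Cmod z < rho ->
  cps (shiftc m a) z = (z ^ m * cps a z)%C.
Proof.
  intros Ha Hz. unfold cps.
  rewrite (CSer_incr_n _ m) by (apply (Conv_asum rho); auto using Conv_shiftc).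
  rewrite csum_0.
  - rewrite Cplus_0_l, <- CSer_scal by now apply (Conv_asum rho).
    apply CSer_ext. intros j. rewrite shiftc_add, Cpow_add_r. ring.
  - intros j Hj. unfold shiftc. destruct (Nat.ltb_spec j m); [ring|lia].
Qed.

Lemma Conv_csum rho n (f : nat -> nat -> C) : (forall p, Conv rho (f p)) ->
  Conv rho (fun j => csum n (fun p => f p j)).
Proof.
  intros H. induction n as [|n IH]; simpl.
  - apply (Conv_finite rho _ 0); easy.
  - now apply Conv_plus.
Qed.

Lemma cps_csum rho n (f : nat -> nat -> C) z : (forall p, Conv rho (f p)) -> Cmod z < rho ->
  cps (fun j => csum n (fun p => f p j)) z = csum n (fun p => cps (f p) z).
Proof.
  intros H Hz. induction n as [|n IH]; simpl.
  - now apply cps_0.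
  - rewrite (cps_plus rho), IH; auto. now apply Conv_csum.
Qed.

(** On the circle of radius [r] one has [conj z = r ^ 2 / z], so that [z ^ N]
    times a polyanalytic function is there the sum of a power series. *)
Lemma pser_fourier_bound N rho c r M : array N rho c -> 0 < r < rho ->
  (forall z, Cmod z = r -> Cmod (pser N c z) <= M) ->
  forall q, Cmod (csum N (fun p => shiftc (N - p) (c p) q * RtoC (r ^ 2) ^ p)%C) * r ^ q
    <= 2 * (M * r ^ N).
Proof.
  intros [Hc _] Hr HM q.
  assert (Hf : forall p, Conv rho (fun q => shiftc (N - p) (c p) q * RtoC (r ^ 2) ^ p)%C).
  { intros p r' Hr'. destruct (Conv_scal rho (RtoC (r ^ 2) ^ p) _ (Conv_shiftc rho (N - p) _ (Hc p)) r' Hr') as [K HK].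
    exists K. intros j. now rewrite Cmult_comm. }
  apply (cps_coef_bound rho (fun q => csum N (fun p => shiftc (N - p) (c p) q * RtoC (r ^ 2) ^ p)%C));
    [now apply (Conv_csum rho N (fun p q => shiftc (N - p) (c p) q * RtoC (r ^ 2) ^ p)%C)|easy|].
  intros z Hz.
  rewrite (cps_csum rho N (fun p q => shiftc (N - p) (c p) q * RtoC (r ^ 2) ^ p)%C) by (easy || lra).
  replace (csum N _) with (z ^ N * pser N c z)%C.
  - rewrite Cmod_mult, Cmod_pow, Hz, Rmult_comm. apply Rmult_le_compat_r; [apply pow_le; lra|auto].
  - unfold pser. rewrite <- csum_scal. apply csum_ext. intros p Hp.
    transitivity (RtoC (r ^ 2) ^ p * cps (shiftc (N - p) (c p)) z)%C.
    + rewrite (cps_shiftc rho) by (auto; lra).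
      rewrite <- Hz, Cmod2_conj, Cpow_mult_l.
      replace N with (p + (N - p))%nat at 1 by lia. rewrite Cpow_add_r. ring.
    + rewrite <- (cps_scal rho) by (auto using Conv_shiftc; lra). f_equal.
      apply functional_extensionality; intros j. ring.
Qed.

(** Division of a polynomial by [t - tau], with the relations between the
    coefficients of the polynomial and those of the quotient. *)
Lemma poly_div_root N : forall (a : nat -> C) (tau : C), exists (b : nat -> C) (r : C),
  (forall t, csum (S N) (fun p => a p * t ^ p)%C =
     ((t - tau) * csum N (fun i => b i * t ^ i) + r)%C) /\
  a O = (r - tau * b O)%C /\
  (forall p, (p < N)%nat -> a (S p) = (b p - tau * b (S p))%C) /\
  (forall i, (N <= i)%nat -> b i = 0%C).
Proof.
  induction N as [|N IH]; intros a tau.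
  - exists (fun _ => RtoC 0), (a O). split; [|split; [cbv beta iota; ring|split; [lia|easy]]].
    intros t; simpl; ring.
  - destruct (IH (fun p => a (S p)) tau) as [b [r [H1 [H2 [H3 H4]]]]].
    exists (fun i => match i with O => r | S i => b i end), (a O + tau * r)%C.
    split; [|split; [cbv beta iota; ring|split]].
    + intros t. rewrite csum_shift.
      rewrite (csum_ext (S N) _ (fun j => t * (a (S j) * t ^ j))%C) by (intros; rewrite Cpow_S; ring).
      rewrite csum_scal, H1, (csum_shift N).
      rewrite (csum_ext N (fun j => b j * t ^ S j)%C (fun j => t * (b j * t ^ j))%C)
        by (intros; rewrite Cpow_S; ring).
      rewrite csum_scal. simpl (t ^ 0)%C. ring.
    + intros [|p] Hp; [easy|]. apply H3; lia.
    + intros [|i] Hi; [lia|]. apply H4; lia.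
Qed.

(** The coefficients of a polynomial of degree less than [N] are controlled by
    its values at [N] points of [[- 4, 4]] whose mutual distances are at least
    [h]. *)
Lemma interpolation_bound N : exists K, 0 < K /\
  forall (a : nat -> C) (t : nat -> R) h M, 0 < h <= 1 ->
    (forall i, (i < N)%nat -> Rabs (t i) <= 4) ->
    (forall i j, (i < N)%nat -> (j < N)%nat -> i <> j -> h <= Rabs (t i - t j)) ->
    (forall i, (i < N)%nat -> Cmod (csum N (fun p => a p * RtoC (t i) ^ p)%C) <= M) ->
    forall p, (p < N)%nat -> Cmod (a p) <= K * M / h ^ N.
Proof.
  induction N as [|N [K [HK IH]]].
  - exists 1. split; [lra|]. intros; lia.
  - exists (1 + 10 * K). split; [lra|]. intros a t h M Hh Ht Hs HM p Hp.
    destruct (poly_div_root N a (RtoC (t N))) as [b [r [H1 [H2 [H3 H4]]]]].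
    assert (Hr : Cmod r <= M).
    { replace r with (csum (S N) (fun p => a p * RtoC (t N) ^ p)%C); [apply HM; lia|].
      rewrite H1. ring. }
    assert (HM0 : 0 <= M) by (assert (H0 := Cmod_ge_0 r); lra).
    assert (HhN : 0 < h ^ N) by (apply pow_lt; lra).
    set (B := K * (2 * M / h) / h ^ N).
    assert (HB0 : 0 <= B).
    { unfold B. apply Rdiv_le_0_compat; [|easy].
      apply Rmult_le_pos; [lra|]. apply Rdiv_le_0_compat; lra. }
    assert (HB : forall i, Cmod (b i) <= B).
    { intros i. destruct (Nat.lt_ge_cases i N) as [Hi|Hi].
      2:{ rewrite H4 by easy. rewrite Cmod_0; easy. }
      apply (IH b t h); [easy| | | |easy].
      - intros i' ?; apply Ht; lia.
      - intros i' j' ? ? ?; apply Hs; lia.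
      - intros i' Hi'. assert (Hd := Hs i' N ltac:(lia) ltac:(lia) ltac:(lia)).
        assert (E := H1 (RtoC (t i'))).
        assert (F : Cmod (RtoC (t i') - RtoC (t N)) * Cmod (csum N (fun i => b i * RtoC (t i') ^ i)%C) <= 2 * M).
        { rewrite <- Cmod_mult.
          replace ((RtoC (t i') - RtoC (t N)) * csum N (fun i => b i * RtoC (t i') ^ i))%C
            with (csum (S N) (fun p => a p * RtoC (t i') ^ p) + - r)%C by (rewrite E; ring).
          eapply Rle_trans; [apply Cmod_triangle|]. rewrite Cmod_opp.
          specialize (HM i' ltac:(lia)). lra. }
        rewrite <- RtoC_minus, Cmod_R in F.
        set (x := Cmod (csum N (fun i => b i * RtoC (t i') ^ i)%C)) in *.
        assert (Hx : 0 <= x) by apply Cmod_ge_0.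
        apply Rmult_le_reg_r with h; [lra|]. unfold Rdiv. rewrite Rmult_assoc, Rinv_l by lra.
        nra. }
    assert (HtN : Rabs (t N) <= 4) by (apply Ht; lia).
    assert (Hf : M + 5 * B <= (1 + 10 * K) * M / h ^ S N).
    { assert (M <= M / h ^ S N).
      { apply Rmult_le_reg_r with (h ^ S N); [apply pow_lt; lra|].
        unfold Rdiv. rewrite Rmult_assoc, Rinv_l by (apply pow_nonzero; lra).
        assert (h ^ S N <= 1) by (rewrite <- (pow1 (S N)); apply pow_incr; lra). nra. }
      replace ((1 + 10 * K) * M / h ^ S N) with (M / h ^ S N + 5 * B).
      - lra.
      - unfold B. simpl. field. split; lra. }
    eapply Rle_trans; [|apply Hf].
    assert (HT : forall x y, Cmod (x - RtoC (t N) * y) <= Cmod x + 4 * Cmod y).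
    { intros x y. unfold Cminus. eapply Rle_trans; [apply Cmod_triangle|].
      rewrite Cmod_opp, Cmod_mult, Cmod_R. assert (H0 := Cmod_ge_0 y). nra. }
    destruct p as [|p].
    + rewrite H2. specialize (HT r (b O)). specialize (HB O). lra.
    + rewrite H3 by lia. specialize (HT (b p) (b (S p))).
      assert (HBp := HB p). specialize (HB (S p)). lra.
Qed.

(** A polyanalytic function bounded by [M] on the disk of radius [rho]: its
    coefficients decay like [rho' ^ (- j)] for [rho' < rho], with a constant
    polynomial in [1 / (rho - rho')]. *)
Lemma pser_coef_bound N : exists K, 0 < K /\
  forall c rho rho' M, 1 <= rho' -> rho' < rho -> rho <= 2 -> array N rho c ->
    (forall z, Cmod z < rho -> Cmod (pser N c z) <= M) ->
    forall p j, (p < N)%nat -> Cmod (c p j) * rho' ^ j <= K * M / (rho - rho') ^ N.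
Proof.
  destruct (interpolation_bound N) as [K [HK HI]].
  assert (HN1 : 0 < INR (S N)) by (apply lt_0_INR; lia).
  assert (HN1' : 1 <= INR (S N)) by (apply (le_INR 1); lia).
  exists (K * (2 * 2 ^ N) * INR (S N) ^ N). split.
  { apply Rmult_lt_0_compat; [|now apply pow_lt]. apply Rmult_lt_0_compat; [lra|].
    apply Rmult_lt_0_compat; [lra|apply pow_lt; lra]. }
  intros c rho rho' M H1 Hlt H2 Hc HM p j Hp.
  assert (HM0 : 0 <= M).
  { eapply Rle_trans; [apply (Cmod_ge_0 (pser N c 0))|]. apply HM. rewrite Cmod_0; lra. }
  (* the nodes are the squares of [N] equidistant radii between [rho'] and [rho] *)
  set (h := (rho - rho') / INR (S N)).
  assert (Hh : 0 < h) by (apply Rdiv_lt_0_compat; lra).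
  assert (Hhd : h * INR (S N) = rho - rho') by (unfold h; field; lra).
  set (r := fun i => rho' + h * INR (S i)).
  assert (Hr : forall i, (i < N)%nat -> rho' < r i < rho).
  { intros i Hi. unfold r. assert (0 < INR (S i)) by (apply lt_0_INR; lia).
    assert (INR (S i) < INR (S N)) by (apply lt_INR; lia). nra. }
  set (q := ((N - p) + j)%nat).
  assert (Hq : 0 < rho' ^ q) by (apply pow_lt; lra).
  replace (c p j) with (shiftc (N - p) (c p) q) by (unfold q; apply shiftc_add).
  assert (HB := HI (fun p => shiftc (N - p) (c p) q) (fun i => r i ^ 2) h
    (2 * (M * 2 ^ N) / rho' ^ q)).
  assert (Hbound : Cmod (shiftc (N - p) (c p) q) <= K * (2 * (M * 2 ^ N) / rho' ^ q) / h ^ N).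
  { apply HB; try easy.
    - split; [easy|]. nra.
    - intros i Hi. specialize (Hr i Hi). rewrite Rabs_pos_eq by (apply pow_le; lra). nra.
    - assert (Hd : forall i i', (i < i')%nat -> (i' < N)%nat -> h <= r i' ^ 2 - r i ^ 2).
      { intros i i' Hii Hi'. assert (A := Hr i ltac:(lia)). assert (B := Hr i' ltac:(lia)).
        assert (h <= r i' - r i).
        { unfold r. assert (INR i + 1 <= INR i') by (rewrite <- S_INR; apply le_INR; lia).
          rewrite !S_INR. nra. }
        nra. }
      intros i i' Hi Hi' Hne. destruct (Nat.lt_ge_cases i i') as [Hl|Hl].
      + rewrite Rabs_minus_sym. eapply Rle_trans; [apply (Hd i i'); easy|apply Rle_abs].
      + eapply Rle_trans; [apply (Hd i' i); lia|apply Rle_abs].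
    - intros i Hi. destruct (Hr i Hi) as [Ha Hb].
      assert (HF := pser_fourier_bound N rho c (r i) M Hc ltac:(lra)
        ltac:(intros z Hz; apply HM; lra) q).
      set (x := Cmod _) in *.
      assert (Hx : 0 <= x) by apply Cmod_ge_0.
      apply Rmult_le_reg_r with (rho' ^ q); [easy|]. unfold Rdiv.
      rewrite (Rmult_assoc _ (/ _)), Rinv_l, Rmult_1_r by lra.
      assert (rho' ^ q <= r i ^ q) by (apply pow_incr; lra).
      assert (r i ^ N <= 2 ^ N) by (apply pow_incr; lra).
      assert (x * rho' ^ q <= x * r i ^ q) by (apply Rmult_le_compat_l; easy).
      assert (M * r i ^ N <= M * 2 ^ N) by (apply Rmult_le_compat_l; easy).
      lra. }
  assert (HhN : 0 < h ^ N) by now apply pow_lt.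
  assert (E : (rho - rho') ^ N = h ^ N * INR (S N) ^ N) by (rewrite <- Hhd; apply Rpow_mult_distr).
  rewrite E.
  assert (HNN : 0 < INR (S N) ^ N) by now apply pow_lt.
  replace (K * (2 * 2 ^ N) * INR (S N) ^ N * M / (h ^ N * INR (S N) ^ N))
    with (K * (2 * (M * 2 ^ N) / rho' ^ q) / h ^ N * rho' ^ q) by (field; lra).
  apply Rmult_le_compat; [apply Cmod_ge_0|apply pow_le; lra|easy|].
  apply Rle_pow; [easy|unfold q; lia].
Qed.

Lemma pow_bernoulli r n : 0 <= r <= 1 -> 1 - r ^ n <= INR n * (1 - r).
Proof.
  intros Hr. induction n as [|n IH]; [simpl; lra|].
  rewrite S_INR. simpl. assert (0 <= r ^ n <= 1).
  { split; [apply pow_le; lra|]. rewrite <- (pow1 n). apply pow_incr; lra. }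
  nra.
Qed.

(** Letting the radius tend to [1] in [pser_fourier_bound]. *)
Lemma pser_fourier_bound_1 N c M : array N 1 c ->
  (forall z, Cmod z < 1 -> Cmod (pser N c z) <= M) ->
  forall q, Cmod (csum N (fun p => shiftc (N - p) (c p) q)) <= 2 * M.
Proof.
  intros Hc HM q.
  set (a := fun p => shiftc (N - p) (c p) q).
  assert (HS : exists A, 0 <= A /\ forall p, (p < N)%nat -> Cmod (a p) <= A).
  { clearbody a. clear. induction N as [|N [A [HA H]]]; [exists 0; split; [lra|lia]|].
    assert (H0 := Cmod_ge_0 (a N)).
    exists (A + Cmod (a N)). split; [lra|]. intros p Hp.
    destruct (Nat.eq_dec p N) as [->|Hn]; [lra|]. specialize (H p ltac:(lia)); lra. }
  destruct HS as [A [HA HAp]].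
  assert (HM0 : 0 <= M).
  { eapply Rle_trans; [apply (Cmod_ge_0 (pser N c 0))|]. apply HM. rewrite Cmod_0; lra. }
  set (L := INR N * (A * INR (2 * N + q)) + 1).
  assert (HL : 0 < L).
  { assert (0 <= INR N * (A * INR (2 * N + q)));
      [apply Rmult_le_pos; [apply pos_INR|apply Rmult_le_pos; [easy|apply pos_INR]]|unfold L; lra]. }
  apply le_epsilon. intros eps He.
  set (d := Rmin (1 / 2) (eps / L)).
  assert (Hd : 0 < d <= 1 / 2).
  { split; [apply Rmin_pos; [lra|now apply Rdiv_lt_0_compat]|apply Rmin_l]. }
  assert (HdL : d * L <= eps).
  { assert (d <= eps / L) by apply Rmin_r.
    apply (Rmult_le_compat_r L) in H; [|lra]. unfold Rdiv in H.
    rewrite Rmult_assoc, Rinv_l in H; lra. }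
  set (r := 1 - d).
  assert (Hr : 0 < r < 1) by (unfold r; lra).
  assert (HF := pser_fourier_bound N 1 c r M Hc Hr
     ltac:(intros z Hz; apply HM; rewrite Hz; apply Hr) q).
  assert (E : csum N a = (csum N (fun p => a p * (1 - RtoC (r ^ 2) ^ p * RtoC (r ^ q))) +
     RtoC (r ^ q) * csum N (fun p => a p * RtoC (r ^ 2) ^ p))%C).
  { rewrite <- csum_scal, <- csum_plus. apply csum_ext. intros; ring. }
  rewrite E. eapply Rle_trans; [apply Cmod_triangle|].
  assert (Hrq : forall n, 0 <= r ^ n <= 1).
  { intros n. split; [apply pow_le; unfold r; lra|]. rewrite <- (pow1 n). apply pow_incr; unfold r; lra. }
  rewrite Cmod_mult, Cmod_R, (Rabs_pos_eq (r ^ q)) by apply Hrq.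
  rewrite Rmult_comm in HF.
  assert (H1 : M * r ^ N <= M) by (specialize (Hrq N); nra).
  assert (H2 : Cmod (csum N (fun p => a p * (1 - RtoC (r ^ 2) ^ p * RtoC (r ^ q)))%C) <= d * L).
  { eapply Rle_trans; [apply (csum_bound _ _ (A * (INR (2 * N + q) * d)))|].
    - intros p Hp. rewrite Cmod_mult. apply Rmult_le_compat; auto using Cmod_ge_0.
      replace (1 - RtoC (r ^ 2) ^ p * RtoC (r ^ q))%C with (RtoC (1 - r ^ (2 * p + q))).
      2:{ rewrite pow_add, pow_mult, RtoC_minus, RtoC_mult, !RtoC_pow. easy. }
      rewrite Cmod_R, Rabs_pos_eq by (specialize (Hrq (2 * p + q)%nat); lra).
      eapply Rle_trans; [apply pow_bernoulli; unfold r; lra|].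
      replace (1 - r) with d by (unfold r; ring). apply Rmult_le_compat_r; [lra|].
      apply le_INR; lia.
    - unfold L. replace (INR N * (A * (INR (2 * N + q) * d)))
        with (d * (INR N * (A * INR (2 * N + q)))) by ring. nra. }
  change (r ^ q * Cmod (csum N (fun p => a p * RtoC (r ^ 2) ^ p)%C) <= 2 * (M * r ^ N)) in HF. lra.
Qed.

(** * Cauchy's formula *)

Lemma disk_open rho (z : C) : Cmod z < rho -> locally z (fun w : C => Cmod w < rho).
Proof.
  intros Hz. assert (H2 : 0 < sqrt 2) by (apply sqrt_lt_R0; lra).
  assert (Hd : 0 < (rho - Cmod z) / sqrt 2) by (apply Rdiv_lt_0_compat; lra).
  exists (mkposreal _ Hd). intros w Hw.
  apply C_NormedModule_mixin_compat2 in Hw. simpl in Hw.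
  replace (sqrt 2 * ((rho - Cmod z) / sqrt 2)) with (rho - Cmod z) in Hw by (field; lra).
  change (Cmod (w - z) < rho - Cmod z) in Hw.
  assert (H := Cmod_triangle_inv w z). lra.
Qed.

Lemma continuous_Re (f : C -> C) (z : C) : continuous f z -> continuous (fun w => Re (f w)) z.
Proof.
  intros H. apply (continuous_comp f (fun w : C => fst w)); [exact H|].
  destruct (f z). apply (continuous_fst (U := R_UniformSpace) (V := R_UniformSpace)).
Qed.

Lemma continuous_Im (f : C -> C) (z : C) : continuous f z -> continuous (fun w => Im (f w)) z.
Proof.
  intros H. apply (continuous_comp f (fun w : C => snd w)); [exact H|].
  destruct (f z). apply (continuous_snd (U := R_UniformSpace) (V := R_UniformSpace)).
Qed.

(** Chain rule along a path, for a function of class [C^1] with vanishing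
    [dbar]: its differential is multiplication by [partial_x f]. *)
Lemma Cder_path f (g : R -> C) t l :
  class_C 1 unit_disk f -> (forall z, unit_disk z -> dbar f z = 0%C) ->
  Cmod (g t) < 1 -> Cder g t l ->
  Cder (fun s => f (g s)) t (partial_x f (g t) * l)%C.
Proof.
  intros [Hc [He [[Hcx _] [Hcy _]]]] Hdb Hg [Hl1 Hl2].
  assert (Hy : partial_y f (g t) = (Ci * partial_x f (g t))%C).
  { specialize (Hdb _ Hg). unfold dbar in Hdb.
    set (u := partial_x f (g t)) in *. set (v := partial_y f (g t)) in *.
    replace v with (- Ci * (2 * (/ 2 * (u + Ci * v))) + Ci * u)%C.
    - rewrite Hdb. ring.
    - replace (2 * (/ 2 * (u + Ci * v)))%C with (u + Ci * v)%C by field.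
      replace (- Ci * (u + Ci * v) + Ci * u)%C with (- (Ci * Ci) * v)%C by ring.
      replace (- (Ci * Ci))%C with (RtoC 1) by (apply injective_projections; simpl; ring).
      ring. }
  assert (Hloc := disk_open 1 (g t) Hg).
  assert (D1 : differentiable_pt_lim (fun x y => Re (f (x, y))) (Re (g t)) (Im (g t))
    (Re (partial_x f (g t))) (Re (partial_y f (g t)))).
  { apply filterdiff_differentiable_pt_lim.
    assert (FD := is_derive_filterdiff (fun x y => Re (f (x, y))) (Re (g t)) (Im (g t))
      (fun x y => Re (partial_x f (x, y))) (Re (partial_y f (g t)))).
    destruct (g t) as [x0 y0]. apply FD.
    - revert Hloc. apply filter_imp. intros [x y] Hw.
      destruct (He _ Hw) as [Hex _]. apply (Cder_partial_x _ _ Hex).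
    - destruct (He _ Hg) as [_ Hey]. apply (Cder_partial_y _ _ Hey).
    - eapply continuous_ext; [|apply (continuous_Re (partial_x f)), (Hcx _ Hg)].
      intros [x y]; easy. }
  assert (D2 : differentiable_pt_lim (fun x y => Im (f (x, y))) (Re (g t)) (Im (g t))
    (Im (partial_x f (g t))) (Im (partial_y f (g t)))).
  { apply filterdiff_differentiable_pt_lim.
    assert (FD := is_derive_filterdiff (fun x y => Im (f (x, y))) (Re (g t)) (Im (g t))
      (fun x y => Im (partial_x f (x, y))) (Im (partial_y f (g t)))).
    destruct (g t) as [x0 y0]. apply FD.
    - revert Hloc. apply filter_imp. intros [x y] Hw.
      destruct (He _ Hw) as [Hex _]. apply (Cder_partial_x _ _ Hex).
    - destruct (He _ Hg) as [_ Hey]. apply (Cder_partial_y _ _ Hey).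
    - eapply continuous_ext; [|apply (continuous_Im (partial_x f)), (Hcx _ Hg)].
      intros [x y]; easy. }
  apply is_derive_Reals in Hl1, Hl2.
  rewrite Hy in D1, D2.
  assert (P1 := derivable_pt_lim_comp_2d _ _ _ _ _ _ _ _ D1 Hl1 Hl2).
  assert (P2 := derivable_pt_lim_comp_2d _ _ _ _ _ _ _ _ D2 Hl1 Hl2).
  apply is_derive_Reals in P1, P2.
  set (u := partial_x f (g t)) in *. clearbody u.
  split.
  - replace (Re (u * l)) with (Re u * Re l + Re (Ci * u) * Im l) by (unfold Re, Im; simpl; ring).
    eapply is_derive_ext; [|exact P1]. intros s; simpl. now destruct (g s).
  - replace (Im (u * l)) with (Im u * Re l + Im (Ci * u) * Im l) by (unfold Re, Im; simpl; ring).
    eapply is_derive_ext; [|exact P2]. intros s; simpl. now destruct (g s).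
Qed.

Lemma ccont_comp (F : C -> C) (g : R -> C) : (forall t, continuous F (g t)) -> ccont g ->
  ccont (fun t => F (g t)).
Proof.
  intros HF Hg t. destruct (Hg t) as [H1 H2].
  assert (Hc : continuous (fun s => (Re (g s), Im (g s)) : C) t).
  { apply continuous_comp_2 with (f := fun s => Re (g s)) (g := fun s => Im (g s))
      (h := fun x y => (x, y) : C); try easy. apply continuous_ext with (fun p : R * R => p); [now intros []|].
    apply continuous_id. }
  assert (Hc' : continuous g t).
  { apply continuous_ext with (fun s => (Re (g s), Im (g s)) : C); [|exact Hc].
    intros s; now destruct (g s). }
  split.
  - apply (continuous_comp g (fun w => Re (F w))); [easy|]. now apply continuous_Re.
  - apply (continuous_comp g (fun w => Im (F w))); [easy|]. now apply continuous_Im.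
Qed.

Lemma continuity_2d_comp (F : C -> C) (w : R -> R -> C) s t :
  continuous F (w s t) ->
  continuity_2d_pt (fun u v => Re (w u v)) s t ->
  continuity_2d_pt (fun u v => Im (w u v)) s t ->
  continuity_2d_pt (fun u v => Re (F (w u v))) s t /\
  continuity_2d_pt (fun u v => Im (F (w u v))) s t.
Proof.
  intros HF H1 H2.
  assert (G : forall eps, 0 < eps -> locally_2d (fun u v => Cmod (F (w u v) - F (w s t)) < eps) s t).
  { intros eps He. destruct (proj1 (continuous_C_iff F _) HF eps He) as [d [Hd HH]].
    assert (Hd2 : 0 < d / 2) by lra.
    destruct (H1 (mkposreal _ Hd2)) as [d1 K1], (H2 (mkposreal _ Hd2)) as [d2 K2].
    assert (Hm : 0 < Rmin d1 d2) by (apply Rmin_pos; apply cond_pos).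
    exists (mkposreal _ Hm). intros u v Hu Hv. simpl in *.
    assert (M1 := Rmin_l d1 d2). assert (M2 := Rmin_r d1 d2).
    specialize (K1 u v ltac:(lra) ltac:(lra)). specialize (K2 u v ltac:(lra) ltac:(lra)).
    apply HH. eapply Rle_lt_trans; [apply Cmod_le_ReIm|].
    change (Rabs (Re (w u v) - Re (w s t)) + Rabs (Im (w u v) - Im (w s t)) < d). lra. }
  split; intros eps; destruct (G eps (cond_pos eps)) as [d Hd]; exists d; intros u v Hu Hv;
    (eapply Rle_lt_trans; [|apply (Hd u v Hu Hv)]).
  - apply (re_le_Cmod (F (w u v) - F (w s t))).
  - apply (im_le_Cmod (F (w u v) - F (w s t))).
Qed.

Lemma ccont_continuity_2d g s t : ccont g ->
  continuity_2d_pt (fun _ v => Re (g v)) s t /\ continuity_2d_pt (fun _ v => Im (g v)) s t.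
Proof.
  intros Hg. destruct (Hg t).
  split.
  - apply (continuity_1d_2d_pt_comp (fun v => Re (g v)) (fun _ v => v)); [|apply continuity_2d_pt_id2].
    now apply continuity_pt_filterlim.
  - apply (continuity_1d_2d_pt_comp (fun v => Im (g v)) (fun _ v => v)); [|apply continuity_2d_pt_id2].
    now apply continuity_pt_filterlim.
Qed.

Lemma continuity_2d_Cmult (f g : R -> R -> C) s t :
  continuity_2d_pt (fun u v => Re (f u v)) s t ->
  continuity_2d_pt (fun u v => Im (f u v)) s t ->
  continuity_2d_pt (fun u v => Re (g u v)) s t ->
  continuity_2d_pt (fun u v => Im (g u v)) s t ->
  continuity_2d_pt (fun u v => Re (f u v * g u v)%C) s t /\
  continuity_2d_pt (fun u v => Im (f u v * g u v)%C) s t.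
Proof.
  intros H1 H2 H3 H4. split.
  - apply (continuity_2d_pt_minus (fun u v => Re (f u v) * Re (g u v)) (fun u v => Im (f u v) * Im (g u v)));
      now apply continuity_2d_pt_mult.
  - apply (continuity_2d_pt_plus (fun u v => Re (f u v) * Im (g u v)) (fun u v => Im (f u v) * Re (g u v)));
      now apply continuity_2d_pt_mult.
Qed.

(** Integrals over the circle of a family depending on a parameter: if the
    integral of the derivative vanishes for [s <> 0], the integral is the same
    at [s = 0] and [s = 1]. *)
Lemma cint_param_const (A dA : R -> R -> C) eta : 0 < eta ->
  (forall s t, - eta < s < 1 + eta -> Cder (fun u => A u t) s (dA s t)) ->
  (forall s t, - eta < s < 1 + eta ->
     continuity_2d_pt (fun u v => Re (dA u v)) s t /\
     continuity_2d_pt (fun u v => Im (dA u v)) s t) ->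
  (forall s, - eta < s < 1 + eta -> ccont (A s)) ->
  (forall s, - eta < s < 1 + eta -> s <> 0 -> cint (dA s) = 0%C) ->
  cint (A 1) = cint (A 0).
Proof.
  intros Heta HD HC HA H0.
  assert (HS : forall s, - eta < s < 1 + eta -> locally s (fun u => - eta < u < 1 + eta)).
  { intros s Hs. apply (open_and (fun u => - eta < u) (fun u => u < 1 + eta)); [apply open_gt|apply open_lt|easy]. }
  assert (K : forall (p : C -> R), (p = Re \/ p = Im) -> 
    RInt (fun t => p (A 1 t)) 0 (2 * PI) = RInt (fun t => p (A 0 t)) 0 (2 * PI)).
  { intros p Hp.
    assert (HDp : forall s t, - eta < s < 1 + eta -> is_derive (fun u => p (A u t)) s (p (dA s t))).
    { intros s t Hs. destruct (HD s t Hs), Hp; subst p; easy. }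
    assert (Hpar : forall s, - eta < s < 1 + eta ->
      is_derive (fun u => RInt (fun t => p (A u t)) 0 (2 * PI)) s
        (RInt (fun t => p (dA s t)) 0 (2 * PI))).
    { intros s Hs.
      rewrite (RInt_ext _ (fun t => Derive (fun u => p (A u t)) s)).
      2:{ intros t _. symmetry. apply is_derive_unique. now apply HDp. }
      apply (is_derive_RInt_param (fun u t => p (A u t))).
      - generalize (HS s Hs). apply filter_imp. intros u Hu t _.
        eexists; now apply HDp.
      - intros t _. apply continuity_2d_pt_ext_loc with (fun u v => p (dA u v)).
        + destruct (HS s Hs) as [d Hd]. exists d. intros u v Hu _. symmetry.
          apply is_derive_unique. apply HDp. now apply Hd.
        + destruct (HC s t Hs), Hp; subst p; easy.
      - generalize (HS s Hs). apply filter_imp. intros u Hu.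
        destruct (ccont_ex _ (HA u Hu)), Hp; subst p; easy. }
    destruct (MVT_gen (fun u => RInt (fun t => p (A u t)) 0 (2 * PI)) 0 1 (fun _ => 0)) as [c [_ Hc]].
    - intros s Hs. rewrite Rmin_left, Rmax_right in Hs by lra.
      assert (E := H0 s ltac:(lra) ltac:(lra)).
      replace 0 with (RInt (fun t => p (dA s t)) 0 (2 * PI)) at 1.
      + apply Hpar; lra.
      + destruct Hp; subst p; [apply (f_equal fst) in E|apply (f_equal snd) in E]; exact E.
    - intros s Hs. rewrite Rmin_left, Rmax_right in Hs by lra.
      apply continuity_pt_filterlim.
      apply (ex_derive_continuous (V := R_NormedModule) (fun u => RInt (fun t => p (A u t)) 0 (2 * PI))).
      eexists. apply Hpar; lra.
    - lra. }
  apply injective_projections; apply K; auto.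
Qed.

Lemma Cmod_lt_1_neq (q : C) : Cmod q < 1 -> (1 - q)%C <> 0%C.
Proof.
  intros H E. assert (q = 1)%C by (replace q with (1 - (1 - q))%C by ring; rewrite E; ring).
  subst q. rewrite Cmod_1 in H. lra.
Qed.

Lemma geom_C (q : C) n : (1 - q)%C <> 0%C ->
  (/ (1 - q))%C = (csum n (fun j => q ^ j) + q ^ n * / (1 - q))%C.
Proof.
  intros H. induction n as [|n IH]; simpl.
  - ring.
  - rewrite IH at 1. field. easy.
Qed.

Lemma ccont_inv g : ccont g -> (forall t, g t <> 0%C) -> ccont (fun t => / g t)%C.
Proof.
  intros Hg H0 t. destruct (Hg t) as [H1 H2].
  assert (Hn : Re (g t) ^ 2 + Im (g t) ^ 2 <> 0).
  { intros E. apply (H0 t). rewrite <- Cmod2_alt in E. apply Cmod_eq_0.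
    assert (H := Cmod_ge_0 (g t)). nra. }
  assert (M := fun u v => continuous_mult (K := R_AbsRing) u v t).
  assert (Hi : continuous (fun s => / (Re (g s) ^ 2 + Im (g s) ^ 2)) t).
  { apply (continuous_comp (fun s => Re (g s) ^ 2 + Im (g s) ^ 2) Rinv).
    - apply (continuous_plus (V := R_NormedModule)).
      + simpl. apply M; [easy|]. apply M; [easy|apply continuous_const].
      + simpl. apply M; [easy|]. apply M; [easy|apply continuous_const].
    - apply continuity_pt_filterlim. apply continuity_pt_inv; [|easy].
      apply derivable_continuous_pt, derivable_pt_id. }
  split.
  - apply (M (fun s => Re (g s))); easy.
  - apply (M (fun s => - Im (g s))); [|easy].
    now apply (continuous_opp (V := R_NormedModule)).
Qed.

(** Integration against [g] of the expansion of the Cauchy kernel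
    [/ (1 - (z / r) * conj (exp (i t)))] in powers of [z]. *)
Lemma cauchy_kernel g M r z : ccont g -> (forall t, 0 <= t <= 2 * PI -> Cmod (g t) <= M) -> 0 < r -> Cmod z < r ->
  Clim (fun n => csum n (fun j => cint (fun t => g t * Cconj (cexp t) ^ j) * (/ r) ^ j * z ^ j))%C
    (cint (fun t => g t * / (1 - z / r * Cconj (cexp t)))%C).
Proof.
  intros Hg HM Hr Hz.
  assert (Hr0 : RtoC r <> 0%C) by (intros E; apply RtoC_inj in E; lra).
  set (q := fun t => (z / r * Cconj (cexp t))%C).
  set (x := Cmod z / r).
  assert (Hx : 0 <= x < 1).
  { unfold x. split; [apply Rdiv_le_0_compat; [apply Cmod_ge_0|easy]|].
    apply Rmult_lt_reg_r with r; [easy|]. unfold Rdiv. rewrite Rmult_assoc, Rinv_l; lra. }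
  assert (Hq : forall t, Cmod (q t) = x).
  { intros t. unfold q. rewrite Cmod_mult, Cmod_conj, Cmod_cexp, Cmod_div, Cmod_R, Rabs_pos_eq by (easy || lra).
    unfold x; ring. }
  assert (Hq1 : forall t, (1 - q t)%C <> 0%C) by (intros t; apply Cmod_lt_1_neq; rewrite Hq; lra).
  assert (Hqc : ccont q) by (apply ccont_mult; [apply ccont_const|apply ccont_conj, ccont_cexp]).
  assert (Hkc : ccont (fun t => / (1 - q t))%C).
  { apply ccont_inv; [|easy].
    apply (ccont_plus (fun _ => 1%C) (fun t => - q t)%C); [apply ccont_const|].
    intros t; destruct (Hqc t); split; apply (continuous_opp (V := R_NormedModule)); easy. }
  assert (HPI := PI_RGT_0).
  assert (HM0 : 0 <= M) by (eapply Rle_trans; [apply (Cmod_ge_0 (g 0))|apply HM; lra]).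
  assert (Hk : forall t, Cmod (/ (1 - q t))%C <= / (1 - x)).
  { intros t. rewrite Cmod_inv by easy. apply Rinv_le_contravar; [lra|].
    assert (H := Cmod_triangle_inv 1 (q t)). rewrite Cmod_1, Hq in H. lra. }
  assert (Hi0 : 0 < / (1 - x)) by (apply Rinv_0_lt_compat; lra).
  assert (Hpow : forall n, ccont (fun t => g t * q t ^ n)%C) by (intros n; apply ccont_mult; [easy|now apply ccont_pow]).
  assert (E : forall n, (csum n (fun j => cint (fun t => g t * Cconj (cexp t) ^ j) * (/ r) ^ j * z ^ j) -
      cint (fun t => g t * / (1 - q t)))%C = (- (1) * cint (fun t => g t * q t ^ n * / (1 - q t)))%C).
  { intros n.
    rewrite (cint_ext (fun t => g t * / (1 - q t))%C
      (fun t => csum n (fun j => g t * q t ^ j) + g t * q t ^ n * / (1 - q t))%C).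
    2:{ intros t. rewrite (geom_C (q t) n) at 1 by easy. rewrite csum_scal. change (fun j => q t ^ j)%C with (Cpow (q t)). ring. }
    rewrite cint_plus; [|now apply (ccont_csum n (fun j t => g t * q t ^ j)%C)|now apply (ccont_mult (fun t => g t * q t ^ n)%C)].
    rewrite (cint_csum n (fun j t => g t * q t ^ j)%C) by easy.
    rewrite (csum_ext n (fun j => cint (fun t => g t * q t ^ j)%C)
      (fun j => cint (fun t => g t * Cconj (cexp t) ^ j) * (/ r) ^ j * z ^ j)%C); [ring|].
    intros j _.
    rewrite (cint_ext _ (fun t => ((/ r) ^ j * z ^ j) * (g t * Cconj (cexp t) ^ j))%C).
    - rewrite cint_scal; [ring|]. apply ccont_mult; [easy|]. apply ccont_pow, ccont_conj, ccont_cexp.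
    - intros t. unfold q, Cdiv. rewrite !Cpow_mult_l. ring. }
  intros eps He.
  set (L := 2 * PI * (2 * (M * / (1 - x))) + 1).
  assert (HL : 0 < L).
  { assert (0 <= M * / (1 - x)) by (apply Rmult_le_pos; lra).
    assert (0 <= 2 * PI * (2 * (M * / (1 - x)))) by (apply Rmult_le_pos; lra). unfold L; lra. }
  assert (HeL : 0 < eps / L) by now apply Rdiv_lt_0_compat.
  destruct (pow_lt_1_zero x ltac:(rewrite Rabs_pos_eq; lra) (eps / L) HeL) as [n0 Hn0].
  exists n0. intros n Hn. change (fun t => g t * / (1 - z / r * Cconj (cexp t)))%C
    with (fun t => g t * / (1 - q t))%C.
  rewrite E, Cmod_mult, Cmod_opp, Cmod_1, Rmult_1_l.
  assert (Hxn : 0 <= x ^ n) by (apply pow_le; lra).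
  assert (B : Cmod (cint (fun t => g t * q t ^ n * / (1 - q t))%C) <= 2 * PI * (2 * (M * x ^ n * / (1 - x)))).
  { apply cint_bound; [now apply (ccont_mult (fun t => g t * q t ^ n)%C)|].
    intros t Ht. rewrite !Cmod_mult, Cmod_pow, Hq.
    apply Rmult_le_compat; auto using Cmod_ge_0.
    - apply Rmult_le_pos; [apply Cmod_ge_0|easy].
    - apply Rmult_le_compat_r; auto. }
  specialize (Hn0 n Hn). rewrite Rabs_pos_eq in Hn0 by easy.
  eapply Rle_lt_trans; [exact B|].
  apply Rle_lt_trans with (x ^ n * L).
  - unfold L. replace (2 * PI * (2 * (M * x ^ n * / (1 - x)))) with
      (x ^ n * (2 * PI * (2 * (M * / (1 - x))))) by ring. nra.
  - apply Rmult_lt_compat_r with (r := L) in Hn0; [|easy].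
    unfold Rdiv in Hn0. rewrite Rmult_assoc, Rinv_l in Hn0; lra.
Qed.

(** Cauchy's formula on the circle of radius [r]; the coefficients [b] may at
    this stage depend on [r]. *)
Lemma cauchy_expansion f r : class_C 1 unit_disk f ->
  (forall z, unit_disk z -> dbar f z = 0%C) -> 0 < r < 1 ->
  exists (b : nat -> C) K, (forall j, Cmod (b j) * r ^ j <= K) /\
    forall z, Cmod z < r -> f z = cps b z.
Proof.
  intros Hf Hdb Hr. assert (HPI := PI_RGT_0).
  assert (Hf' := Hf). destruct Hf' as [Hc Hrest].
  assert (Hcx : forall z, unit_disk z -> continuous (partial_x f) z) by apply Hrest.
  assert (Hr0 : RtoC r <> 0%C) by (intros E; apply RtoC_inj in E; lra).
  set (g := fun t => f (RtoC r * cexp t)%C).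
  assert (Hre : forall t, Cmod (RtoC r * cexp t) = r).
  { intros t. rewrite Cmod_mult, Cmod_R, Cmod_cexp, Rabs_pos_eq; lra. }
  assert (Hrc : ccont (fun t => RtoC r * cexp t)%C) by (apply ccont_mult; [apply ccont_const|apply ccont_cexp]).
  assert (Hg : ccont g).
  { apply (ccont_comp f); [|easy]. intros t. apply Hc. unfold unit_disk, disk. rewrite Hre. lra. }
  assert (HM : exists M, forall t, 0 <= t <= 2 * PI -> Cmod (g t) <= M).
  { assert (Hcm : forall t, continuity_pt (fun s => Rabs (Re (g s)) + Rabs (Im (g s))) t).
    { intros t. destruct (Hg t) as [H1 H2].
      apply (continuity_pt_plus (fun s => Rabs (Re (g s))) (fun s => Rabs (Im (g s)))).
      - apply (continuity_pt_comp (fun s => Re (g s)) Rabs); [now apply continuity_pt_filterlim|apply Rcontinuity_abs].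
      - apply (continuity_pt_comp (fun s => Im (g s)) Rabs); [now apply continuity_pt_filterlim|apply Rcontinuity_abs]. }
    destruct (continuity_ab_maj _ 0 (2 * PI) ltac:(lra) (fun t _ => Hcm t)) as [m [Hm _]].
    exists (Rabs (Re (g m)) + Rabs (Im (g m))). intros t Ht.
    eapply Rle_trans; [apply Cmod_le_ReIm|]. now apply Hm. }
  destruct HM as [M HM].
  set (b := fun j => (/ RtoC (2 * PI) * (cint (fun t => g t * Cconj (cexp t) ^ j)%C * (/ RtoC r) ^ j))%C).
  assert (H2pi : RtoC (2 * PI) <> 0%C) by (intros E; apply RtoC_inj in E; lra).
  assert (Hb : forall j, Cmod (b j) * r ^ j <= 2 * M).
  { intros j. unfold b. rewrite !Cmod_mult, Cmod_pow, !Cmod_inv, !Cmod_R, !Rabs_pos_eq by (easy || lra).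
    assert (B : Cmod (cint (fun t => g t * Cconj (cexp t) ^ j)%C) <= 2 * PI * (2 * M)).
    { apply cint_bound.
      - apply ccont_mult; [easy|]. apply ccont_pow, ccont_conj, ccont_cexp.
      - intros t Ht. rewrite Cmod_mult, Cmod_pow, Cmod_conj, Cmod_cexp, pow1, Rmult_1_r. auto. }
    assert (Hrj : 0 < r ^ j) by (apply pow_lt; lra).
    rewrite pow_inv, !Rmult_assoc, Rinv_l, Rmult_1_r by lra.
    apply Rmult_le_reg_l with (2 * PI); [lra|].
    rewrite <- Rmult_assoc, Rinv_r, Rmult_1_l by lra. exact B. }
  exists b, (2 * M). split; [exact Hb|]. intros z Hz.
  assert (Hbc : Conv r b).
  { intros r' Hr'. exists (2 * M). intros j. eapply Rle_trans; [|apply (Hb j)].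
    apply Rmult_le_compat_l; [apply Cmod_ge_0|apply pow_incr; lra]. }
  set (k := fun t => (/ (1 - z / r * Cconj (cexp t)))%C).
  assert (Hkey : cint (fun t => g t * k t)%C = (RtoC (2 * PI) * f z)%C).
  { (* only the constant term of the kernel has a nonzero integral *)
    assert (Hk1 : cint (fun t => 1 * k t)%C = RtoC (2 * PI)).
    { eapply Clim_unique.
      - apply (cauchy_kernel (fun _ => 1%C) 1); [apply ccont_const| |lra|easy].
        intros; rewrite Cmod_1; lra.
      - intros eps He. exists 1%nat. intros [|n] Hn; [lia|].
        rewrite (csum_single _ _ 0); [|lia|].
        + rewrite (cint_ext _ (fun t => cexp t ^ 0 * Cconj (cexp t) ^ 0)%C) by (intros; simpl; ring).
          rewrite cint_orthogonal. simpl.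
          replace (RtoC (2 * PI) * 1 * 1 - RtoC (2 * PI))%C with (RtoC 0) by ring.
          now rewrite Cmod_0.
        + intros j _ Hj.
          rewrite (cint_ext _ (fun t => cexp t ^ 0 * Cconj (cexp t) ^ j)%C) by (intros; simpl; ring).
          rewrite cint_orthogonal. destruct (Nat.eq_dec 0 j); [lia|]. ring. }
    (* contraction of the circle onto the point [z]; [s] is allowed to leave
       [[0, 1]] slightly so that derivatives exist at both ends *)
    set (e := fun t => (RtoC r * cexp t)%C) in *.
    set (w := fun s t => (z + RtoC s * (e t - z))%C).
    set (eta := (1 - r) / 4).
    assert (Heta : 0 < eta) by (unfold eta; lra).
    assert (Hw : forall s t, - eta < s < 1 + eta -> Cmod (w s t) < 1).
    { intros s t Hs. unfold w. 
      replace (z + RtoC s * (e t - z))%C with (RtoC (1 - s) * z + RtoC s * e t)%C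
        by (rewrite RtoC_minus; ring).
      eapply Rle_lt_trans; [apply Cmod_triangle|]. rewrite !Cmod_mult, !Cmod_R, (Hre t : Cmod (e t) = r).
      assert (HA : Rabs (1 - s) + Rabs s <= 1 + 2 * eta).
      { unfold Rabs. destruct (Rcase_abs (1 - s)), (Rcase_abs s); lra. }
      assert (Rabs (1 - s) * Cmod z <= Rabs (1 - s) * r) by (apply Rmult_le_compat_l; [apply Rabs_pos|lra]).
      assert ((Rabs (1 - s) + Rabs s) * r <= (1 + 2 * eta) * r) by (apply Rmult_le_compat_r; lra).
      unfold eta in *. nra. }
    assert (Hq1 : forall t, (1 - z / r * Cconj (cexp t))%C <> 0%C).
    { intros t. apply Cmod_lt_1_neq. rewrite Cmod_mult, Cmod_conj, Cmod_cexp, Cmod_div, Cmod_R, Rabs_pos_eq by (easy || lra).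
      rewrite Rmult_1_r. apply Rmult_lt_reg_r with r; [lra|]. unfold Rdiv. rewrite Rmult_assoc, Rinv_l; lra. }
    assert (Hkc : ccont k).
    { apply ccont_inv; [|easy].
      apply (ccont_plus (fun _ => 1%C) (fun t => - (z / r * Cconj (cexp t)))%C); [apply ccont_const|].
      assert (Hqc : ccont (fun t => - (z / r) * Cconj (cexp t))%C)
        by (apply ccont_mult; [apply ccont_const|apply ccont_conj, ccont_cexp]).
      intros t. destruct (Hqc t) as [Q1 Q2].
      split; [revert Q1|revert Q2]; apply continuous_ext; intros s; f_equal; ring. }
    assert (Hke : forall t, ((e t - z) * k t)%C = e t).
    { intros t. replace (e t - z)%C with (e t * (1 - z / r * Cconj (cexp t)))%C.
      - unfold k. rewrite <- Cmult_assoc, Cinv_r by apply Hq1. ring.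
      - unfold e. transitivity (RtoC r * cexp t - z * (cexp t * Cconj (cexp t)))%C.
        + field. easy.
        + rewrite cexp_conj. ring. }
    assert (Hwc : forall s, ccont (w s)).
    { intros s. apply ccont_plus; [apply ccont_const|]. apply ccont_mult; [apply ccont_const|].
      apply (ccont_plus e (fun _ => - z)%C); [easy|apply ccont_const]. }
    assert (Hws : forall s t, Cder (fun u => w u t) s (e t - z)%C).
    { intros s t. apply Cder_quad with 0 1; [lra|]. intros h _. unfold w.
      rewrite RtoC_plus. replace (_ - _ - _)%C with (RtoC 0) by ring. rewrite Cmod_0; lra. }
    assert (Hes : forall t, Cder e t (Ci * e t)%C).
    { intros t. unfold e. replace (Ci * (RtoC r * cexp t))%C with (0 * cexp t + RtoC r * (Ci * cexp t))%C by ring.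
      apply (Cder_mult (fun _ => RtoC r)); [apply Cder_const|apply Cder_cexp]. }
    assert (Hwt : forall s t, Cder (w s) t (RtoC s * (Ci * e t))%C).
    { intros s t. unfold w.
      replace (RtoC s * (Ci * e t))%C with (0 + (0 * (e t - z) + RtoC s * (Ci * e t + 0)))%C by ring.
      apply (Cder_plus (fun _ => z)); [apply Cder_const|].
      apply (Cder_mult (fun _ => RtoC s) (fun u => e u - z)%C); [apply Cder_const|].
      apply (Cder_plus e (fun _ => - z)%C); [apply Hes|apply Cder_const]. }
    transitivity (cint (fun t => f (w 1 t) * k t)%C).
    { apply cint_ext. intros t. unfold g, w. f_equal. f_equal. unfold e. ring. }
    rewrite (cint_param_const (fun s t => f (w s t) * k t)%C
      (fun s t => partial_x f (w s t) * e t)%C eta Heta).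
    - rewrite (cint_ext _ (fun t => f z * (1 * k t))%C).
      + rewrite cint_scal, Hk1; [ring|]. apply (ccont_mult (fun _ => 1%C)); [apply ccont_const|easy].
      + intros t. unfold w. replace (z + 0 * (e t - z))%C with z by ring. ring.
    - intros s t Hs. assert (P := Cder_path f (fun u => w u t) s _ Hf Hdb (Hw s t Hs) (Hws s t)).
      assert (P' := Cder_mult _ _ _ _ _ P (Cder_const (k t) s)). simpl in P'.
      replace (partial_x f (w s t) * e t)%C with
        (partial_x f (w s t) * (e t - z) * k t + f (w s t) * 0)%C; [exact P'|].
      rewrite <- (Hke t) at 2. ring.
    - intros s t Hs.
      assert (C1 : continuity_2d_pt (fun u v => Re (w u v)) s t /\ continuity_2d_pt (fun u v => Im (w u v)) s t).
      { assert (Hez : ccont (fun v => e v - z)%C) by (apply (ccont_plus e (fun _ => - z)%C); [easy|apply ccont_const]).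
        destruct (ccont_continuity_2d _ s t Hez) as [E1 E2].
        destruct (continuity_2d_Cmult (fun u _ => RtoC u) (fun _ v => e v - z)%C s t) as [F1 F2].
        - exact (continuity_2d_pt_id1 s t).
        - exact (continuity_2d_pt_const s t 0).
        - exact E1.
        - exact E2.
        - split; [apply (continuity_2d_pt_plus (fun _ _ => Re z))|apply (continuity_2d_pt_plus (fun _ _ => Im z))];
            auto using continuity_2d_pt_const. }
      destruct C1 as [C1 C2].
      destruct (continuity_2d_comp (partial_x f) w s t (Hcx _ (Hw s t Hs)) C1 C2) as [D1 D2].
      destruct (ccont_continuity_2d e s t Hrc) as [E1 E2].
      now apply (continuity_2d_Cmult (fun u v => partial_x f (w u v)) (fun _ v => e v)).
    - intros s Hs. apply ccont_mult; [|easy]. apply (ccont_comp f); [|apply Hwc].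
      intros t. apply Hc. now apply Hw.
    - intros s Hs Hs0.
      assert (HD : ccont (fun t => partial_x f (w s t) * e t)%C).
      { apply ccont_mult; [|easy]. apply (ccont_comp (partial_x f)); [|apply Hwc].
        intros t. apply Hcx. now apply Hw. }
      assert (Hsi : Ci <> 0%C /\ RtoC s <> 0%C).
      { split.
        - intros H. apply (f_equal snd) in H. simpl in H. lra.
        - intros H. apply RtoC_inj in H. easy. }
      rewrite (cint_ext _ (fun t => / (RtoC s * Ci) * ((RtoC s * Ci) * (partial_x f (w s t) * e t)))%C)
        by (intros; field; split; apply Hsi).
      rewrite cint_scal by (apply (ccont_mult (fun _ => RtoC s * Ci)%C); [apply ccont_const|easy]).
      rewrite (cint_derive (fun t => f (w s t))); [ring| | |].
      + intros t. assert (P := Cder_path f (w s) t _ Hf Hdb (Hw s t Hs) (Hwt s t)).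
        replace (RtoC s * Ci * (partial_x f (w s t) * e t))%C with
          (partial_x f (w s t) * (RtoC s * (Ci * e t)))%C by ring. exact P.
      + now apply (ccont_mult (fun _ => RtoC s * Ci)%C); [apply ccont_const|].
      + unfold w, e. now rewrite cexp_2PI. }
  apply (Clim_unique (fun n => csum n (fun j => b j * z ^ j)%C)).
  - intros eps He.
    destruct (cauchy_kernel g M r z Hg HM ltac:(lra) Hz (eps * (2 * PI)) ltac:(apply Rmult_lt_0_compat; lra)) as [n0 Hn0].
    exists n0. intros n Hn. specialize (Hn0 n Hn).
    change (cint (fun t => g t * / (1 - z / r * Cconj (cexp t)))%C) with (cint (fun t => g t * k t)%C) in Hn0.
    rewrite Hkey in Hn0.
    set (S := csum n _) in Hn0.
    replace (csum n (fun j => b j * z ^ j) - f z)%C with (/ RtoC (2 * PI) * (S - RtoC (2 * PI) * f z))%C.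
    + rewrite Cmod_mult, Cmod_inv, Cmod_R, Rabs_pos_eq by (easy || lra).
      apply Rmult_lt_reg_l with (2 * PI); [lra|].
      rewrite <- Rmult_assoc, Rinv_r, Rmult_1_l by lra. lra.
    + unfold S. rewrite (csum_ext n (fun j => b j * z ^ j)%C (fun j => / RtoC (2 * PI) *
        (cint (fun t => g t * Cconj (cexp t) ^ j) * (/ RtoC r) ^ j * z ^ j))%C) by (intros; unfold b; ring).
      rewrite csum_scal. field. easy.
  - apply CSer_lim. now apply (Conv_asum r).
Qed.

(** A function of class [C^1] killed by [dbar] on the unit disk is the sum of a
    power series. *)
Lemma holomorphic_expansion f : class_C 1 unit_disk f ->
  (forall z, unit_disk z -> dbar f z = 0%C) ->
  exists a : nat -> C, Conv 1 a /\ eq_on 1 f (cps a).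
Proof.
  intros Hf Hdb.
  destruct (cauchy_expansion f (1 / 2) Hf Hdb ltac:(lra)) as [a [K [HK Ha]]].
  assert (HC : forall r b L, 0 < r -> (forall j, Cmod (b j) * r ^ j <= L) -> Conv r b).
  { intros r b L Hr Hb r' Hr'. exists L. intros j. eapply Rle_trans; [|apply (Hb j)].
    apply Rmult_le_compat_l; [apply Cmod_ge_0|apply pow_incr; lra]. }
  (* by uniqueness, the coefficients found for [r = 1 / 2] serve for all [r] *)
  assert (Hu : forall r, 1 / 2 <= r < 1 -> exists L, (forall j, Cmod (a j) * r ^ j <= L) /\
    forall z, Cmod z < r -> f z = cps a z).
  { intros r Hr. destruct (cauchy_expansion f r Hf Hdb ltac:(lra)) as [b [L [HL Hb]]].
    assert (E : a = b).
    { apply functional_extensionality. apply (cps_unique (1 / 2)); [lra| | |].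
      - apply (HC (1 / 2) a K); [lra|exact HK].
      - apply (Conv_le r); [lra|]. apply (HC r b L); [lra|exact HL].
      - intros z Hz. transitivity (f z); [symmetry; apply Ha; lra|apply Hb; lra]. }
    subst b. exists L. now split. }
  exists a. split.
  - intros r Hr. destruct (Hu (Rmax (1 / 2) r)) as [L [HL _]].
    { split; [apply Rmax_l|apply Rmax_lub_lt; lra]. }
    exists L. intros j. eapply Rle_trans; [|apply (HL j)].
    apply Rmult_le_compat_l; [apply Cmod_ge_0|]. apply pow_incr. split; [lra|apply Rmax_r].
  - intros z Hz. assert (H0 := Cmod_ge_0 z). destruct (Hu ((1 + Cmod z) / 2) ltac:(lra)) as [L [_ H]].
    apply H. lra.
Qed.

Lemma class_C_iter_dbar n m : forall f, class_C (n + m) unit_disk f ->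
  class_C m unit_disk (Nat.iter n dbar f).
Proof.
  induction n as [|n IH]; intros f Hf; [easy|].
  rewrite Nat.iter_succ_r. apply IH. now apply (class_C_dbar 1).
Qed.

(** The highest component of a function [f] of order [N + 1] is
    [dbar ^ N f / N!]; removing it lowers the order. *)
Lemma polyanalytic_expansion N : forall f, polyanalytic N unit_disk f ->
  exists c, array N 1 c /\ eq_on 1 f (pser N c).
Proof.
  induction N as [|N IH]; intros f [Hf Hdb].
  - exists (fun _ _ => 0%C). split.
    + split; [|easy]. intros p. now apply (Conv_finite 1 _ 0).
    + intros z Hz. apply (Hdb z Hz).
  - assert (Hh : class_C 1 unit_disk (Nat.iter N dbar f)).
    { apply class_C_iter_dbar. now rewrite Nat.add_1_r. }
    destruct (holomorphic_expansion _ Hh Hdb) as [a [Ha Hfa]].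
    set (c0 := fun p j => if Nat.eq_dec p N then (RtoC (/ INR (fact N)) * a j)%C else 0%C).
    assert (Hc0 : array (S N) 1 c0).
    { split.
      - intros p. unfold c0. destruct (Nat.eq_dec p N); [now apply Conv_scal|now apply (Conv_finite 1 _ 0)].
      - intros p j Hp. unfold c0. destruct (Nat.eq_dec p N); [lia|easy]. }
    assert (Hg : eq_on 1 (Nat.iter N dbar (pser (S N) c0)) (cps a)).
    { intros z Hz. rewrite (pser_iter_dbar (S N) 1 c0 N Hc0 z Hz). unfold pser.
      rewrite (csum_single _ _ 0); [|lia|].
      - simpl (_ ^ 0)%C. rewrite Cmult_1_r. f_equal. apply functional_extensionality. intros j.
        rewrite iter_dzb_coef. unfold c0. simpl (0 + N)%nat. destruct (Nat.eq_dec N N); [|easy].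
        rewrite Cmult_assoc, <- RtoC_mult.
        replace (INR (fact N) / INR (fact 0) * / INR (fact N)) with 1.
        + ring.
        + simpl. field. apply INR_fact_neq_0.
      - intros p _ Hp. rewrite cps_0; [ring|]. intros j. rewrite iter_dzb_coef. unfold c0.
        destruct (Nat.eq_dec (p + N) N); [lia|ring]. }
    assert (HfN : class_C N unit_disk f) by now apply class_C_pred.
    assert (HgN : class_C N unit_disk (pser (S N) c0)) by now apply pser_class_C.
    destruct (IH (fun z => 1 * f z + - (1) * pser (S N) c0 z)%C) as [c1 [Hc1 H1]].
    { split; [now apply (class_C_lin 1)|]. intros z Hz.
      rewrite (iter_dbar_lin 1 N 1 (- (1))%C f (pser (S N) c0) HfN HgN z Hz).
      rewrite (Hfa z Hz), (Hg z Hz). ring. }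
    assert (Hc1' : array (S N) 1 c1).
    { destruct Hc1 as [A B]. split; [easy|]. intros p j Hp. apply B; lia. }
    exists (alin 1 1 c1 c0). split; [now apply array_alin|].
    intros z Hz. rewrite (pser_lin (S N) 1); auto.
    assert (E : pser (S N) c1 z = pser N c1 z).
    { unfold pser. simpl. rewrite (cps_0 (c1 N)); [ring|]. intros j. now apply Hc1. }
    rewrite E, <- (H1 z Hz). ring.
Qed.

(** * Coefficients with stretched exponential decay *)

(** The weight [exp (- a * (j + 1) ^ (1 / s))]; the shift by [1] keeps the base
    of the power positive. *)
Definition wt (s a : R) (j : nat) : R := exp (- a * Rpower (INR (S j)) (/ s)).

Lemma exp_le x y : x <= y -> exp x <= exp y.
Proof. intros [H| ->]; [left; now apply exp_increasing|apply Rle_refl]. Qed.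

Lemma wt_pos s a j : 0 < wt s a j.
Proof. apply exp_pos. Qed.

Lemma wt_le_1 s a j : 0 <= a -> wt s a j <= 1.
Proof.
  intros Ha. unfold wt. rewrite <- exp_0. apply exp_le.
  assert (0 < Rpower (INR (S j)) (/ s)) by apply exp_pos. nra.
Qed.

(** Half of the exponent is kept for summation over [j], the other half is
    available for other estimates. *)
Lemma wt_half s a j : wt s a j = wt s (a / 2) j * exp (- (a / 2) * Rpower (INR (S j)) (/ s)).
Proof. unfold wt. rewrite <- exp_plus. f_equal. field. Qed.

Lemma ln_le_minus_1 x : 0 < x -> ln x <= x - 1.
Proof.
  intros Hx. assert (H := exp_ineq1_le (ln x)). rewrite exp_ln in H by easy. lra.
Qed.

Lemma Rpower_pos x y : 0 < Rpower x y.
Proof. apply exp_pos. Qed.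

(** The maximum of [t ^ m * exp (- c * t ^ (1 / s))] grows like [m ^ (s * m)]. *)
Lemma pow_exp_bound s c t m : 0 < s -> 0 < c -> 0 < t ->
  t ^ m * exp (- c * Rpower t (/ s)) <= Rpower (s / c) s ^ m * Rpower (INR m) (s * INR m).
Proof.
  intros Hs Hc Ht. destruct m as [|m].
  - simpl. unfold Rpower at 2. rewrite Rmult_0_r, Rmult_0_l, exp_0, Rmult_1_l, Rmult_1_r.
    rewrite <- exp_0. apply exp_le. assert (H := Rpower_pos t (/ s)). nra.
  - set (n := INR (S m)). assert (Hn : 0 < n) by (apply lt_0_INR; lia).
    assert (Hsc : 0 < s / c) by now apply Rdiv_lt_0_compat.
    rewrite <- (Rpower_pow (S m) t) by easy.
    rewrite <- (Rpower_pow (S m) (Rpower (s / c) s)) by apply Rpower_pos.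
    fold n. rewrite Rpower_mult. unfold Rpower at 1 3 4. rewrite <- !exp_plus. apply exp_le.
    set (y := Rpower t (/ s)). assert (Hy : 0 < y) by apply Rpower_pos.
    assert (Elt : ln t = s * ln y) by (unfold y, Rpower; rewrite ln_exp; field; lra).
    assert (H : ln (y * (/ n * / (s / c))) <= y * (/ n * / (s / c)) - 1).
    { apply ln_le_minus_1. apply Rmult_lt_0_compat; [easy|].
      apply Rmult_lt_0_compat; now apply Rinv_0_lt_compat. }
    assert (0 < / n) by now apply Rinv_0_lt_compat.
    assert (0 < / (s / c)) by now apply Rinv_0_lt_compat.
    rewrite ln_mult, ln_mult, !ln_Rinv in H by (easy || now apply Rmult_lt_0_compat).
    rewrite Elt. apply (Rmult_le_compat_l (n * s)) in H; [|now apply Rlt_le, Rmult_lt_0_compat].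
    replace (n * s * (y * (/ n * / (s / c)) - 1)) with (c * y - n * s) in H by (field; lra).
    assert (0 < n * s) by now apply Rmult_lt_0_compat. nra.
Qed.

Lemma ex_series_inv_square : ex_series (fun j => / (INR (S j)) ^ 2).
Proof.
  assert (H : ex_series (fun j => / INR (S j) - / INR (S (S j)))).
  { exists 1. change (is_lim_seq (sum_n (fun j => / INR (S j) - / INR (S (S j)))) 1).
    apply (is_lim_seq_ext (fun n => 1 - / INR (S (S n)))).
    - induction n as [|n IH]; [rewrite sum_O; simpl; lra|].
      rewrite sum_Sn, <- IH. unfold plus; cbn -[INR]. lra.
    - replace (Finite 1) with (Rbar_minus 1 0) by (simpl; f_equal; ring).
      apply is_lim_seq_minus'; [apply is_lim_seq_const|].
      apply (is_lim_seq_incr_1 (fun n => / INR (S n))), (is_lim_seq_incr_1 (fun n => / INR n)).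
      exact (is_lim_seq_inv (fun n => INR n) p_infty is_lim_seq_INR ltac:(easy)). }
  apply ex_series_incr_1. apply ex_series_Rle with (2 := H). intros n.
  assert (Hn : 0 < INR (S n)) by (apply lt_0_INR; lia).
  assert (Hn2 : INR (S (S n)) = INR (S n) + 1) by apply S_INR.
  set (x := INR (S n)) in *. rewrite Hn2. split.
  - left. apply Rinv_0_lt_compat, pow_lt. lra.
  - replace (/ x - / (x + 1)) with (/ (x * (x + 1))) by (field; lra).
    apply Rinv_le_contravar; [apply Rmult_lt_0_compat; lra|nra].
Qed.

Lemma wt_summable s a : 0 < s -> 0 < a -> ex_series (wt s a).
Proof.
  intros Hs Ha.
  set (K := Rpower (s / a) s ^ 2 * Rpower (INR 2) (s * INR 2)).
  apply ex_series_Rle with (fun j => K * / (INR (S j)) ^ 2).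
  - intros n. split; [left; apply wt_pos|].
    assert (Hn : 0 < INR (S n)) by (apply lt_0_INR; lia).
    assert (H := pow_exp_bound s a (INR (S n)) 2 Hs Ha Hn). fold K in H.
    apply Rmult_le_reg_l with (INR (S n) ^ 2); [now apply pow_lt|].
    unfold wt. rewrite (Rmult_comm K), <- Rmult_assoc, Rinv_r, Rmult_1_l; [easy|].
    apply pow_nonzero; lra.
  - apply ex_series_Rscal, ex_series_inv_square.
Qed.

Lemma Series_wt_pos s a : 0 < s -> 0 < a -> 0 <= Series (wt s a).
Proof.
  intros Hs Ha. rewrite <- (Rmult_0_l (Series (wt s a))), <- Series_scal_l.
  apply Series_le; [|now apply wt_summable]. intros n. assert (H := wt_pos s a n). lra.
Qed.

(** The radius [2] covers both the unit disk and the disks of radius at most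
    [2] that contain it. *)
Lemma pser_wt_bound N s a c z K : 0 < s -> 0 < a -> 0 <= K -> Cmod z <= 2 ->
  (forall p j, (p < N)%nat -> Cmod (c p j) * Cmod z ^ j <= K * wt s a j) ->
  Cmod (pser N c z) <= INR N * 2 ^ N * Series (wt s a) * K.
Proof.
  intros Hs Ha HK Hz H. unfold pser.
  assert (HS := Series_wt_pos s a Hs Ha).
  eapply Rle_trans; [apply (csum_bound _ _ (K * Series (wt s a) * 2 ^ N))|right; ring].
  intros p Hp. rewrite Cmod_mult, Cmod_pow, Cmod_conj.
  apply Rmult_le_compat; [apply Cmod_ge_0|apply pow_le, Cmod_ge_0| |].
  - rewrite <- Series_scal_l. unfold cps. apply CSer_bound_le.
    + intros j. rewrite Cmod_mult, Cmod_pow. now apply H.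
    + now apply ex_series_Rscal, wt_summable.
  - apply Rle_trans with (2 ^ p).
    + apply pow_incr. split; [apply Cmod_ge_0|easy].
    + apply Rle_pow; [lra|lia].
Qed.

Lemma array_wt N s a c K : 0 < a -> 0 <= K ->
  (forall p j, (p < N)%nat -> Cmod (c p j) <= K * wt s a j) ->
  (forall p j, (N <= p)%nat -> c p j = 0%C) -> array N 1 c.
Proof.
  intros Ha HK H H0. split; [|easy]. intros p r Hr. exists K. intros j.
  assert (Hrj : 0 <= r ^ j <= 1).
  { split; [apply pow_le; lra|]. rewrite <- (pow1 j). apply pow_incr; lra. }
  assert (Hw := wt_le_1 s a j ltac:(lra)). assert (Hw0 := wt_pos s a j).
  assert (Cmod (c p j) <= K).
  { destruct (Nat.lt_ge_cases p N) as [Hp|Hp].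
    - specialize (H p j Hp). nra.
    - rewrite H0, Cmod_0; easy. }
  assert (Hc0 := Cmod_ge_0 (c p j)). nra.
Qed.

(** If [c p j] is dominated by [w (p + j)], a derivative of order [m] is
    dominated by [(i + m + 1) ^ m * w (i + m)] with [i = p + j]. *)
Lemma array_der_majorant (w : nat -> R) c (l : list bool) :
  (forall p j, Cmod (c p j) <= w (p + j)%nat) ->
  forall p j, Cmod (fold_right (fun b d => if b : bool then ax d else ay d) c l p j) <=
    INR (p + j + length l + 1) ^ length l * w (p + j + length l)%nat.
Proof.
  intros H. induction l as [|b l IH]; intros p j.
  - simpl. rewrite Nat.add_0_r, Rmult_1_l. apply H.
  - cbn [fold_right length].
    set (d := fold_right _ c l) in *. set (m := length l) in *.
    set (i := (p + j)%nat) in *.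
    set (X := INR (i + S m + 1) ^ m * w (i + S m)%nat).
    assert (A1 : Cmod (d p (S j)) <= X).
    { eapply Rle_trans; [apply IH|]. unfold X. right.
      replace (p + S j + m)%nat with (i + S m)%nat by (unfold i; lia). easy. }
    assert (A2 : Cmod (d (S p) j) <= X).
    { eapply Rle_trans; [apply IH|]. unfold X. right.
      replace (S p + j + m)%nat with (i + S m)%nat by (unfold i; lia). easy. }
    assert (HX : 0 <= X) by (eapply Rle_trans; [apply Cmod_ge_0|exact A1]).
    assert (B : Cmod ((if b then ax d else ay d) p j) <= INR (S j) * X + INR (S p) * X).
    { assert (P : forall u v : C, Cmod u = 1 -> Cmod v = 1 ->
        Cmod (u * (RtoC (INR (S j)) * d p (S j)) + v * (RtoC (INR (S p)) * d (S p) j))%C <=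
        INR (S j) * X + INR (S p) * X).
      { intros u v Hu Hv. eapply Rle_trans; [apply Cmod_triangle|].
        rewrite !Cmod_mult, Hu, Hv, !Cmod_R, !Rabs_pos_eq, !Rmult_1_l by apply pos_INR.
        apply Rplus_le_compat; (apply Rmult_le_compat_l; [apply pos_INR|easy]). }
      destruct b; apply P.
      - apply Cmod_1.
      - apply Cmod_1.
      - apply Cmod_Ci.
      - rewrite Cmod_opp; apply Cmod_Ci. }
    eapply Rle_trans; [exact B|]. rewrite <- Rmult_plus_distr_r, <- plus_INR.
    simpl (_ ^ S m). rewrite Rmult_assoc. fold X.
    apply Rmult_le_compat_r; [easy|]. apply le_INR. unfold i. lia.
Qed.

(** A mixed derivative as a word in the two letters [ax] ([true]) and [ay]
    ([false]). *)
Lemma alpha_word a1 a2 c : exists l : list bool, length l = (a1 + a2)%nat /\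
  Nat.iter a1 ax (Nat.iter a2 ay c) =
  fold_right (fun b d => if b : bool then ax d else ay d) c l.
Proof.
  induction a1 as [|a1 [l [Hl IH]]].
  - induction a2 as [|a2 [l [Hl IH]]].
    + exists nil. now split.
    + exists (cons false l). simpl in *. split; [now rewrite Hl|now rewrite <- IH].
  - exists (cons true l). simpl. split; [now rewrite Hl|now rewrite <- IH].
Qed.

(** Decay of the coefficients implies Gevrey estimates. *)
Lemma gevrey_of_decay N s a c K : (1 <= N)%nat -> 0 < s -> 0 < a -> 0 <= K ->
  (forall p j, (p < N)%nat -> Cmod (c p j) <= K * wt s a j) ->
  (forall p j, (N <= p)%nat -> c p j = 0%C) ->
  exists B, 0 < B /\ forall a1 a2 z, Cmod z < 1 ->
    Cmod (pser N (Nat.iter a1 ax (Nat.iter a2 ay c)) z) <=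
    B ^ (a1 + a2 + 1) * Rpower (INR (a1 + a2)) (s * INR (a1 + a2)).
Proof.
  intros HN Hs Ha HK Hc Hc0.
  assert (HN0 : 0 < INR N) by (apply lt_0_INR; lia).
  (* [p + j + 1 <= N * (j + 1)] turns a weight in [j] into a weight in [p + j] *)
  set (a' := a * Rpower (INR N) (- / s)).
  assert (Ha' : 0 < a') by (apply Rmult_lt_0_compat; [easy|apply Rpower_pos]).
  set (w := fun i => K * wt s a' i).
  assert (Hw : forall p j, Cmod (c p j) <= w (p + j)%nat).
  { intros p j. unfold w. destruct (Nat.lt_ge_cases p N) as [Hp|Hp].
    2:{ rewrite Hc0, Cmod_0 by easy. apply Rmult_le_pos; [easy|left; apply wt_pos]. }
    eapply Rle_trans; [now apply Hc|]. apply Rmult_le_compat_l; [easy|].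
    unfold wt. apply exp_le.
    assert (HR : Rpower (INR (S (p + j))) (/ s) <= Rpower (INR N) (/ s) * Rpower (INR (S j)) (/ s)).
    { assert (0 < INR (S j)) by (apply lt_0_INR; lia).
      rewrite Rpower_mult_distr by easy. apply Rle_Rpower_l.
      - left; now apply Rinv_0_lt_compat.
      - split; [apply lt_0_INR; lia|]. rewrite <- mult_INR. apply le_INR. nia. }
    assert (E : Rpower (INR N) (- / s) * Rpower (INR N) (/ s) = 1).
    { rewrite <- Rpower_plus. rewrite Rplus_opp_l. apply Rpower_O; easy. }
    assert (H1 := Rpower_pos (INR N) (- / s)).
    assert (H2 : Rpower (INR N) (- / s) * Rpower (INR (S (p + j))) (/ s) <= Rpower (INR (S j)) (/ s)).
    { eapply Rle_trans; [apply Rmult_le_compat_l; [left; exact H1|exact HR]|].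
      rewrite <- Rmult_assoc, E. lra. }
    unfold a'. nra. }
  set (A := Rpower (s / (a' / 2)) s). assert (HA : 0 < A) by apply Rpower_pos.
  set (S1 := Series (wt s (a' / 2))).
  assert (HS1 : 0 <= S1) by (apply Series_wt_pos; lra).
  assert (H2N : 0 < 2 ^ N) by (apply pow_lt; lra).
  set (D := INR N * 2 ^ N * S1 * K).
  assert (HD : 0 <= D) by (unfold D; repeat apply Rmult_le_pos; lra).
  exists (1 + D + A). split; [lra|]. intros a1 a2 z Hz.
  destruct (alpha_word a1 a2 c) as [l [Hl E]]. rewrite E. clear E.
  set (m := (a1 + a2)%nat) in *.
  set (G := A ^ m * Rpower (INR m) (s * INR m)).
  assert (HG : 0 < G) by (apply Rmult_lt_0_compat; [now apply pow_lt|apply Rpower_pos]).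
  assert (HT : Cmod (pser N (fold_right (fun b d => if b : bool then ax d else ay d) c l) z) <= D * G).
  { unfold D. rewrite (Rmult_assoc _ K G). apply pser_wt_bound; try lra.
    - apply Rmult_le_pos; lra.
    - intros p j _. set (T := INR (p + j + m + 1)).
      assert (HT0 : INR (S j) <= T) by (apply le_INR; lia).
      assert (HTp : 0 < INR (S j)) by (apply lt_0_INR; lia).
      assert (M := array_der_majorant w c l Hw p j). rewrite Hl in M. fold m T in M.
      assert (Hzj : 0 <= Cmod z ^ j <= 1).
      { split; [apply pow_le, Cmod_ge_0|]. rewrite <- (pow1 j). apply pow_incr.
        split; [apply Cmod_ge_0|lra]. }
      set (u := Cmod (fold_right _ c l p j)) in *.
      assert (Hu : 0 <= u) by apply Cmod_ge_0.
      apply Rle_trans with u; [nra|]. eapply Rle_trans; [exact M|].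
      unfold w. rewrite wt_half.
      replace (INR (S (p + j + m))) with T by (unfold T; f_equal; lia).
      assert (P := pow_exp_bound s (a' / 2) T m Hs ltac:(lra) ltac:(lra)). fold A in P. fold G in P.
      assert (Q : wt s (a' / 2) (p + j + m) <= wt s (a' / 2) j).
      { unfold wt. apply exp_le.
        assert (Rpower (INR (S j)) (/ s) <= Rpower (INR (S (p + j + m))) (/ s)).
        { apply Rle_Rpower_l; [left; now apply Rinv_0_lt_compat|]. split; [easy|]. apply le_INR; lia. }
        nra. }
      assert (Hw0 := wt_pos s (a' / 2) (p + j + m)).
      set (X := T ^ m) in *. set (Y := exp _) in *.
      assert (HXY : 0 <= X * Y) by (apply Rmult_le_pos; [apply pow_le; lra|left; apply exp_pos]).
      replace (X * (K * (wt s (a' / 2) (p + j + m) * Y))) with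
        (K * (X * Y * wt s (a' / 2) (p + j + m))) by ring.
      rewrite (Rmult_assoc K G). apply Rmult_le_compat_l; [easy|].
      apply Rmult_le_compat; lra. }
  eapply Rle_trans; [exact HT|]. unfold G. rewrite <- Rmult_assoc.
  apply Rmult_le_compat_r; [left; apply Rpower_pos|].
  rewrite Nat.add_1_r. simpl. apply Rmult_le_compat; try lra.
  - apply pow_le; lra.
  - apply pow_incr; lra.
Qed.

(** * From derivative bounds to coefficient decay *)

Lemma ax_ay_comm c : ax (ay c) = ay (ax c).
Proof.
  apply functional_extensionality; intros p. apply functional_extensionality; intros j.
  unfold ax, ay, alin, dz, dzb, da. ring.
Qed.

Lemma ax_alin a b c d : ax (alin a b c d) = alin a b (ax c) (ax d).
Proof.
  apply functional_extensionality; intros p. apply functional_extensionality; intros j.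
  unfold ax, alin, dz, dzb, da. ring.
Qed.

Lemma ay_alin a b c d : ay (alin a b c d) = alin a b (ay c) (ay d).
Proof.
  apply functional_extensionality; intros p. apply functional_extensionality; intros j.
  unfold ay, alin, dz, dzb, da. ring.
Qed.

Lemma iter_alin op n a b c d :
  (forall a b c d, op (alin a b c d) = alin a b (op c) (op d)) ->
  Nat.iter n op (alin a b c d) = alin a b (Nat.iter n op c) (Nat.iter n op d).
Proof. intros H. induction n as [|n IH]; simpl; [easy|]. now rewrite IH, H. Qed.

Lemma iter_ay_ax n c : Nat.iter n ay (ax c) = ax (Nat.iter n ay c).
Proof. induction n as [|n IH]; simpl; [easy|]. now rewrite IH, ax_ay_comm. Qed.

Lemma Ci_Ci : (Ci * Ci)%C = (- (1))%C.
Proof. apply injective_projections; simpl; ring. Qed.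

Lemma dz_alin c : dz c = alin (/ 2) (- (/ 2 * Ci)) (ax c) (ay c).
Proof.
  apply functional_extensionality; intros p. apply functional_extensionality; intros j.
  unfold ax, ay, alin. set (u := dz c p j). set (v := dzb c p j).
  transitivity (/ 2 * (u + v - (Ci * Ci) * u + (Ci * Ci) * v))%C; [|ring].
  rewrite Ci_Ci. field.
Qed.

Lemma dzb_alin c : dzb c = alin (/ 2) (/ 2 * Ci) (ax c) (ay c).
Proof.
  apply functional_extensionality; intros p. apply functional_extensionality; intros j.
  unfold ax, ay, alin. set (u := dz c p j). set (v := dzb c p j).
  transitivity (/ 2 * (u + v + (Ci * Ci) * u - (Ci * Ci) * v))%C; [|ring].
  rewrite Ci_Ci. field.
Qed.

(** All the partial derivatives of order [n] of [pser N c] are bounded by [W]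
    on the unit disk. *)
Definition der_bound (N : nat) (c : nat -> nat -> C) (n : nat) (W : R) : Prop :=
  forall a1 a2 z, (a1 + a2 = n)%nat -> Cmod z < 1 ->
    Cmod (pser N (Nat.iter a1 ax (Nat.iter a2 ay c)) z) <= W.

(** Both [dz] and [dzb] have this form, by [dz_alin] and [dzb_alin]. *)
Lemma der_bound_half N c n W u v : array N 1 c -> Cmod u = / 2 -> Cmod v = / 2 ->
  der_bound N c (S n) W -> der_bound N (alin u v (ax c) (ay c)) n W.
Proof.
  intros Hc Hu Hv H a1 a2 z Hn Hz.
  rewrite (iter_alin ay) by apply ay_alin. rewrite (iter_alin ax) by apply ax_alin.
  rewrite iter_ay_ax, <- !Nat.iter_succ_r.
  rewrite (pser_lin N 1); auto.
  - eapply Rle_trans; [apply Cmod_triangle|]. rewrite !Cmod_mult, Hu, Hv.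
    assert (H1 := H (S a1) a2 z ltac:(lia) Hz). assert (H2 := H a1 (S a2) z ltac:(lia) Hz). lra.
  - apply array_iter; [intros; now apply array_ax|]. apply array_iter; auto. intros; now apply array_ay.
  - apply array_iter; [intros; now apply array_ax|]. apply array_iter; auto. intros; now apply array_ay.
Qed.

Lemma Cmod_half : Cmod (/ 2) = / 2.
Proof.
  rewrite Cmod_inv, Cmod_R, Rabs_pos_eq; [easy|lra|]. intros H. apply RtoC_inj in H. lra.
Qed.

Lemma der_bound_dz N c n W : array N 1 c -> der_bound N c (S n) W -> der_bound N (dz c) n W.
Proof.
  intros Hc H. rewrite dz_alin. apply der_bound_half; auto; [apply Cmod_half|].
  now rewrite Cmod_opp, Cmod_mult, Cmod_half, Cmod_Ci, Rmult_1_r.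
Qed.

Lemma der_bound_dzb N c n W : array N 1 c -> der_bound N c (S n) W -> der_bound N (dzb c) n W.
Proof.
  intros Hc H. rewrite dzb_alin. apply der_bound_half; auto; [apply Cmod_half|].
  now rewrite Cmod_mult, Cmod_half, Cmod_Ci, Rmult_1_r.
Qed.

Lemma der_bound_iter N op m : 
  (forall c, array N 1 c -> array N 1 (op c)) ->
  (forall c n W, array N 1 c -> der_bound N c (S n) W -> der_bound N (op c) n W) ->
  forall c n W, array N 1 c -> der_bound N c (m + n) W -> der_bound N (Nat.iter m op c) n W.
Proof.
  intros H1 H2. induction m as [|m IH]; intros c n W Hc H; [easy|].
  rewrite Nat.iter_succ_r. apply IH; auto.
Qed.

Lemma iter_dz_coef m c p i :
  Nat.iter m dz c p i = (RtoC (INR (fact (i + m)) / INR (fact i)) * c p (i + m)%nat)%C.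
Proof.
  revert i. induction m as [|n IH]; intros i; simpl.
  - rewrite Nat.add_0_r. unfold Rdiv. rewrite Rinv_r by apply INR_fact_neq_0. ring.
  - unfold dz at 1, da. rewrite IH.
    replace (S i + n)%nat with (i + S n)%nat by lia.
    rewrite Cmult_assoc, <- RtoC_mult. f_equal. f_equal.
    rewrite (fact_simpl i), mult_INR. field.
    split; [apply INR_fact_neq_0|apply not_0_INR; lia].
Qed.

Lemma fact_pos n : 0 < INR (fact n).
Proof. apply lt_0_INR, lt_O_fact. Qed.

(** The bound on the Fourier coefficients of [dbar ^ p] of the [m]-th complex
    derivative controls [c p], once the [c p'] with [p' > p] are controlled;
    whence a descending induction on [p]. *)
Lemma coef_of_der_bound N c (V : nat -> R) : array N 1 c ->
  (forall n, 0 <= V n) -> (forall n n', (n <= n')%nat -> V n <= V n') ->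
  (forall n, der_bound N c n (V n)) ->
  exists K, 0 <= K /\ forall p m l,
    Cmod (c p (l + m)%nat) * (INR (fact (l + m)) / INR (fact l)) <= K * V (m + N)%nat.
Proof.
  intros Hc HV0 HVm HV.
  assert (Hr : forall l m, 0 < INR (fact (l + m)) / INR (fact l)).
  { intros. apply Rdiv_lt_0_compat; apply fact_pos. }
  assert (G : forall i, exists K, 0 <= K /\ forall p, (N <= p + i)%nat -> forall m l,
    Cmod (c p (l + m)%nat) * (INR (fact (l + m)) / INR (fact l)) <= K * V (m + N)%nat).
  { induction i as [|i [K [HK IH]]].
    - exists 0. split; [lra|]. intros p Hp m l. rewrite (proj2 Hc) by lia.
      rewrite Cmod_0. lra.
    - set (F := INR (fact N)). assert (HF : 0 < F) by apply fact_pos.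
      exists (2 + INR N * (F * K) + K). assert (0 <= INR N * (F * K)).
      { apply Rmult_le_pos; [apply pos_INR|]. apply Rmult_le_pos; lra. }
      split; [lra|]. intros p Hp m l.
      set (v := V (m + N)%nat). assert (Hv : 0 <= v) by apply HV0.
      destruct (Nat.le_gt_cases N (p + i)) as [Hpi|Hpi].
      { eapply Rle_trans; [now apply IH|]. fold v. nra. }
      set (d := Nat.iter p dzb (Nat.iter m dz c)).
      assert (Hdz : array N 1 (Nat.iter m dz c)).
      { apply array_iter; auto. intros; now apply array_dz. }
      assert (Hd : array N 1 d).
      { apply array_iter; auto. intros; now apply array_dzb. }
      assert (HB : der_bound N d 0 v).
      { apply der_bound_iter; auto using array_dzb, der_bound_dzb.
        apply der_bound_iter; auto using array_dz, der_bound_dz.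
        intros a1 a2 z Ha Hz. eapply Rle_trans; [apply (HV (m + (p + 0))%nat); easy|].
        apply HVm. lia. }
      assert (HFo := pser_fourier_bound_1 N d v Hd (fun z Hz => HB O O z eq_refl Hz) (N + l)%nat).
      assert (Ed : forall p', d p' (l + p')%nat = (RtoC (INR (fact (p' + p)) / INR (fact p')) *
        (RtoC (INR (fact (l + p' + m)) / INR (fact (l + p'))) * c (p' + p)%nat (l + p' + m)%nat))%C).
      { intros p'. unfold d. now rewrite iter_dzb_coef, iter_dz_coef. }
      assert (HN : (1 <= N)%nat) by lia.
      rewrite (csum_ext N _ (fun p' => d p' (l + p')%nat)) in HFo.
      2:{ intros p' Hp'. replace (N + l)%nat with ((N - p') + (l + p'))%nat by lia. apply shiftc_add. }
      replace N with (S (pred N)) in HFo at 1 by lia.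
      rewrite csum_shift in HFo.
      set (R1 := csum _ _) in HFo.
      assert (HR1 : Cmod R1 <= INR (pred N) * (F * (K * v))).
      { apply csum_bound. intros j Hj. rewrite Ed, !Cmod_mult, !Cmod_R.
        rewrite !Rabs_pos_eq by (left; apply Rdiv_lt_0_compat; apply fact_pos).
        destruct (Nat.le_gt_cases N (S j + p)) as [Hle|Hgt].
        { rewrite (proj2 Hc) by easy. rewrite Cmod_0, !Rmult_0_r.
          repeat apply Rmult_le_pos; lra. }
        apply Rmult_le_compat.
        - left; apply Rdiv_lt_0_compat; apply fact_pos.
        - apply Rmult_le_pos; [left; apply Rdiv_lt_0_compat; apply fact_pos|apply Cmod_ge_0].
        - apply Rle_trans with (INR (fact (S j + p))).
          + assert (H1 : 1 <= INR (fact (S j))) by (apply (le_INR 1), lt_O_fact).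
            assert (H2 := fact_pos (S j + p)).
            apply Rmult_le_reg_r with (INR (fact (S j))); [lra|].
            unfold Rdiv. rewrite Rmult_assoc, Rinv_l by lra. nra.
          + apply le_INR, fact_le. lia.
        - rewrite Rmult_comm. apply IH. lia. }
      rewrite Ed in HFo. simpl (0 + p)%nat in HFo. rewrite Nat.add_0_r in HFo.
      set (X := (RtoC _ * c p (l + m)%nat)%C) in HFo.
      assert (HX : Cmod X = Cmod (c p (l + m)%nat) * (INR (fact (l + m)) / INR (fact l))).
      { unfold X. rewrite Cmod_mult, Cmod_R, Rabs_pos_eq by (left; apply Hr). ring. }
      rewrite <- HX.
      assert (Hp1 : 1 <= INR (fact p) / INR (fact 0)).
      { simpl (fact 0). simpl (INR 1). unfold Rdiv. rewrite Rinv_1, Rmult_1_r.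
        apply (le_INR 1), lt_O_fact. }
      set (Y := INR (fact p) / INR (fact 0)) in *.
      assert (HT := Cmod_triangle (RtoC Y * X + R1) (- R1)).
      replace (RtoC Y * X + R1 + - R1)%C with (RtoC Y * X)%C in HT by ring.
      rewrite Cmod_opp, Cmod_mult, Cmod_R, Rabs_pos_eq in HT by lra.
      assert (HX0 := Cmod_ge_0 X).
      assert (INR (pred N) * (F * (K * v)) <= INR N * (F * (K * v))).
      { apply Rmult_le_compat_r; [repeat apply Rmult_le_pos; lra|]. apply le_INR; lia. }
      assert (0 <= K * v) by now apply Rmult_le_pos.
      replace ((2 + INR N * (F * K) + K) * v) with (2 * v + INR N * (F * (K * v)) + K * v) by ring.
      nra. }
  destruct (G N) as [K [HK H]]. exists K. split; [easy|].
  intros p m l. apply H. lia.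
Qed.

Lemma pow_le_fact_ratio l m : INR (S l) ^ m <= INR (fact (l + m)) / INR (fact l).
Proof.
  induction m as [|m IH].
  - rewrite Nat.add_0_r. simpl. right. field. apply INR_fact_neq_0.
  - rewrite Nat.add_succ_r, fact_simpl, mult_INR, <- tech_pow_Rmult.
    unfold Rdiv. rewrite Rmult_assoc. apply Rmult_le_compat; auto.
    + apply pos_INR.
    + apply pow_le, pos_INR.
    + apply le_INR; lia.
Qed.

Lemma Rpower_self_mono s n n' : 0 < s -> (n <= n')%nat ->
  Rpower (INR n) (s * INR n) <= Rpower (INR n') (s * INR n').
Proof.
  intros Hs Hn. unfold Rpower. apply exp_le.
  assert (L : forall i, (1 <= i)%nat -> 0 <= ln (INR i)).
  { intros i Hi. rewrite <- ln_1. apply Rcomplements.ln_le; [lra|]. now apply (le_INR 1). }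
  destruct n as [|n].
  - simpl (INR 0). rewrite Rmult_0_r, Rmult_0_l. destruct n' as [|n'].
    + simpl. lra.
    + apply Rmult_le_pos; [apply Rmult_le_pos; [lra|apply pos_INR]|apply L; lia].
  - apply Rmult_le_compat.
    + apply Rmult_le_pos; [lra|apply pos_INR].
    + apply L; lia.
    + apply Rmult_le_compat_l; [lra|now apply le_INR].
    + apply Rcomplements.ln_le; [apply lt_0_INR; lia|now apply le_INR].
Qed.

(** Optimization in [m]: a good choice is of the order of
    [(j / B) ^ (1 / s)]. *)
Lemma decay_of_ratio_bound N s B K : 1 <= s -> 1 <= B -> 0 <= K ->
  exists a L, 0 < a /\ 0 <= L /\ forall u : nat -> R, (forall j, 0 <= u j) ->
    (forall m l, u (l + m)%nat * (INR (fact (l + m)) / INR (fact l)) <=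
      K * (B ^ (m + N) * Rpower (INR (m + N)) (s * INR (m + N)))) ->
    forall j, u j <= L * wt s a j.
Proof.
  intros Hs HB HK.
  set (D := 2 * B * exp 1).
  assert (He1 : 2 <= exp 1) by (assert (H := exp_ineq1_le 1); lra).
  assert (HD : 4 <= D) by (unfold D; nra).
  set (a1 := Rpower (/ D) (/ s)).
  assert (Ha1 : 0 < a1) by apply Rpower_pos.
  assert (Hs' : 0 < / s) by (apply Rinv_0_lt_compat; lra).
  set (X0 := D * Rpower (INR (S N)) s).
  set (A := Rpower (s / (a1 / 2)) s ^ N * Rpower (INR N) (s * INR N)).
  assert (HA : 0 < A) by (apply Rmult_lt_0_compat; [apply pow_lt, Rpower_pos|apply Rpower_pos]).
  set (K1 := K * (B ^ N * Rpower (INR N) (s * INR N))).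
  assert (HK1 : 0 <= K1).
  { unfold K1. apply Rmult_le_pos; [easy|]. apply Rmult_le_pos; [apply pow_le; lra|left; apply Rpower_pos]. }
  exists (a1 / 2), (K * exp 1 * A + K1 * exp (a1 / 2 * Rpower X0 (/ s))).
  assert (HX0 : 0 < X0) by (apply Rmult_lt_0_compat; [lra|apply Rpower_pos]).
  assert (HL1 : 0 <= K * exp 1 * A) by (apply Rmult_le_pos; [apply Rmult_le_pos|]; lra).
  assert (HL2 : 0 <= K1 * exp (a1 / 2 * Rpower X0 (/ s))).
  { apply Rmult_le_pos; [easy|left; apply exp_pos]. }
  split; [lra|]. split; [lra|]. intros u Hu H j.
  set (X := INR (S j)). assert (HX : 0 < X) by (apply lt_0_INR; lia).
  assert (Hw := wt_pos s (a1 / 2) j).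
  destruct (Rlt_le_dec X X0) as [Hlt|Hge].
  - (* few coefficients: the bound for [m = 0] suffices *)
    specialize (H O j). rewrite Nat.add_0_r in H. simpl (0 + N)%nat in H. fold K1 in H.
    unfold Rdiv in H. rewrite Rinv_r, Rmult_1_r in H by apply INR_fact_neq_0.
    assert (E : 1 <= exp (a1 / 2 * Rpower X0 (/ s)) * wt s (a1 / 2) j).
    { unfold wt. rewrite <- exp_plus, <- exp_0. apply exp_le. fold X.
      assert (Rpower X (/ s) <= Rpower X0 (/ s)) by (apply Rle_Rpower_l; lra). nra. }
    assert (0 <= K * exp 1 * A * wt s (a1 / 2) j) by (apply Rmult_le_pos; lra). nra.
  - set (y := Rpower (X / D) (/ s)).
    assert (HXD : 0 < X / D) by (apply Rdiv_lt_0_compat; lra).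
    assert (HXDN : Rpower (INR (S N)) s <= X / D).
    { apply Rmult_le_reg_l with D; [lra|]. fold X0. replace (D * (X / D)) with X by (field; lra). easy. }
    assert (HSN : 1 <= INR (S N)) by (apply (le_INR 1); lia).
    assert (HyN : INR (S N) <= y).
    { replace (INR (S N)) with (Rpower (Rpower (INR (S N)) s) (/ s)).
      - apply Rle_Rpower_l; [lra|]. split; [apply Rpower_pos|easy].
      - rewrite Rpower_mult, Rinv_r by lra. apply Rpower_1; lra. }
    assert (HXD1 : 1 <= X / D).
    { eapply Rle_trans; [|exact HXDN]. rewrite <- (Rpower_O (INR (S N))) at 1 by lra.
      apply Rle_Rpower; lra. }
    assert (HyX : y <= X / D).
    { rewrite <- (Rpower_1 (X / D)) by easy. apply Rle_Rpower; [easy|].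
      rewrite <- Rinv_1. apply Rinv_le_contravar; lra. }
    assert (Hy0 : 0 < y) by lra.
    (* the exponent [M = m + N] is the integer part of [y] *)
    destruct (nfloor_ex y ltac:(lra)) as [M [HM1 HM2]].
    assert (HMN : (N <= M)%nat).
    { apply Nat.lt_succ_r. apply INR_lt. rewrite S_INR in *. lra. }
    set (m := (M - N)%nat).
    assert (HXD4 : X / D <= X / 4).
    { apply Rmult_le_compat_l; [lra|]. apply Rinv_le_contravar; lra. }
    assert (HmX : INR m <= X / 4).
    { apply Rle_trans with (INR M); [apply le_INR; unfold m; lia|lra]. }
    assert (HX4 : 4 <= X).
    { assert (1 <= X / 4) by lra. lra. }
    assert (Hmj : (m <= j)%nat).
    { apply INR_le. unfold X in *. rewrite S_INR in *. lra. }
    set (l := (j - m)%nat).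
    specialize (H m l). replace (l + m)%nat with j in H by (unfold l; lia).
    replace (m + N)%nat with M in H by (unfold m; lia).
    assert (Hr : (X / 2) ^ m <= INR (fact j) / INR (fact l)).
    { eapply Rle_trans; [|replace j with (l + m)%nat by (unfold l; lia); apply pow_le_fact_ratio].
      apply pow_incr. split; [lra|]. unfold l. rewrite S_INR, minus_INR by easy.
      unfold X in *. rewrite S_INR in *. lra. }
    assert (H1 : u j * (X / 2) ^ m <= K * (B ^ M * Rpower (INR M) (s * INR M))).
    { eapply Rle_trans; [|exact H]. apply Rmult_le_compat_l; auto. }
    assert (HXm : 0 < X / 2) by lra.
    (* multiply by [(X / 2) ^ N] to reach the exponent [M] *)
    assert (H2 : u j * (X / 2) ^ M <= K * X ^ N * (B ^ M * Rpower (INR M) (s * INR M))).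
    { replace M with (m + N)%nat at 1 by (unfold m; lia). rewrite pow_add, <- Rmult_assoc.
      apply Rle_trans with (K * (B ^ M * Rpower (INR M) (s * INR M)) * (X / 2) ^ N).
      - apply Rmult_le_compat_r; [apply pow_le; lra|easy].
      - rewrite (Rmult_comm _ ((X / 2) ^ N)), (Rmult_comm K (X ^ N)), <- Rmult_assoc, (Rmult_assoc (X ^ N)).
        rewrite Rmult_assoc. apply Rmult_le_compat.
        + apply pow_le; lra.
        + apply Rmult_le_pos; [easy|]. apply Rmult_le_pos; [apply pow_le; lra|left; apply Rpower_pos].
        + apply pow_incr; lra.
        + right; ring. }
    (* [B * M ^ s <= (X / 2) / e] *)
    assert (H3 : B ^ M * Rpower (INR M) (s * INR M) <= (X / 2) ^ M * exp (- INR M)).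
    { destruct (Nat.eq_dec M 0) as [E0|E0].
      { rewrite E0. simpl. unfold Rpower. rewrite Rmult_0_r, Rmult_0_l, Ropp_0, exp_0. lra. }
      assert (HMpos : 0 < INR M) by (apply lt_0_INR; lia).
      rewrite <- Rpower_mult, Rpower_pow by apply Rpower_pos.
      replace (exp (- INR M)) with ((/ exp 1) ^ M).
      2:{ rewrite pow_inv, exp_Ropp. f_equal. rewrite <- Rpower_pow by apply exp_pos.
          unfold Rpower. rewrite ln_exp. f_equal; ring. }
      rewrite <- !Rpow_mult_distr. apply pow_incr. split.
      - apply Rmult_le_pos; [lra|left; apply Rpower_pos].
      - assert (Rpower (INR M) s <= X / D).
        { replace (X / D) with (Rpower y s).
          - apply Rle_Rpower_l; lra.
          - unfold y. rewrite Rpower_mult, Rinv_l by lra. now apply Rpower_1. }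
        apply Rle_trans with (B * (X / D)); [apply Rmult_le_compat_l; lra|].
        right. unfold D. field. split; [|lra].
        assert (0 < exp 1) by apply exp_pos; lra. }
    assert (H4 : u j <= K * X ^ N * exp (- INR M)).
    { assert (HP : 0 < (X / 2) ^ M) by now apply pow_lt.
      apply Rmult_le_reg_r with ((X / 2) ^ M); [easy|]. eapply Rle_trans; [exact H2|].
      rewrite (Rmult_assoc (K * X ^ N)). apply Rmult_le_compat_l.
      - apply Rmult_le_pos; [easy|apply pow_le; lra].
      - rewrite Rmult_comm in H3 |- *. rewrite (Rmult_comm (exp _)). lra. }
    assert (Ey : y = a1 * Rpower X (/ s)).
    { unfold y, a1. rewrite Rpower_mult_distr; [f_equal; unfold Rdiv; ring|apply Rinv_0_lt_compat; lra|easy]. }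
    assert (H5 : exp (- INR M) <= exp 1 * (exp (- (a1 / 2) * Rpower X (/ s)) * wt s (a1 / 2) j)).
    { unfold wt. fold X. rewrite <- !exp_plus. apply exp_le. lra. }
    assert (P := pow_exp_bound s (a1 / 2) X N ltac:(lra) ltac:(lra) HX). fold A in P.
    set (Y := exp (- (a1 / 2) * Rpower X (/ s))) in *.
    assert (H6 : K * X ^ N * exp (- INR M) <= K * X ^ N * (exp 1 * (Y * wt s (a1 / 2) j))).
    { apply Rmult_le_compat_l; [apply Rmult_le_pos; [easy|apply pow_le; lra]|easy]. }
    assert (H7 : K * exp 1 * wt s (a1 / 2) j * (X ^ N * Y) <= K * exp 1 * wt s (a1 / 2) j * A).
    { apply Rmult_le_compat_l; [|easy]. apply Rmult_le_pos; [apply Rmult_le_pos|]; lra. }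
    assert (0 <= K1 * exp (a1 / 2 * Rpower X0 (/ s)) * wt s (a1 / 2) j) by (apply Rmult_le_pos; lra).
    nra.
Qed.

Lemma sup_norm_le E h M : (forall u, E u -> Cmod (h u) <= M) -> Rbar_le (sup_norm E h) M.
Proof.
  intros H. unfold sup_norm. destruct (Lub_Rbar_correct (fun r => exists u, E u /\ r = Cmod (h u))) as [_ HL].
  apply HL. intros r [u [Hu ->]]. now apply H.
Qed.

Lemma le_sup_norm E h M u : Rbar_le (sup_norm E h) (Finite M) -> E u -> Cmod (h u) <= M.
Proof.
  intros H Hu. unfold sup_norm in H.
  destruct (Lub_Rbar_correct (fun r => exists u, E u /\ r = Cmod (h u))) as [HL _].
  assert (H1 : Rbar_le (Finite (Cmod (h u))) (Finite M)).
  { eapply Rbar_le_trans; [|exact H]. apply HL. now exists u. }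
  exact H1.
Qed.

(** The coefficients of a Gevrey polyanalytic function. *)
Lemma gevrey_decay N k F : 0 < k -> gevrey_polyanalytic N k unit_disk F ->
  exists c a L, 0 < a /\ 0 <= L /\ array N 1 c /\ eq_on 1 F (pser N c) /\
    forall p j, Cmod (c p j) <= L * wt (1 + 1 / k) a j.
Proof.
  intros Hk [HF [B0 [HB0 HD]]].
  destruct (polyanalytic_expansion N F HF) as [c [Hc Hcf]].
  set (s := 1 + 1 / k) in *.
  assert (Hs : 1 <= s) by (unfold s; assert (0 < 1 / k) by (apply Rdiv_lt_0_compat; lra); lra).
  set (B := Rmax 1 B0). assert (HB1 : 1 <= B) by apply Rmax_l.
  set (V := fun n => B ^ (n + 1) * Rpower (INR n) (s * INR n)).
  assert (HV : forall n, der_bound N c n (V n)).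
  { intros n a1 a2 z Hn Hz.
    rewrite <- (pser_partial_alpha N 1 c a1 a2 Hc z Hz).
    assert (Heq : partial_alpha a1 a2 F z = partial_alpha a1 a2 (pser N c) z).
    { unfold partial_alpha. apply (iter_ext 1 partial_x a1 (partial_x_ext 1)); [|easy].
      apply (iter_ext 1 partial_y a2 (partial_y_ext 1)). exact Hcf. }
    rewrite <- Heq. eapply Rle_trans; [apply (le_sup_norm _ _ _ z (HD a1 a2)); exact Hz|].
    rewrite Hn. unfold V. apply Rmult_le_compat_r; [left; apply Rpower_pos|].
    apply pow_incr. split; [lra|apply Rmax_r]. }
  destruct (coef_of_der_bound N c V Hc) as [K [HK HKc]]; auto.
  { intros n. unfold V. apply Rmult_le_pos; [apply pow_le; lra|left; apply Rpower_pos]. }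
  { intros n n' Hn. unfold V. apply Rmult_le_compat.
    - apply pow_le; lra.
    - left; apply Rpower_pos.
    - apply Rle_pow; [easy|lia].
    - apply Rpower_self_mono; [lra|easy]. }
  destruct (decay_of_ratio_bound N s B (K * B) Hs HB1 ltac:(apply Rmult_le_pos; lra)) as [a [L [Ha [HL HH]]]].
  exists c, a, L. do 4 (split; [easy|]). intros p.
  apply (HH (fun j => Cmod (c p j))); [intros; apply Cmod_ge_0|].
  intros m l. eapply Rle_trans; [apply HKc|]. unfold V. rewrite pow_add, pow_1. right; ring.
Qed.

(** * N-analytic polynomials *)

(** Coefficients up to degree [d] only. *)
Definition truncc (d : nat) (a : nat -> C) (j : nat) : C :=
  if (j <=? d)%nat then a j else 0%C.

Lemma truncc_0 d a j : (S d <= j)%nat -> truncc d a j = 0%C.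
Proof. intros H. unfold truncc. destruct (Nat.leb_spec j d); [lia|easy]. Qed.

Lemma has_coeffs_cps Q d a z : has_coeffs Q d a -> Q z = cps (truncc d a) z.
Proof.
  intros H. rewrite H, sum_n_csum. unfold cps.
  assert (H0 : forall j, (S d <= j)%nat -> (truncc d a j * z ^ j)%C = 0%C).
  { intros j Hj. rewrite truncc_0 by easy. ring. }
  rewrite (proj2 (CSer_finite (fun j => truncc d a j * z ^ j)%C (S d) H0)).
  apply csum_ext. intros j Hj. unfold truncc. destruct (Nat.leb_spec j d); [easy|lia].
Qed.

(** The array of coefficients of an N-analytic polynomial. *)
Lemma decomp_array N P Q : (1 <= N)%nat -> analytic_decomp N P Q ->
  exists c, (forall rho, array N rho c) /\
    (forall p z, (p < N)%nat -> Q p z = cps (c p) z) /\ forall z, P z = pser N c z.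
Proof.
  intros HN [HQ HP].
  destruct (functional_choice (fun p (a : nat -> C) =>
    ((p < N)%nat -> forall z, Q p z = cps a z) /\ ((N <= p)%nat -> forall j, a j = 0%C) /\
    forall rho, Conv rho a)) as [c Hc].
  { intros p. destruct (Nat.lt_ge_cases p N) as [Hp|Hp].
    - destruct (HQ p Hp) as [d [a Ha]]. exists (truncc d a). split; [|split].
      + intros _ z. now apply has_coeffs_cps.
      + lia.
      + intros rho. apply (Conv_finite rho _ (S d)), truncc_0.
    - exists (fun _ => 0%C). split; [lia|split; [easy|]].
      intros rho. now apply (Conv_finite rho _ 0). }
  exists c. split; [|split].
  - intros rho. split; [intros p; apply Hc|]. intros p j Hp. now apply Hc.
  - intros p z Hp. now apply Hc.
  - intros z. rewrite HP, sum_n_csum. replace (S (pred N)) with N by lia.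
    apply csum_ext. intros p Hp. rewrite (proj1 (Hc p)); easy.
Qed.

Lemma pser_unique N c d : (forall rho, array N rho c) -> (forall rho, array N rho d) ->
  (forall z, pser N c z = pser N d z) -> forall p j, (p < N)%nat -> c p j = d p j.
Proof.
  intros Hc Hd H p j Hp. destruct (pser_coef_bound N) as [K [HK HH]].
  specialize (HH (alin 1 (- (1)) c d) 2 1 0 ltac:(lra) ltac:(lra) ltac:(lra)
    (array_alin _ _ _ _ _ _ (Hc 2) (Hd 2))).
  assert (E : Cmod (alin 1 (- (1)) c d p j) * 1 ^ j <= K * 0 / (2 - 1) ^ N).
  { apply HH; [|easy]. intros z Hz. rewrite (pser_lin N 2), H; auto.
    replace (1 * pser N d z + - (1) * pser N d z)%C with (RtoC 0) by ring.
    rewrite Cmod_0; lra. }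
  rewrite pow1, Rmult_1_r in E. unfold Rdiv in E. rewrite Rmult_0_r, Rmult_0_l in E.
  assert (E0 : Cmod (alin 1 (- (1)) c d p j) = 0) by (apply Rle_antisym; [easy|apply Cmod_ge_0]).
  apply Cmod_eq_0 in E0. unfold alin in E0.
  replace (c p j) with (1 * c p j + - (1) * d p j + d p j)%C by ring. rewrite E0; ring.
Qed.

Lemma analytic_poly_pser N (c : nat -> nat -> C) : (1 <= N)%nat ->
  (forall p, exists J, forall j, (J <= j)%nat -> c p j = 0%C) ->
  analytic_poly N (pser N c).
Proof.
  intros HN H. exists (fun p => cps (c p)). split.
  - intros p _. destruct (H p) as [J HJ]. exists J, (c p). intros z.
    rewrite sum_n_csum. unfold cps. apply (CSer_finite (fun j => c p j * z ^ j)%C).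
    intros j Hj. rewrite HJ by lia. ring.
  - intros z. rewrite sum_n_csum. replace (S (pred N)) with N by lia. easy.
Qed.

Lemma analytic_degree_pser N c D : (1 <= N)%nat -> (forall rho, array N rho c) ->
  (forall p j, (p < N)%nat -> c p j <> 0%C -> INR j <= D) ->
  Rbar_le (analytic_degree N (pser N c)) D.
Proof.
  intros HN Hc HD. unfold analytic_degree.
  match goal with |- Rbar_le (Lub_Rbar ?E) _ => destruct (Lub_Rbar_correct E) as [_ HL] end.
  apply HL. intros r [Q [p [d [HQ [Hp [[a [Ha Had]] ->]]]]]].
  destruct (decomp_array N _ Q HN HQ) as [c' [Hc' [HQc HPc]]].
  apply (HD p d Hp). rewrite (pser_unique N c c' Hc Hc' HPc p d Hp).
  assert (E : forall j, c' p j = truncc d a j).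
  { apply (cps_unique 1); [lra|apply Hc'|apply (Conv_finite 1 _ (S d)), truncc_0|].
    intros z _. rewrite <- HQc by easy. now apply has_coeffs_cps. }
  rewrite E. unfold truncc. now rewrite Nat.leb_refl.
Qed.

(** * Decomposition of a Gevrey polyanalytic function *)

(** Whether the exponent [j] is reached at step [n], that is [j <= n ^ s];
    none is at step [0]. *)
Definition reached (s : R) (n j : nat) : bool :=
  match n with
  | O => false
  | S _ => if Rle_dec (INR j) (Rpower (INR n) s) then true else false
  end.

(** Coefficients of the [n]-th term of the decomposition: the exponents reached
    at step [n] and not before. *)
Definition block (s : R) (c : nat -> nat -> C) (n p j : nat) : C :=
  if (reached s n j && negb (reached s (pred n) j))%bool then c p j else 0%C.

(** Coefficients of the sum of the first [n] terms. *)
Definition reached_part (s : R) (c : nat -> nat -> C) (n p j : nat) : C :=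
  if reached s n j then c p j else 0%C.

Lemma reached_S s n j : 0 < s -> reached s n j = true -> reached s (S n) j = true.
Proof.
  intros Hs. destruct n as [|n]; [easy|]. unfold reached.
  destruct (Rle_dec (INR j) (Rpower (INR (S n)) s)); [intros _|easy].
  destruct (Rle_dec (INR j) (Rpower (INR (S (S n))) s)) as [|H]; [easy|].
  exfalso. apply H. eapply Rle_trans; [eassumption|].
  apply Rle_Rpower_l; [lra|]. split; [apply lt_0_INR; lia|apply le_INR; lia].
Qed.

Lemma reached_true s n j : reached s n j = true -> INR j <= Rpower (INR n) s.
Proof.
  destruct n as [|n]; [easy|]. unfold reached.
  now destruct (Rle_dec (INR j) (Rpower (INR (S n)) s)).
Qed.

Lemma reached_false s n j : 1 <= s -> reached s n j = false ->
  INR n <= Rpower (INR (S j)) (/ s).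
Proof.
  intros Hs. destruct n as [|n]; [intros _; left; apply Rpower_pos|].
  unfold reached. destruct (Rle_dec (INR j) (Rpower (INR (S n)) s)) as [|H]; [easy|intros _].
  apply Rnot_le_lt in H.
  assert (Hn : 0 < INR (S n)) by (apply lt_0_INR; lia).
  replace (INR (S n)) with (Rpower (Rpower (INR (S n)) s) (/ s)).
  - apply Rle_Rpower_l; [left; apply Rinv_0_lt_compat; lra|]. split; [apply Rpower_pos|].
    rewrite (S_INR j). lra.
  - rewrite Rpower_mult, Rinv_r by lra. now apply Rpower_1.
Qed.

Lemma csum_block s c n p j : 0 < s ->
  csum n (fun i => block s c (S i) p j) = reached_part s c n p j.
Proof.
  intros Hs. induction n as [|n IH]; [easy|]. cbn [csum]. rewrite IH.
  unfold block, reached_part. simpl pred. assert (H := reached_S s n j Hs).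
  destruct (reached s n j).
  - rewrite (H eq_refl). simpl. ring.
  - rewrite Bool.andb_true_r. destruct (reached s (S n) j); ring.
Qed.

Lemma pser_csum N rho (c : nat -> nat -> nat -> C) n z :
  (forall i, array N rho (c i)) -> Cmod z < rho ->
  array N rho (fun p j => csum n (fun i => c i p j)) /\
  csum n (fun i => pser N (c i) z) = pser N (fun p j => csum n (fun i => c i p j)) z.
Proof.
  intros Hc Hz. induction n as [|n [IH1 IH2]].
  - split.
    + split; [intros p; now apply (Conv_finite rho _ 0)|easy].
    + simpl. symmetry. apply csum_0. intros p _. rewrite cps_0; [ring|easy].
  - assert (E : (fun p j => csum (S n) (fun i => c i p j)) =
      alin 1 1 (fun p j => csum n (fun i => c i p j)) (c n)).
    { apply functional_extensionality; intros p. apply functional_extensionality; intros j.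
      unfold alin. simpl. ring. }
    rewrite E. split; [now apply array_alin|].
    rewrite (pser_lin N rho); auto. cbn [csum]. rewrite IH2. ring.
Qed.

Lemma exp_pow x n : exp x ^ n = exp (INR n * x).
Proof.
  rewrite <- Rpower_pow by apply exp_pos. unfold Rpower. now rewrite ln_exp.
Qed.

Lemma exp_tends_0 A a eps : 0 <= A -> 0 < a -> 0 < eps ->
  exists n0, forall n, (n0 <= n)%nat -> A * exp (- a * INR n) < eps.
Proof.
  intros HA Ha He.
  assert (Hq : exp (- a) < 1) by (rewrite <- exp_0; apply exp_increasing; lra).
  assert (Hq0 := exp_pos (- a)).
  assert (HeA : 0 < eps / (A + 1)) by (apply Rdiv_lt_0_compat; lra).
  destruct (pow_lt_1_zero (exp (- a)) ltac:(rewrite Rabs_pos_eq; lra) _ HeA) as [n0 H].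
  exists n0. intros n Hn. specialize (H n Hn).
  rewrite Rabs_pos_eq in H by (apply pow_le; lra). rewrite exp_pow in H.
  replace (- a * INR n) with (INR n * - a) by ring.
  set (x := exp (INR n * - a)) in *. assert (Hx : 0 < x) by apply exp_pos.
  apply Rmult_lt_compat_l with (r := A + 1) in H; [|lra].
  replace ((A + 1) * (eps / (A + 1))) with eps in H by (field; lra). nra.
Qed.

(** With [T] the constant of [pser_wt_bound], half of the decay [a] of the
    coefficients is spent on summation over [j], and [Rad <= a / 4] leaves
    [delta = exp (- a / 4)]. *)
Lemma gevrey_decomposition N k F : (1 <= N)%nat -> 0 < k ->
  gevrey_polyanalytic N k unit_disk F ->
  exists (K Rad delta : R) (P : nat -> C -> C),
    0 < K /\ 0 < Rad /\ 0 < delta < 1 /\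
    (forall n : nat, (1 <= n)%nat -> analytic_poly N (P n)) /\
    (forall n : nat, (1 <= n)%nat ->
       Rbar_le (sup_norm (disk_kRn k Rad n) (P n)) (Finite (K * delta ^ n))) /\
    (forall z : C, unit_disk z -> is_series (fun n : nat => P (S n) z) (F z)) /\
    (forall n : nat, (1 <= n)%nat ->
       Rbar_le (analytic_degree N (P n)) (Finite (Rpower (INR n) ((k + 1) / k)))).
Proof.
  intros HN Hk HF.
  destruct (gevrey_decay N k F Hk HF) as [c [a [L [Ha [HL [Hc [HFc Hdec]]]]]]].
  set (s := 1 + 1 / k) in *.
  assert (Hik : 0 < 1 / k) by (apply Rdiv_lt_0_compat; lra).
  assert (Hs : 1 <= s) by (unfold s; lra).
  assert (Hs0 : 0 < s) by lra.
  set (Rad := Rmin 1 (a / 4)).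
  assert (HR : 0 < Rad) by (apply Rmin_pos; lra).
  assert (HR1 : Rad <= 1) by apply Rmin_l. assert (HRa : Rad <= a / 4) by apply Rmin_r.
  assert (HS1 := Series_wt_pos s (a / 2) Hs0 ltac:(lra)).
  set (T := INR N * 2 ^ N * Series (wt s (a / 2))).
  assert (HT : 0 <= T).
  { unfold T. apply Rmult_le_pos; [apply Rmult_le_pos; [apply pos_INR|apply pow_le; lra]|easy]. }
  assert (Hfin : forall n p, exists J, forall j, (J <= j)%nat -> block s c n p j = 0%C).
  { intros n p. destruct (nfloor_ex (Rpower (INR n) s) ltac:(left; apply Rpower_pos)) as [M [_ HM]].
    exists (S M). intros j Hj. unfold block. destruct (reached s n j) eqn:E; [|easy].
    apply reached_true in E. apply le_INR in Hj. rewrite S_INR in Hj. lra. }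
  assert (Hblk : forall n rho, array N rho (block s c n)).
  { intros n rho. split.
    - intros p. destruct (Hfin n p) as [J HJ]. now apply (Conv_finite rho _ J).
    - intros p j Hp. unfold block. rewrite (proj2 Hc) by easy. now destruct (_ && _)%bool. }
  exists (T * (L * exp (a / 2)) + 1), Rad, (exp (- (a / 4))), (fun n => pser N (block s c n)).
  assert (HTL : 0 <= T * (L * exp (a / 2))).
  { apply Rmult_le_pos; [easy|]. apply Rmult_le_pos; [easy|left; apply exp_pos]. }
  split; [lra|]. split; [easy|]. split; [split; [apply exp_pos|]|].
  { rewrite <- exp_0. apply exp_increasing. lra. }
  split; [|split; [|split]].
  - intros n _. apply (analytic_poly_pser N (block s c n) HN), Hfin.
  - intros n Hn. apply sup_norm_le. intros z Hz.
    assert (Hn0 : 0 < INR n) by (apply lt_0_INR; lia).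
    assert (Hn1 : 1 <= INR n) by now apply (le_INR 1).
    set (x := Rpower (INR n) (- (1 / k))).
    change (Cmod z < 1 + Rad * x) in Hz.
    assert (Hx : 0 < x) by apply Rpower_pos.
    assert (Hx1 : x <= 1).
    { unfold x. apply Rle_trans with (Rpower (INR n) 0); [apply Rle_Rpower; lra|rewrite Rpower_O; lra]. }
    apply Rle_trans with (T * (L * exp (a / 2) * exp (- (a / 4)) ^ n)).
    2:{ rewrite <- Rmult_assoc. apply Rmult_le_compat_r; [|lra]. apply pow_le; left; apply exp_pos. }
    apply pser_wt_bound; try lra.
    { apply Rmult_le_pos; [apply Rmult_le_pos; [easy|left; apply exp_pos]|].
      apply pow_le; left; apply exp_pos. }
    { nra. }
    intros p j _. unfold block.
    assert (Hw := wt_pos s (a / 2) j).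
    assert (Hrhs : 0 <= L * exp (a / 2) * exp (- (a / 4)) ^ n * wt s (a / 2) j).
    { apply Rmult_le_pos; [|lra]. apply Rmult_le_pos; [|apply pow_le; left; apply exp_pos].
      apply Rmult_le_pos; [easy|left; apply exp_pos]. }
    destruct (reached s n j) eqn:E1; [|simpl; rewrite Cmod_0; lra].
    destruct (reached s (pred n) j) eqn:E2; [simpl; rewrite Cmod_0; lra|]. simpl.
    apply reached_true in E1. apply reached_false in E2; [|easy].
    assert (Hpn : INR (pred n) = INR n - 1).
    { replace n with (S (pred n)) at 2 by lia. rewrite S_INR. ring. }
    assert (Hzj : Cmod z ^ j <= exp (Rad * INR n)).
    { apply Rle_trans with (exp (Rad * x) ^ j).
      - apply pow_incr. split; [apply Cmod_ge_0|].
        assert (H := exp_ineq1_le (Rad * x)). lra.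
      - rewrite exp_pow. apply exp_le.
        assert (Ex : Rpower (INR n) s * x = INR n).
        { unfold x. rewrite <- Rpower_plus. unfold s.
          replace (1 + 1 / k + - (1 / k)) with 1 by ring. now apply Rpower_1. }
        replace (Rad * INR n) with (Rpower (INR n) s * (Rad * x))
          by (transitivity (Rad * (Rpower (INR n) s * x)); [ring|now rewrite Ex]).
        apply Rmult_le_compat_r; [|easy]. apply Rmult_le_pos; lra. }
    apply Rle_trans with (L * wt s a j * exp (Rad * INR n)).
    { apply Rmult_le_compat; auto; [apply Cmod_ge_0|apply pow_le, Cmod_ge_0]. }
    rewrite wt_half, exp_pow.
    assert (HE : exp (- (a / 2) * Rpower (INR (S j)) (/ s)) * exp (Rad * INR n) <=
      exp (a / 2) * exp (INR n * - (a / 4))).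
    { rewrite <- !exp_plus. apply exp_le.
      assert (Rad * INR n <= a / 4 * INR n) by (apply Rmult_le_compat_r; lra). nra. }
    replace (L * (wt s (a / 2) j * exp (- (a / 2) * Rpower (INR (S j)) (/ s))) * exp (Rad * INR n))
      with (L * wt s (a / 2) j * (exp (- (a / 2) * Rpower (INR (S j)) (/ s)) * exp (Rad * INR n))) by ring.
    replace (L * exp (a / 2) * exp (INR n * - (a / 4)) * wt s (a / 2) j) with
      (L * wt s (a / 2) j * (exp (a / 2) * exp (INR n * - (a / 4)))) by ring.
    apply Rmult_le_compat_l; [apply Rmult_le_pos; lra|easy].
  - intros z Hz. apply Clim_is_series. intros eps He.
    destruct (exp_tends_0 (T * L) (a / 2) eps ltac:(now apply Rmult_le_pos) ltac:(lra) He) as [n0 Hn0].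
    exists n0. intros n Hn. eapply Rle_lt_trans; [|apply (Hn0 n Hn)].
    destruct (pser_csum N 1 (fun i => block s c (S i)) n z (fun i => Hblk (S i) 1) Hz) as [Har E].
    rewrite (HFc z Hz), E.
    replace (pser N (fun p j => csum n (fun i => block s c (S i) p j)) z - pser N c z)%C with
      (pser N (alin 1 (- (1)) (fun p j => csum n (fun i => block s c (S i) p j)) c) z).
    2:{ rewrite (pser_lin N 1); auto. ring. }
    change (Cmod z < 1) in Hz.
    rewrite Rmult_assoc. apply pser_wt_bound; try lra.
    { apply Rmult_le_pos; [easy|left; apply exp_pos]. }
    intros p j _. unfold alin. rewrite csum_block by easy. unfold reached_part.
    assert (Hw := wt_pos s (a / 2) j).
    assert (Hzj : 0 <= Cmod z ^ j <= 1).
    { split; [apply pow_le, Cmod_ge_0|]. rewrite <- (pow1 j). apply pow_incr.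
      split; [apply Cmod_ge_0|lra]. }
    destruct (reached s n j) eqn:E1.
    + replace (1 * c p j + - (1) * c p j)%C with (RtoC 0) by ring. rewrite Cmod_0, Rmult_0_l.
      apply Rmult_le_pos; [apply Rmult_le_pos; [easy|left; apply exp_pos]|lra].
    + replace (1 * 0 + - (1) * c p j)%C with (- c p j)%C by ring. rewrite Cmod_opp.
      apply reached_false in E1; [|easy].
      assert (Hcp := Cmod_ge_0 (c p j)).
      apply Rle_trans with (Cmod (c p j)); [nra|]. eapply Rle_trans; [apply Hdec|].
      rewrite wt_half.
      assert (exp (- (a / 2) * Rpower (INR (S j)) (/ s)) <= exp (- (a / 2) * INR n)).
      { apply exp_le. nra. }
      rewrite (Rmult_comm (wt s (a / 2) j)), <- Rmult_assoc.
      apply Rmult_le_compat_r; [lra|]. now apply Rmult_le_compat_l.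
  - intros n Hn. apply (analytic_degree_pser N (block s c n) _ HN (Hblk n)).
    intros p j _ Hne. replace ((k + 1) / k) with s by (unfold s; field; lra).
    apply reached_true. unfold block in Hne. now destruct (reached s n j).
Qed.

(** * Sums of N-analytic polynomials *)

(** The two cases are [n >= (j + 1) ^ (1 / s)], where the first factor is
    small, and [n < (j + 1) ^ (1 / s)], where the second one is. *)
Lemma geometric_wt k a b n j : 0 < k -> 0 < a -> 0 < b <= 1 -> (1 <= n)%nat ->
  exp (- a * INR n) * / (1 + b * Rpower (INR n) (- (1 / k))) ^ j <=
  exp 1 * wt (1 + 1 / k) (Rmin a (b / 2)) j.
Proof.
  intros Hk Ha Hb Hn.
  assert (Hik : 0 < 1 / k) by (apply Rdiv_lt_0_compat; lra).
  set (s := 1 + 1 / k). assert (Hs : 0 < s) by (unfold s; lra).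
  assert (Hn0 : 0 < INR n) by (apply lt_0_INR; lia).
  assert (Hn1 : 1 <= INR n) by now apply (le_INR 1).
  set (q := Rpower (INR n) (- (1 / k))). assert (Hq : 0 < q) by apply Rpower_pos.
  assert (Hq1 : q <= 1).
  { unfold q. apply Rle_trans with (Rpower (INR n) 0); [apply Rle_Rpower; lra|rewrite Rpower_O; lra]. }
  set (x := b * q). assert (Hx : 0 < x <= 1) by (unfold x; nra).
  assert (H1 : / (1 + x) <= exp (- (x / 2))).
  { assert (H := exp_ineq1_le (- (x / 2))). eapply Rle_trans; [|exact H].
    apply Rmult_le_reg_l with (1 + x); [lra|]. rewrite Rinv_r by lra. nra. }
  assert (H2 : / (1 + x) ^ j <= exp (- (x / 2) * INR j)).
  { rewrite <- pow_inv. rewrite Rmult_comm, <- exp_pow. apply pow_incr. split; [|easy].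
    left. apply Rinv_0_lt_compat. lra. }
  apply Rle_trans with (exp (- a * INR n) * exp (- (x / 2) * INR j)).
  { apply Rmult_le_compat_l; [left; apply exp_pos|easy]. }
  unfold wt. rewrite <- !exp_plus. apply exp_le.
  set (m := Rmin a (b / 2)). assert (Hm1 : m <= a) by apply Rmin_l.
  assert (Hm2 : m <= b / 2) by apply Rmin_r. assert (Hm : 0 < m) by (apply Rmin_pos; lra).
  set (X := INR (S j)). assert (HX : X = INR j + 1) by apply S_INR.
  assert (HX0 : 0 < X) by (apply lt_0_INR; lia).
  set (y := Rpower X (/ s)). assert (Hy : 0 < y) by apply Rpower_pos.
  assert (Hj : 0 <= INR j) by apply pos_INR.
  destruct (Rle_lt_dec y (INR n)) as [Hyn|Hyn].
  - assert (m * y <= a * INR n) by (apply Rmult_le_compat; lra).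
    assert (0 <= x / 2 * INR j) by (apply Rmult_le_pos; lra). lra.
  - assert (Hqy : Rpower y (- (1 / k)) <= q).
    { unfold q. rewrite !Rpower_Ropp. apply Rinv_le_contravar; [apply Rpower_pos|].
      apply Rle_Rpower_l; lra. }
    assert (HyX : X * Rpower y (- (1 / k)) = y).
    { replace X with (Rpower y s).
      - rewrite <- Rpower_plus. unfold s. replace (1 + 1 / k + - (1 / k)) with 1 by ring.
        now apply Rpower_1.
      - unfold y. rewrite Rpower_mult, Rinv_l by lra. now apply Rpower_1. }
    assert (H3 : y <= X * q) by (rewrite <- HyX; apply Rmult_le_compat_l; lra).
    assert (H4 : m * y <= b / 2 * (X * q)) by (apply Rmult_le_compat; lra).
    assert (0 <= a * INR n) by (apply Rmult_le_pos; lra).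
    replace (b / 2 * (X * q)) with (x / 2 * (INR j + 1)) in H4 by (unfold x; rewrite HX; field).
    lra.
Qed.

Lemma poly_exp_bound r a : 0 < a -> exists A, 0 < A /\
  forall n, (1 <= n)%nat -> Rpower (INR n) r * exp (- a * INR n) <= A.
Proof.
  intros Ha. destruct (nfloor_ex (Rabs r) (Rabs_pos r)) as [m [_ Hm]].
  exists (Rpower (1 / a) 1 ^ S m * Rpower (INR (S m)) (1 * INR (S m))). split.
  { apply Rmult_lt_0_compat; [apply pow_lt|]; apply Rpower_pos. }
  intros n Hn.
  assert (Hn0 : 0 < INR n) by (apply lt_0_INR; lia).
  assert (Hn1 : 1 <= INR n) by now apply (le_INR 1).
  assert (P := pow_exp_bound 1 a (INR n) (S m) ltac:(lra) Ha Hn0).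
  rewrite Rinv_1, Rpower_1 in P by easy. eapply Rle_trans; [|exact P].
  apply Rmult_le_compat_r; [left; apply exp_pos|].
  rewrite <- Rpower_pow by easy. apply Rle_Rpower; [easy|].
  rewrite S_INR. assert (H := Rle_abs r). lra.
Qed.

(** Coefficients of the terms: geometric in [n] and stretched exponential in
    [j]. *)
Lemma coef_decay_of_bound N k Rad delta K : 0 < k -> 0 < Rad -> 0 < delta < 1 -> 0 < K ->
  exists a b L, 0 < a /\ 0 < b /\ 0 <= L /\ forall n c, (1 <= n)%nat ->
    (forall rho, array N rho c) ->
    (forall z, disk_kRn k Rad n z -> Cmod (pser N c z) <= K * delta ^ n) ->
    forall p j, (p < N)%nat -> Cmod (c p j) <= L * exp (- b * INR n) * wt (1 + 1 / k) a j.
Proof.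
  intros Hk HR Hd HK.
  assert (Hik : 0 < 1 / k) by (apply Rdiv_lt_0_compat; lra).
  (* [2 * b <= 1] keeps the radii at most [2]; the radii [1 + b * q] and
     [1 + 2 * b * q], with [q = n ^ (- 1 / k)], are compared *)
  set (b := Rmin 1 Rad / 2).
  assert (Hb : 0 < b <= 1 / 2).
  { unfold b. assert (0 < Rmin 1 Rad) by (apply Rmin_pos; lra). assert (H1 := Rmin_l 1 Rad). lra. }
  assert (HbR : 2 * b <= Rad) by (unfold b; assert (H1 := Rmin_r 1 Rad); lra).
  set (th := - ln delta).
  assert (Hth : 0 < th) by (unfold th; assert (H := ln_increasing delta 1); rewrite ln_1 in H; lra).
  destruct (pser_coef_bound N) as [K1 [HK1 HB]].
  destruct (poly_exp_bound (INR N * (1 / k)) (th / 4)) as [A [HA HAn]]; [lra|].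
  assert (HbN : 0 < b ^ N) by now apply pow_lt.
  exists (Rmin (th / 4) (b / 2)), (th / 2), (K1 * K / b ^ N * A * exp 1).
  split; [apply Rmin_pos; lra|]. split; [lra|]. split.
  { repeat apply Rmult_le_pos; try lra.
    - left; now apply Rinv_0_lt_compat.
    - left; apply exp_pos. }
  intros n c Hn Hc HM p j Hp.
  assert (Hn0 : 0 < INR n) by (apply lt_0_INR; lia).
  assert (Hn1 : 1 <= INR n) by now apply (le_INR 1).
  set (q := Rpower (INR n) (- (1 / k))). assert (Hq : 0 < q) by apply Rpower_pos.
  assert (Hq1 : q <= 1).
  { unfold q. apply Rle_trans with (Rpower (INR n) 0); [apply Rle_Rpower; lra|rewrite Rpower_O; lra]. }
  assert (Hbq : 0 < b * q <= b) by nra.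
  assert (H := HB c (1 + 2 * b * q) (1 + b * q) (K * delta ^ n) ltac:(lra) ltac:(lra) ltac:(lra)
    (Hc _)).
  assert (Hz : forall z, Cmod z < 1 + 2 * b * q -> Cmod (pser N c z) <= K * delta ^ n).
  { intros z Hz. apply HM. unfold disk_kRn, disk. fold q. nra. }
  specialize (H Hz p j Hp). clear Hz.
  replace (1 + 2 * b * q - (1 + b * q)) with (b * q) in H by ring.
  rewrite Rpow_mult_distr in H.
  assert (Hdn : delta ^ n = exp (- (th / 4) * INR n) * exp (- (th / 4) * INR n) * exp (- (th / 2) * INR n)).
  { rewrite <- !exp_plus, <- Rpower_pow by lra. unfold Rpower, th. f_equal. field. }
  assert (HqN : / q ^ N = Rpower (INR n) (INR N * (1 / k))).
  { rewrite <- pow_inv. unfold q. rewrite Rpower_Ropp, Rinv_inv, <- Rpower_pow by apply Rpower_pos.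
    rewrite Rpower_mult. f_equal; ring. }
  set (D := (1 + b * q) ^ j) in *. assert (HD : 0 < D) by (apply pow_lt; lra).
  assert (G := geometric_wt k (th / 4) b n j Hk ltac:(lra) ltac:(lra) Hn). fold q in G. fold D in G.
  specialize (HAn n Hn). rewrite <- HqN in HAn.
  set (E := exp (- (th / 4) * INR n)) in *. set (E2 := exp (- (th / 2) * INR n)) in *.
  set (W := wt _ _ j) in *.
  assert (HqN0 : 0 < q ^ N) by now apply pow_lt.
  assert (HE : 0 < E) by apply exp_pos. assert (HE2 : 0 < E2) by apply exp_pos.
  apply Rle_trans with (K1 * K / b ^ N * E2 * ((/ q ^ N * E) * (E * / D))).
  - apply Rmult_le_reg_r with D; [easy|]. eapply Rle_trans; [exact H|]. rewrite Hdn.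
    right. field. repeat split; lra.
  - replace (K1 * K / b ^ N * A * exp 1 * E2 * W) with (K1 * K / b ^ N * E2 * (A * (exp 1 * W))) by ring.
    apply Rmult_le_compat_l.
    + repeat apply Rmult_le_pos; try lra. left; now apply Rinv_0_lt_compat.
    + apply Rmult_le_compat; auto.
      * apply Rmult_le_pos; [left; now apply Rinv_0_lt_compat|lra].
      * apply Rmult_le_pos; [lra|left; now apply Rinv_0_lt_compat].
Qed.

Lemma gevrey_sum N k (f : nat -> C -> C) K Rad delta : (1 <= N)%nat -> 0 < k ->
  (forall n : nat, (1 <= n)%nat -> analytic_poly N (f n)) ->
  0 < K -> 0 < Rad -> 0 < delta < 1 ->
  (forall n : nat, (1 <= n)%nat ->
     Rbar_le (sup_norm (disk_kRn k Rad n) (f n)) (Finite (K * delta ^ n))) ->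
  exists g : C -> C, gevrey_polyanalytic N k unit_disk g /\ series_CVU_on unit_disk f g.
Proof.
  intros HN Hk Hf HK HR Hd HM.
  assert (Hik : 0 < 1 / k) by (apply Rdiv_lt_0_compat; lra).
  destruct (coef_decay_of_bound N k Rad delta K Hk HR Hd HK) as [a [b [L [Ha [Hb [HL HB]]]]]].
  set (s := 1 + 1 / k) in *. assert (Hs : 0 < s) by (unfold s; lra).
  destruct (functional_choice (fun n (c : nat -> nat -> C) =>
    (forall rho, array N rho c) /\ forall z, f (S n) z = pser N c z)) as [c Hc].
  { intros n. destruct (Hf (S n) ltac:(lia)) as [Q HQ].
    destruct (decomp_array N _ Q HN HQ) as [c [H1 [_ H2]]]. now exists c. }
  set (q := exp (- b)).
  assert (Hq : 0 < q < 1).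
  { split; [apply exp_pos|]. rewrite <- exp_0. apply exp_increasing. lra. }
  assert (Hdec : forall n p j, Cmod (c n p j) <= q ^ S n * (L * wt s a j)).
  { intros n p j. assert (Hw := wt_pos s a j). destruct (Hc n) as [H1 H2].
    destruct (Nat.lt_ge_cases p N) as [Hp|Hp].
    - replace (q ^ S n) with (exp (- b * INR (S n))) by (unfold q; rewrite exp_pow; f_equal; ring).
      rewrite <- Rmult_assoc, (Rmult_comm (exp _)).
      apply (HB (S n) (c n)); auto; [lia|].
      intros z Hz. rewrite <- H2. apply (le_sup_norm _ _ _ z (HM (S n) ltac:(lia))). exact Hz.
    - rewrite (proj2 (H1 1)), Cmod_0 by easy. apply Rmult_le_pos; [apply pow_le; lra|].
      apply Rmult_le_pos; lra. }
  assert (Hgeo : ex_series (fun n => q ^ n)) by (apply ex_series_geom; rewrite Rabs_pos_eq; lra).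
  assert (HG : Series (fun n => q ^ n) = / (1 - q)) by (apply Series_geom; rewrite Rabs_pos_eq; lra).
  assert (HG0 : 0 < / (1 - q)) by (apply Rinv_0_lt_compat; lra).
  (* tails of the series of coefficients *)
  assert (Htail : forall m p j, Cmod (CSer (fun n => c (m + n)%nat p j)) <=
    q ^ m * (L / (1 - q)) * wt s a j).
  { intros m p j. assert (Hw := wt_pos s a j).
    replace (q ^ m * (L / (1 - q)) * wt s a j) with
      (Series (fun n => q ^ m * (L * wt s a j) * q ^ n)).
    2:{ rewrite Series_scal_l. replace (Series _) with (/ (1 - q)) by (symmetry; exact HG). unfold Rdiv. ring. }
    apply CSer_bound_le; [|now apply ex_series_Rscal]. intros n.
    eapply Rle_trans; [apply Hdec|].
    replace (q ^ m * (L * wt s a j) * q ^ n) with (q ^ (m + n) * (L * wt s a j)) by (rewrite pow_add; ring).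
    apply Rmult_le_compat_r; [apply Rmult_le_pos; lra|]. simpl.
    assert (0 < q ^ (m + n)) by (apply pow_lt; lra). nra. }
  assert (Hsum : forall p j, asum (fun n => c n p j)).
  { intros p j. apply asum_le with (fun n => L * wt s a j * q ^ n); [|now apply ex_series_Rscal].
    intros n. eapply Rle_trans; [apply Hdec|]. simpl.
    assert (0 < q ^ n) by (apply pow_lt; lra).
    assert (0 <= L * wt s a j) by (apply Rmult_le_pos; [easy|left; apply wt_pos]).
    assert (0 <= q ^ n * (L * wt s a j)) by (apply Rmult_le_pos; lra). nra. }
  set (L' := L / (1 - q)).
  assert (HL' : 0 <= L') by (apply Rmult_le_pos; lra).
  set (d := fun p j => CSer (fun n => c n p j)).
  assert (Hd1 : forall p j, Cmod (d p j) <= L' * wt s a j).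
  { intros p j. assert (H := Htail O p j). simpl in H. rewrite Rmult_1_l in H. exact H. }
  assert (Hd0 : forall p j, (N <= p)%nat -> d p j = 0%C).
  { intros p j Hp. apply (CSer_finite (fun n => c n p j) 0).
    intros n _. now apply (proj2 (proj1 (Hc n) 1)). }
  assert (Hda : array N 1 d) by now apply (array_wt N s a d L').
  exists (pser N d). split; [split|].
  - now apply (pser_polyanalytic N 1 d).
  - destruct (gevrey_of_decay N s a d L' HN Hs Ha HL' (fun p j _ => Hd1 p j) Hd0) as [B [HB0 HBB]].
    exists B. split; [easy|]. intros a1 a2. apply sup_norm_le. intros z Hz.
    rewrite (pser_partial_alpha N 1 d a1 a2 Hda z Hz). now apply HBB.
  - intros eps He.
    set (T := INR N * 2 ^ N * Series (wt s a)).
    assert (HT : 0 <= T).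
    { unfold T. apply Rmult_le_pos; [|now apply Series_wt_pos].
      apply Rmult_le_pos; [apply pos_INR|apply pow_le; lra]. }
    destruct (exp_tends_0 (T * L') b eps ltac:(now apply Rmult_le_pos) Hb He) as [n0 Hn0].
    exists n0. intros n Hn z Hz. eapply Rle_lt_trans; [|apply (Hn0 n Hn)].
    assert (E1 : sum_n_m (fun j => f j z) 1 n = csum n (fun i => pser N (c i) z)).
    { clear Hn. induction n as [|n IH].
      - rewrite sum_n_m_zero by lia. easy.
      - rewrite sum_n_Sm by lia. rewrite IH, (proj2 (Hc n)). easy. }
    rewrite E1.
    destruct (pser_csum N 1 c n z (fun i => proj1 (Hc i) 1) Hz) as [Har E].
    rewrite E.
    replace (pser N (fun p j => csum n (fun i => c i p j)) z - pser N d z)%C with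
      (pser N (alin 1 (- (1)) (fun p j => csum n (fun i => c i p j)) d) z).
    2:{ rewrite (pser_lin N 1); auto. ring. }
    change (Cmod z < 1) in Hz.
    rewrite Rmult_assoc. apply pser_wt_bound; try lra.
    { apply Rmult_le_pos; [easy|left; apply exp_pos]. }
    intros p j _. unfold alin, d. rewrite (CSer_incr_n _ n (Hsum p j)).
    set (S1 := csum n _). set (S2 := CSer _).
    replace (1 * S1 + - (1) * (S1 + S2))%C with (- S2)%C by ring. rewrite Cmod_opp.
    assert (H := Htail n p j). fold S2 in H. fold L' in H.
    replace (q ^ n) with (exp (- b * INR n)) in H by (unfold q; rewrite exp_pow; f_equal; ring).
    assert (Hzj : 0 <= Cmod z ^ j <= 1).
    { split; [apply pow_le, Cmod_ge_0|]. rewrite <- (pow1 j). apply pow_incr.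
      split; [apply Cmod_ge_0|lra]. }
    assert (Hcp := Cmod_ge_0 S2).
    apply Rle_trans with (Cmod S2); [nra|]. rewrite (Rmult_comm L'). exact H.
Qed.

Theorem mainTheorem1 (N : nat) (k : R) (hN : (1 <= N)%nat) (hk : 0 < k) :
  (forall F : C -> C,
     gevrey_polyanalytic N k unit_disk F ->
     exists (K Rad delta : R) (P : nat -> C -> C),
       0 < K /\ 0 < Rad /\ 0 < delta < 1 /\
       (forall n : nat, (1 <= n)%nat -> analytic_poly N (P n)) /\
       (forall n : nat, (1 <= n)%nat ->
          Rbar_le (sup_norm (disk_kRn k Rad n) (P n)) (Finite (K * delta ^ n))) /\
       (forall z : C, unit_disk z ->
          is_series (fun n : nat => P (S n) z) (F z)) /\
       (forall n : nat, (1 <= n)%nat ->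
          Rbar_le (analytic_degree N (P n))
            (Finite (Rpower (INR n) ((k + 1) / k)))))
  /\
  (forall (f : nat -> C -> C) (K Rad delta : R),
     (forall n : nat, (1 <= n)%nat -> analytic_poly N (f n)) ->
     0 < K -> 0 < Rad -> 0 < delta < 1 ->
     (forall n : nat, (1 <= n)%nat ->
        Rbar_le (sup_norm (disk_kRn k Rad n) (f n)) (Finite (K * delta ^ n))) ->
     exists g : C -> C,
       gevrey_polyanalytic N k unit_disk g /\ series_CVU_on unit_disk f g).
Proof.
  split.
  - intros F HF. now apply gevrey_decomposition.
  - intros f K Rad delta Hf HK HR Hd HM. now apply (gevrey_sum N k f K Rad delta).
Qed.
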